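(* There exists a universal constant $c > 0$ such that, for every $n \ge 1$, every Gaussian vector $X = (X_i)_{1 \le i \le n}$ with covariance kernel $K(i,j) = \mathrm{Cov}[X_i,X_j]$, all $I_1, I_2 \subseteq \{1,\ldots,n\}$, all increasing events $A_1 \in \sigma(I_1)$ and $A_2 \in \sigma(I_2)$, and all $\varepsilon > 0$, $$(1)\qquad \mathbb{P}[X \in A_1 \cap A_2] - \mathbb{P}[X + \varepsilon \in A_1]\,\mathbb{P}[X + \varepsilon \in A_2] \le \frac{c\, \|K_{I_1,I_2}\|_\infty}{\varepsilon^2},$$ and $$(2)\qquad \mathbb{P}[X - \varepsilon \in A_1]\,\mathbb{P}[X - \varepsilon \in A_2] - \mathbb{P}[X \in A_1 \cap A_2] \le \frac{c\, \|K_{I_1,I_2}\|_\infty}{\varepsilon^2}.$$ Moreover, if $K_{I_1,I_2} \ge 0$ (entrywise) then (1) holds with $c = 1$ and (2) holds with $c = 0$.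
   Context: Gaussian vectors are not assumed centred or non-degenerate. For a real number $a$, $X + a$ denotes $X + a\mathbf{1}$, where $\mathbf{1}$ is the vector of ones. For $I, J \subseteq \{1,\ldots,n\}$, $K_{I,J} = (K(i,j))_{i \in I, j \in J}$, and $\|K_{I,J}\|_\infty = \max_{i \in I, j \in J} |K(i,j)|$. An event $A$ is a Borel subset of $\mathbb{R}^n$. It is increasing if $\{X \in A\} \subseteq \{X + v \in A\}$ for every $v \in \mathbb{R}^n$ with $v \ge 0$ coordinatewise (i.e. $x \in A$ implies $x + v \in A$). It is supported on $I \subseteq \{1,\ldots,n\}$, written $A \in \sigma(I)$, if $\{X \in A\} = \{X + v \in A\}$ for every $v \in \mathbb{R}^n$ with $v|_I = 0$ (i.e. $x \in A$ if and only if $x+v \in A$). *)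

(* Defs.v *)
From HB Require Import structures.
From mathcomp Require Import all_boot all_order all_algebra.
From mathcomp Require Import all_classical all_reals all_analysis.

Set Implicit Arguments.
Unset Strict Implicit.
Unset Printing Implicit Defensive.

Import Order.TTheory GRing.Theory Num.Theory.
Import numFieldNormedType.Exports.

Local Open Scope classical_set_scope.
Local Open Scope ring_scope.

(* The library's [normal_prob m 0] is a junk value (the uniform law on [0, 1]);
   here the normal law with standard deviation 0 is the Dirac mass at [m]. *)
Definition normal_law (R : realType) (m s : R) : set R -> \bar R :=
  if s == 0 then (\d_m : set R -> \bar R) else normal_prob m s.

Definition random_vector (d : measure_display) (T : measurableType d)
    (R : realType) (P : probability T R) (n : nat)
    (X : 'I_n -> {RV P >-> R}) (w : T) : 'rV[R]_n :=
  \row_i X i w.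

Definition gaussian_vector (d : measure_display) (T : measurableType d)
    (R : realType) (P : probability T R) (n : nat)
    (X : 'I_n -> {RV P >-> R}) : Prop :=
  forall a : 'I_n -> R, exists m s : R, 0 <= s /\
    forall B : set R, measurable B ->
      P [set w | B (\sum_i a i * X i w)] = normal_law m s B.

(* [fine] loses nothing for Gaussian vectors, whose covariances are finite. *)
Definition cov_kernel (d : measure_display) (T : measurableType d)
    (R : realType) (P : probability T R) (n : nat)
    (X : 'I_n -> {RV P >-> R}) : 'M[R]_n :=
  \matrix_(i, j) fine (covariance P (X i) (X j)).

(* Equal to 0 when [I] or [J] is empty. *)
Definition block_norm (R : realType) (n : nat) (K : 'M[R]_n)
    (I J : {set 'I_n}) : R :=
  \big[Num.max/0]_(i in I) \big[Num.max/0]_(j in J) `|K i j|.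

Definition borel_event (R : realType) (n : nat) (A : set 'rV[R]_n) : Prop :=
  <<s [set U : set 'rV[R]_n | open U] >> A.

Definition increasing_event (R : realType) (n : nat) (A : set 'rV[R]_n) : Prop :=
  forall x v : 'rV[R]_n, (forall i, 0 <= v 0 i) -> A x -> A (x + v).

Definition supported_on (R : realType) (n : nat) (I : {set 'I_n})
    (A : set 'rV[R]_n) : Prop :=
  forall x v : 'rV[R]_n, (forall i, i \in I -> v 0 i = 0) ->
    (A x <-> A (x + v)).

(* P[X + a 1 \in A] *)
Definition shift_prob (d : measure_display) (T : measurableType d)
    (R : realType) (P : probability T R) (n : nat)
    (X : 'I_n -> {RV P >-> R}) (a : R) (A : set 'rV[R]_n) : \bar R :=
  P [set w | A (random_vector X w + const_mx a)].

Definition upper_decoupling (d : measure_display) (T : measurableType d)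
    (R : realType) (P : probability T R) (n : nat)
    (X : 'I_n -> {RV P >-> R}) (I1 I2 : {set 'I_n})
    (A1 A2 : set 'rV[R]_n) (eps c : R) : Prop :=
  (P [set w | (A1 `&` A2) (random_vector X w)]
     - shift_prob X eps A1 * shift_prob X eps A2
   <= (c * block_norm (cov_kernel X) I1 I2 / eps ^+ 2)%:E)%E.

Definition lower_decoupling (d : measure_display) (T : measurableType d)
    (R : realType) (P : probability T R) (n : nat)
    (X : 'I_n -> {RV P >-> R}) (I1 I2 : {set 'I_n})
    (A1 A2 : set 'rV[R]_n) (eps c : R) : Prop :=
  (shift_prob X (- eps) A1 * shift_prob X (- eps) A2
     - P [set w | (A1 `&` A2) (random_vector X w)]
   <= (c * block_norm (cov_kernel X) I1 I2 / eps ^+ 2)%:E)%E.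

(* Main.v *)
Require Import Defs.
From HB Require Import structures.
From mathcomp Require Import all_boot all_order all_algebra.
From mathcomp Require Import all_classical all_reals all_analysis.
From mathcomp Require Import measurable_realfun ring lra.
Import Order.TTheory GRing.Theory Num.Theory.
Import numFieldNormedType.Exports.
Local Open Scope classical_set_scope.
Local Open Scope ring_scope.

Set Implicit Arguments.
Unset Strict Implicit.
Unset Printing Implicit Defensive.

(** The proof compares Gaussian pairs with different cross-covariances.

    Heights.  An increasing event A that is neither empty nor full is replaced
    by its height T, where T x is the supremum of the s such that x - s 1 still
    lies in A.  The height is increasing, Lipschitz, depends on the same
    coordinates as A and satisfies T (x + s 1) = T x + s.  So shifting a
    Gaussian vector by a constant shifts T, and the indicator of A lies between
    two ramps, that is, bounded Lipschitz increasing functions of T.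

    Comparison ([block_slepian]).  Let (U, V) and (U', V') be Gaussian pairs of
    vectors with the same marginal covariances, the cross-covariance of the
    first being entrywise at most that of the second.  Then
    E f(U) g(V) <= E f(U') g(V') for increasing f and g.  Interpolate between
    the two pairs and move the cross-covariance by small amounts h D with
    D >= 0.  Up to a noise of variance of order h, one such move replaces two
    independent noises, one in each block, by noises that are increasing
    functions of the same standard Gaussian vector; by the inequality of
    Chebyshev and Harris ([associated_prod]) it can only raise the expectation.
    The laws met on the way are identified by their cosine transforms
    ([gauss_same_law]), which avoids densities and covers degenerate
    covariances.

    Decoupling.  Let k be the norm of K on I1 x I2, X' an independent copy of
    X, and Z, Z' independent standard normal variables.  The vectors
    X + sqrt k Z and X + sqrt k Z' have cross-covariance K, while X + sqrt k Z
    and X' + sqrt k Z (respectively X' - sqrt k Z) have cross-covariance k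
    (respectively - k), with the same marginals.  The comparison therefore
    bounds the joint expectation of two ramps by that of a pair which is
    independent except for one normal variable.  Removing the scalar noises
    costs at most 4 k / delta^2 by Chebyshev for ramps of width delta, and the
    successive enlargements of the events amount to a shift by 3 delta.  With
    epsilon = 3 delta this gives the constant 36.

    Nonnegative covariances.  Comparing X with independent copies is then
    possible without noise ([association_positive]), and gives the second
    inequality with constant 0.  For the first one, let phi be epsilon times a
    ramp of width epsilon, and Psi t the expectation of t + sqrt k Z truncated
    at a high level epsilon + delta.  Both Psi and Psi - theta phi are
    increasing, where theta <= 1 tends to 1 as delta grows, so association
    applied twice bounds theta^2 Cov (phi (T1 X), phi (T2 X)) by
    Cov (Psi (T1 X), Psi (T2 X)).  By the comparison again, the latter is at
    most the covariance of two 1-Lipschitz functions of sqrt k Z, hence at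
    most k.  Since epsilon^2 (P(A1 and A2) - P(A1 - epsilon) P(A2 - epsilon))
    is at most the covariance of the phi's, the constant 1 follows as theta
    tends to 1. *)

(** * Expectations of bounded measurable functions *)

Definition bmeas {d} {T : measurableType d} {R : realType} (f : T -> R) : Prop :=
  measurable_fun setT f /\ exists C : R, forall x, `|f x| <= C.

Section BoundedMeasurable.
Context d (T : measurableType d) (R : realType).
Implicit Types f g : T -> R.

Lemma bmeas_cst (c : R) : bmeas (fun _ : T => c).
Proof. by split; [exact: measurable_cst | exists `|c|]. Qed.

Lemma bmeasD f g : bmeas f -> bmeas g -> bmeas (fun x => f x + g x).
Proof.
move=> [mf [C hC]] [mg [D hD]]; split; first exact: measurable_funD.
by exists (C + D) => x; apply: (le_trans (ler_normD _ _)); exact: lerD.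
Qed.

Lemma bmeasN f : bmeas f -> bmeas (fun x => - f x).
Proof.
move=> [mf [C hC]]; split; last by exists C => x; rewrite normrN.
exact: measurableT_comp.
Qed.

Lemma bmeasB f g : bmeas f -> bmeas g -> bmeas (fun x => f x - g x).
Proof. by move=> bf bg; apply: bmeasD => //; exact: bmeasN. Qed.

Lemma bmeasM f g : bmeas f -> bmeas g -> bmeas (fun x => f x * g x).
Proof.
move=> [mf [C hC]] [mg [D hD]]; split; first exact: measurable_funM.
by exists (C * D) => x; rewrite normrM ler_pM.
Qed.

Lemma bmeasZ c f : bmeas f -> bmeas (fun x => c * f x).
Proof. by move=> bf; apply: bmeasM => //; exact: bmeas_cst. Qed.

Lemma bmeas_cos f : measurable_fun setT f -> bmeas (fun x => cos (f x)).
Proof.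
move=> mf; split.
  by apply: (measurableT_comp _ mf); apply: continuous_measurable_fun; exact: continuous_cos.
by exists 1 => x; rewrite ler_norml cos_geN1 cos_le1.
Qed.

Lemma bmeas_indic (A : set T) : measurable A -> bmeas (\1_A : T -> R).
Proof.
move=> mA; split; first exact: measurable_indic.
by exists 1 => x; rewrite indicE; case: (_ \in _); rewrite ?normr1 ?normr0.
Qed.

Lemma bmeas_comp d' (T' : measurableType d') (phi : T -> T') (f : T' -> R) :
  measurable_fun setT phi -> bmeas f -> bmeas (fun x => f (phi x)).
Proof.
move=> mphi [mf [C hC]]; split; first exact: (measurableT_comp mf).
by exists C.
Qed.

End BoundedMeasurable.

Section Expectation.
Context d (T : measurableType d) (R : realType) (P : probability T R).
Implicit Types f g : T -> R.

Lemma bmeas_integrable f : bmeas f -> P.-integrable setT (EFin \o f).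
Proof.
move=> [mf [C hC]]; apply: (@le_integrable _ _ _ P _ measurableT _ (fun=> C%:E)).
- exact/measurable_EFinP.
- by move=> x _ /=; rewrite lee_fin (le_trans (hC x))// ler_norm.
- exact: finite_measure_integrable_cst.
Qed.

Lemma Ex_cst c : \int[P]_x c = c.
Proof. by rewrite Rintegral_cst// [X in fine X]probability_setT mulr1. Qed.

Lemma ExD f g : bmeas f -> bmeas g ->
  \int[P]_x (f x + g x) = \int[P]_x f x + \int[P]_x g x.
Proof. by move=> bf bg; apply: RintegralD => //; exact: bmeas_integrable. Qed.

Lemma ExB f g : bmeas f -> bmeas g ->
  \int[P]_x (f x - g x) = \int[P]_x f x - \int[P]_x g x.
Proof. by move=> bf bg; apply: RintegralB => //; exact: bmeas_integrable. Qed.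

Lemma ExZ c f : bmeas f -> \int[P]_x (c * f x) = c * \int[P]_x f x.
Proof. by move=> bf; apply: RintegralZl => //; exact: bmeas_integrable. Qed.

Lemma ExZr c f : bmeas f -> \int[P]_x (f x * c) = \int[P]_x f x * c.
Proof. by move=> bf; apply: RintegralZr => //; exact: bmeas_integrable. Qed.

Lemma le_Ex f g : bmeas f -> bmeas g -> (forall x, f x <= g x) ->
  \int[P]_x f x <= \int[P]_x g x.
Proof.
by move=> bf bg fg; apply: le_Rintegral => //; exact: bmeas_integrable.
Qed.

Lemma eq_Ex f g : f =1 g -> \int[P]_x f x = \int[P]_x g x.
Proof. by move=> fg; apply: eq_Rintegral => x _; exact: fg. Qed.

Lemma Ex_norm_le f C : bmeas f -> (forall x, `|f x| <= C) -> `|\int[P]_x f x| <= C.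
Proof.
move=> bf hC; rewrite ler_norml -[X in X <= _ <= _](Ex_cst (- C)) -[X in _ <= _ <= X](Ex_cst C).
have hx x : - C <= f x <= C by rewrite -ler_norml.
by apply/andP; split; apply: le_Ex => //; try exact: bmeas_cst; move=> x; have /andP[] := hx x.
Qed.

Lemma Ex_indic (A : set T) : measurable A -> (\int[P]_x \1_A x)%:E = P A.
Proof.
move=> mA; rewrite /Rintegral integral_indic// setIT fineK//.
exact: fin_num_measure.
Qed.

(** Bounded convergence: on a probability space a constant is an integrable
    majorant.  The boundedness of the limit comes for free and is needed to go
    on working with it. *)
Lemma Ex_cvg (f_ : nat -> T -> R) f C :
  (forall n, measurable_fun setT (f_ n)) -> (forall n x, `|f_ n x| <= C) ->
  (forall x, f_ ^~ x @ \oo --> f x) ->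
  bmeas f /\ (\int[P]_x f_ n x) @[n --> \oo] --> \int[P]_x f x.
Proof.
move=> mf_ hC cf.
have C0 (x : T) : 0 <= C by exact: le_trans (normr_ge0 _) (hC 0%N x).
have mf : measurable_fun setT f by apply: (measurable_fun_cvg mf_).
have bf : bmeas f.
  split=> //; exists C => x.
  have : `|f_ n x| @[n --> \oo] --> `|f x| by apply: cvg_norm; exact: cf.
  by move=> h; apply: (cvgr_to_le h); apply: nearW => n; exact: hC.
split=> //.
apply: fine_cvg; rewrite fineK; last exact: integrable_fin_num (bmeas_integrable bf).
apply: (@dominated_cvg _ _ _ P _ measurableT (fun n x => (f_ n x)%:E) (fun x => (f x)%:E) (fun=> C%:E)).
- by move=> n; exact/measurable_EFinP.
- by move=> x _; apply: cvg_EFin; [exact: nearW | exact: cf].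
- by [].
- exact: finite_measure_integrable_cst.
- by move=> n x _; rewrite /= lee_fin.
Qed.

End Expectation.

Definition prodP {d1 d2} {T1 : measurableType d1} {T2 : measurableType d2} {R : realType}
  (P1 : probability T1 R) (P2 : probability T2 R) : probability (T1 * T2)%type R :=
  (P1 \x P2)%E.

Section Fubini.
Context d1 d2 (T1 : measurableType d1) (T2 : measurableType d2) (R : realType).
Variables (P1 : probability T1 R) (P2 : probability T2 R).

Lemma bmeas_pair1 (f : T1 * T2 -> R) x : bmeas f -> bmeas (fun y => f (x, y)).
Proof.
by move=> bf; apply: (bmeas_comp _ bf); exact: pair1_measurable.
Qed.

Lemma bmeas_pair2 (f : T1 * T2 -> R) y : bmeas f -> bmeas (fun x => f (x, y)).
Proof.
by move=> bf; apply: (bmeas_comp _ bf); exact: pair2_measurable.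
Qed.

Lemma bmeas_Ex1 (f : T1 * T2 -> R) : bmeas f -> bmeas (fun x => \int[P2]_y f (x, y)).
Proof.
move=> bf; split; last first.
  have [_ [C hC]] := bf; exists C => x; apply: Ex_norm_le => //.
  exact: bmeas_pair1.
have := @measurable_fubini_F _ _ _ _ _ P1 P2 _ (bmeas_integrable (prodP P1 P2) bf).
by move=> h; exact: (measurableT_comp (fine_measurable measurableT) h).
Qed.

Lemma bmeas_Ex2 (f : T1 * T2 -> R) : bmeas f -> bmeas (fun y => \int[P1]_x f (x, y)).
Proof.
move=> bf; split; last first.
  have [_ [C hC]] := bf; exists C => x; apply: Ex_norm_le => //.
  exact: bmeas_pair2.
have := @measurable_fubini_G _ _ _ _ _ P1 P2 _ (bmeas_integrable (prodP P1 P2) bf).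
by move=> h; exact: (measurableT_comp (fine_measurable measurableT) h).
Qed.

Lemma Ex_prod1 (f : T1 * T2 -> R) : bmeas f ->
  \int[prodP P1 P2]_z f z = \int[P1]_x \int[P2]_y f (x, y).
Proof.
move=> bf; rewrite /Rintegral -(integral12_prod_meas1 (bmeas_integrable (prodP P1 P2) bf)).
congr fine; apply: eq_integral => x _; rewrite fineK//.
exact: integrable_fin_num (bmeas_integrable _ (bmeas_pair1 x bf)).
Qed.

Lemma Ex_prod2 (f : T1 * T2 -> R) : bmeas f ->
  \int[prodP P1 P2]_z f z = \int[P2]_y \int[P1]_x f (x, y).
Proof.
move=> bf; rewrite /Rintegral -(integral21_prod_meas1 (bmeas_integrable (prodP P1 P2) bf)).
congr fine; apply: eq_integral => x _; rewrite fineK//.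
exact: integrable_fin_num (bmeas_integrable _ (bmeas_pair2 x bf)).
Qed.

End Fubini.

Section ProductIntegrals.
Context d1 d2 (T1 : measurableType d1) (T2 : measurableType d2) (R : realType).
Variables (P1 : probability T1 R) (P2 : probability T2 R).

Lemma Ex_prodM (f : T1 -> R) (g : T2 -> R) : bmeas f -> bmeas g ->
  \int[prodP P1 P2]_z (f z.1 * g z.2) = (\int[P1]_x f x) * (\int[P2]_y g y).
Proof.
move=> bf bg.
have b1 : bmeas (fun z : T1 * T2 => f z.1) by exact: (bmeas_comp measurable_fst bf).
have b2 : bmeas (fun z : T1 * T2 => g z.2) by exact: (bmeas_comp measurable_snd bg).
rewrite (Ex_prod1 P1 P2 (bmeasM b1 b2)) -(ExZr P1 _ bf).
by apply: eq_Ex => x; exact: (ExZ P2 (f x) bg).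
Qed.

Lemma Ex_prod_fst (f : T1 -> R) : bmeas f ->
  \int[prodP P1 P2]_z f z.1 = \int[P1]_x f x.
Proof.
move=> bf; have := Ex_prodM bf (bmeas_cst T2 1); rewrite Ex_cst mulr1 => <-.
by apply: eq_Ex => z; rewrite mulr1.
Qed.

Lemma Ex_prod_snd (g : T2 -> R) : bmeas g ->
  \int[prodP P1 P2]_z g z.2 = \int[P2]_y g y.
Proof.
move=> bg; have := Ex_prodM (bmeas_cst T1 1) bg; rewrite Ex_cst mul1r => <-.
by apply: eq_Ex => z; rewrite mul1r.
Qed.

End ProductIntegrals.

(** * Moments and cosine transform of the normal law *)

Section NormalLaw.
Variables (R : realType) (m s : R).
Hypothesis s0 : s != 0.
Local Notation mu := (@lebesgue_measure R).
Local Notation p := (normal_pdf m s).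
Local Notation nu := (normal_prob m s).

(** The Radon-Nikodym derivative of the normal law agrees with its density only
    almost everywhere, which is enough under an integral. *)
Lemma ge0_integral_normal_prob (f : R -> \bar R) :
  measurable_fun setT f -> (forall x, 0 <= f x)%E ->
  (\int[nu]_x f x = \int[mu]_x (f x * (p x)%:E))%E.
Proof.
move=> mf f0.
have nm := normal_prob_dominates m s.
rewrite -(Radon_Nikodym_SigmaFinite.change_of_variables nm f0)//.
apply: ae_eq_integral => //.
- apply: emeasurable_funM => //.
  exact: measurable_int (Radon_Nikodym_SigmaFinite.f_integrable nm).
- by apply: emeasurable_funM => //; apply/measurable_EFinP; exact: measurable_normal_pdf.
apply: ae_eqe_mul2l; apply: integral_ae_eq => //.
- exact: (Radon_Nikodym_SigmaFinite.f_integrable nm).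
- by apply/measurable_EFinP; exact: measurable_normal_pdf.
by move=> E _ mE; rewrite -Radon_Nikodym_SigmaFinite.f_integral.
Qed.

Lemma integrable_normal_prob (f : R -> R) : measurable_fun setT f ->
  mu.-integrable setT (fun x => (f x * p x)%:E) ->
  nu.-integrable setT (EFin \o f).
Proof.
move=> mf /integrableP[mfp fp]; apply/integrableP; split; first exact/measurable_EFinP.
rewrite ge0_integral_normal_prob//; last first.
  by apply: measurableT_comp => //; exact/measurable_EFinP.
apply: le_lt_trans fp; rewrite le_eqVlt; apply/orP; left; apply/eqP.
apply: eq_integral => x _ /=; rewrite normrM (ger0_norm (normal_pdf_ge0 _ _ _)).
by rewrite EFinM.
Qed.

Lemma Rintegral_normal_prob (f : R -> R) : measurable_fun setT f ->
  mu.-integrable setT (fun x => (f x * p x)%:E) ->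
  \int[nu]_x f x = \int[mu]_x (f x * p x).
Proof.
move=> mf ifp; congr fine.
have mfE : measurable_fun setT (EFin \o f) by exact/measurable_EFinP.
rewrite integralE [RHS]integralE; congr (_ - _)%E.
  rewrite ge0_integral_normal_prob//; last exact: measurable_funepos.
  apply: eq_integral => x _; rewrite !funeposE/= -!EFin_max -EFinM; congr EFin.
  by rewrite maxr_pMl ?normal_pdf_ge0// mul0r.
rewrite ge0_integral_normal_prob//; last exact: measurable_funeneg.
apply: eq_integral => x _; rewrite !funenegE/= -!EFin_max -EFinM; congr EFin.
by rewrite maxr_pMl ?normal_pdf_ge0// mul0r mulNr.
Qed.

(* The ratio between a quadratic times the density and the density of twice
   the variance is bounded by this constant: every integrability question below
   is settled by comparison with a wider Gaussian density. *)
Let K := normal_peak s * (1 + 4 * s ^+ 2) / normal_peak (Num.sqrt 2 * s).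
Let p2 := normal_pdf m (Num.sqrt 2 * s).

Let s20 : Num.sqrt 2 * s != 0 :> R.
Proof. by rewrite mulf_neq0// sqrtr_eq0 -ltNge. Qed.

Let pE x : p x = normal_peak s * expR (- (x - m) ^+ 2 / (s ^+ 2 *+ 2)).
Proof. by rewrite normal_pdfE. Qed.

Let p2E x : p2 x = normal_peak (Num.sqrt 2 * s) * expR (- (x - m) ^+ 2 / (4 * s ^+ 2)).
Proof.
rewrite /p2 normal_pdfE// /normal_fun exprMn sqr_sqrtr//; congr (_ * expR (_ / _)).
by rewrite -mulr_natl; ring.
Qed.

Let dom x : (1 + (x - m) ^+ 2) * p x <= K * p2 x.
Proof.
set a := (x - m) ^+ 2 / (4 * s ^+ 2).
have ss : 0 < s ^+ 2 by rewrite exprn_even_gt0.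
have pk2 : 0 < normal_peak (Num.sqrt 2 * s) by exact: normal_peak_gt0.
have a0 : 0 <= a by rewrite divr_ge0 ?sqr_ge0// mulr_ge0// ltW.
have E1 : expR (- (x - m) ^+ 2 / (s ^+ 2 *+ 2)) = expR (- a) * expR (- a).
  by rewrite -expRD; congr expR; rewrite /a -mulr_natl; field.
have E2 : expR (- (x - m) ^+ 2 / (4 * s ^+ 2)) = expR (- a) by rewrite /a mulNr.
have E3 : K * p2 x = normal_peak s * (1 + 4 * s ^+ 2) * expR (- a).
  by rewrite /K p2E E2; field; rewrite gt_eqF.
have E4 : (x - m) ^+ 2 = 4 * s ^+ 2 * a by rewrite /a; field.
rewrite E3 pE E1 E4.
have ea : (1 + a) * expR (- a) <= 1.
  by rewrite expRN ler_pdivrMr ?expR_gt0// mul1r expR_ge1Dx.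
have := normal_peak_ge0 s; set k := normal_peak s => k0.
have e0 : 0 <= expR (- a) by exact: expR_ge0.
have h : (1 + 4 * s ^+ 2 * a) * expR (- a) <= 1 + 4 * s ^+ 2.
  apply: (@le_trans _ _ ((1 + 4 * s ^+ 2) * ((1 + a) * expR (- a)))).
    rewrite [leRHS]mulrA ler_wpM2r//; nra.
  by rewrite ger_pMr//; nra.
have := ler_wpM2l (mulr_ge0 k0 e0) h; lra.
Qed.

Let K_ge0 : 0 <= K.
Proof. by rewrite /K divr_ge0 ?mulr_ge0 ?normal_peak_ge0// addr_ge0// mulr_ge0// sqr_ge0. Qed.

Let integrable_dom (f : R -> R) C : measurable_fun setT f ->
  (forall x, `|f x| <= C * (1 + (x - m) ^+ 2)) ->
  mu.-integrable setT (fun x => (f x * p x)%:E).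
Proof.
move=> mf fC.
have i2 : mu.-integrable setT (fun x => ((C * K) * p2 x)%:E).
  exact: (integrableZl measurableT (C * K) (integrable_normal_pdf m (Num.sqrt 2 * s))).
apply: (le_integrable measurableT _ _ i2).
  by apply/measurable_EFinP; apply: measurable_funM => //; exact: measurable_normal_pdf.
move=> x _ /=; rewrite lee_fin.
have C0 : 0 <= C.
  have := le_trans (normr_ge0 _) (fC x); rewrite pmulr_lge0// ltr_wpDr ?sqr_ge0//.
rewrite normrM (ger0_norm (normal_pdf_ge0 _ _ _)).
apply: (le_trans (ler_wpM2r (normal_pdf_ge0 _ _ _) (fC x))).
apply: (le_trans _ (ler_norm _)); rewrite -mulrA -[leLHS]mulrA.
exact: ler_wpM2l.
Qed.

Section Stein.
Variables (H H' : R -> R) (C : R).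
Hypothesis dH : forall x, is_derive x (1 : R) H (H' x).
Hypothesis cH' : continuous H'.
Hypothesis HC : forall x, `|H x| <= C * (1 + `|x - m|).
Hypothesis H'C : forall x, `|H' x| <= C.

(* [g * p] is the derivative of [H * p]. *)
Let g x := H' x - H x * (x - m) / s ^+ 2.

Let cH : continuous H.
Proof. by move=> x; apply: differentiable_continuous; apply/derivable1_diffP; case: (dH x). Qed.

Let cg : continuous g.
Proof.
move=> x; rewrite /g; apply: cvgB; first exact: cH'.
apply: cvgM; last exact: cvg_cst.
by apply: cvgM; [exact: cH | apply: cvgB; [exact: cvg_id | exact: cvg_cst]].
Qed.

Let C0 : 0 <= C. Proof. exact: le_trans (normr_ge0 _) (H'C 0). Qed.

Let abs_sqr (y : R) : (1 + `|y|) * `|y| <= 2 * (1 + y ^+ 2).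
Proof.
have -> : y ^+ 2 = `|y| ^+ 2 by rewrite real_normK// num_real.
by have := normr_ge0 y; set a := `|y| => a0; have := sqr_ge0 (a - 1); nra.
Qed.

Let gC x : `|g x| <= (C + 2 * C / s ^+ 2) * (1 + (x - m) ^+ 2).
Proof.
have ss : 0 < s ^+ 2 by rewrite exprn_even_gt0.
rewrite /g (le_trans (ler_normB _ _))// mulrDl lerD//.
  by rewrite (le_trans (H'C x))// ler_peMr// lerDl sqr_ge0.
rewrite normrM normfV (ger0_norm (ltW ss)) [leRHS]mulrAC ler_wpM2r ?invr_ge0 ?(ltW ss)// normrM.
have := ler_wpM2r (normr_ge0 (x - m)) (HC x); have := ler_wpM2l C0 (abs_sqr (x - m)); lra.
Qed.

Let igp : mu.-integrable setT (fun x => (g x * p x)%:E).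
Proof.
by apply: (integrable_dom _ gC); exact: continuous_measurable_fun cg.
Qed.

Let dHp x : is_derive x (1 : R) (fun x => H x * p x) (g x * p x).
Proof.
have dp : is_derive x (1 : R) p (- (x - m) / s ^+ 2 * p x).
  have -> : p = (fun x => normal_peak s * expR (- (x - m) ^+ 2 / (s ^+ 2 *+ 2))).
    by apply/funext => ?; exact: pE.
  apply: is_derive_eq.
  rewrite /GRing.scale/= -mulr_natl.
  by field.
apply: is_derive_eq; rewrite /GRing.scale/= /g.
by field.
Qed.

Let cHp : continuous (fun x => H x * p x).
Proof.
move=> x; apply: differentiable_continuous; apply/derivable1_diffP.
by case: (dHp x).
Qed.

Let FTC n : \int[mu]_(x in `[m - n.+1%:R, m + n.+1%:R]) (g x * p x) =
  H (m + n.+1%:R) * p (m + n.+1%:R) - H (m - n.+1%:R) * p (m - n.+1%:R).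
Proof.
have ab : m - n.+1%:R < m + n.+1%:R by rewrite ltrD2l gtrN.
rewrite /Rintegral (continuous_FTC2 (F := fun x => H x * p x) ab)//.
- apply: continuous_subspaceT => x; apply: cvgM; first exact: cg.
  exact: continuous_normal_pdf.
- split.
  + by move=> x _; case: (dHp x).
  + by apply: cvg_at_right_filter; exact: cHp.
  + by apply: cvg_at_left_filter; exact: cHp.
- by move=> x _; rewrite derive1E; case: (dHp x).
Qed.

Let decay y n : `|y - m| = n.+1%:R -> `|H y * p y| <= 2 * C * (K * normal_peak (Num.sqrt 2 * s)) * n.+1%:R^-1.
Proof.
move=> yn; rewrite ler_pdivlMr// -yn normrM (ger0_norm (normal_pdf_ge0 _ _ _)).
have := ler_wpM2r (normr_ge0 (y - m)) (ler_wpM2r (normal_pdf_ge0 m s y) (HC y)).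
move=> /le_trans; apply.
have h1 : (1 + (y - m) ^+ 2) * p y <= K * normal_peak (Num.sqrt 2 * s).
  apply: le_trans (dom y) _; apply: ler_wpM2l => //; exact: normal_pdf_ub.
have h2 := ler_wpM2r (normal_pdf_ge0 m s y) (abs_sqr (y - m)).
have := ler_wpM2l C0 h2; have := ler_wpM2l C0 h1.
lra.
Qed.

(** Stein's identity.  By the fundamental theorem of calculus the integral over
    the interval of radius n around m is a boundary term, which tends to 0
    because [H] grows at most linearly. *)
Lemma stein : mu.-integrable setT (fun x => (g x * p x)%:E) /\
  \int[mu]_x (g x * p x) = 0.
Proof.
split; first exact: igp.
pose I n : set R := `[m - n.+1%:R, m + n.+1%:R]%classic.
pose f_ n x := (g x * p x) * \1_(I n) x.
have cv : (\int[mu]_x f_ n x) @[n --> \oo] --> \int[mu]_x (g x * p x).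
  apply: fine_cvg; rewrite fineK; last exact: integrable_fin_num igp.
  have mgp : measurable_fun setT (fun x => g x * p x).
    by case/integrableP : igp => /measurable_EFinP.
  apply: (@dominated_cvg _ _ _ mu _ measurableT (fun n x => (f_ n x)%:E) (fun x => (g x * p x)%:E) (fun x => `|g x * p x|%:E)).
  - by move=> n; apply/measurable_EFinP; apply: measurable_funM => //; apply: measurable_indic; exact: measurable_itv.
  - move=> x _; apply: cvg_EFin; first exact: nearW.
    apply: cvg_near_cst.
    near=> n.
    rewrite /= /f_ indicE mem_set ?mulr1// /I/= in_itv/= -ler_distl.
    have : `|x - m| <= n%:R by near: n; exact: (nbhs_infty_ger _).
    by move=> h; rewrite (le_trans h)// ler_nat.
  - by [].
  - exact: (integrable_abse igp).
  - move=> n x _; rewrite /= lee_fin normrM ler_piMr// indicE.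
    by case: (_ \in _); rewrite ?normr1 ?normr0.
have c0 : (\int[mu]_x f_ n x) @[n --> \oo] --> (0 : R).
  apply/cvgr0Pnorm_le => e e0.
  pose D := 2 * C * (K * normal_peak (Num.sqrt 2 * s)).
  near=> n.
  have -> : \int[mu]_x f_ n x = \int[mu]_(x in I n) (g x * p x).
    by rewrite [RHS]Rintegral_mkcond; apply: eq_Rintegral => x _; rewrite /f_ patchE indicE; case: ifP => _; rewrite ?mulr1 ?mulr0.
  rewrite FTC.
  have h1 := @decay (m + n.+1%:R) n; have h2 := @decay (m - n.+1%:R) n.
  rewrite (le_trans (ler_normB _ _))//.
  apply: (@le_trans _ _ (D * n.+1%:R^-1 + D * n.+1%:R^-1)).
    rewrite lerD//; [apply: h1|apply: h2].
      by rewrite addrAC subrr add0r ger0_norm.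
    by rewrite addrAC subrr add0r normrN ger0_norm.
  rewrite -mulrDl ler_pdivrMr// mulrC -ler_pdivrMr//.
  have : (D + D) / e <= n%:R by near: n; exact: (nbhs_infty_ger _).
  by move=> h; rewrite (le_trans h)// ler_nat.
exact: (cvg_unique _ cv c0).
Unshelve. all: by end_near. Qed.

End Stein.

Let measurable_center : measurable_fun setT (fun x : R => x - m).
Proof. exact: measurable_funB. Qed.

(** Stein's identity for the constant function 1. *)
Lemma normal_mean : nu.-integrable setT (EFin \o (fun x => x - m)) /\
  \int[nu]_x (x - m) = 0.
Proof.
have [] := @stein (fun=> 1) (fun=> 0) 1.
- by move=> ?; exact: cvg_cst.
- by move=> x; rewrite normr1 mul1r lerDl.
- by move=> x; rewrite normr0.
move=> i1 e1.
have E x : (x - m) * p x = (- s ^+ 2) * ((0 - 1 * (x - m) / s ^+ 2) * p x) by field.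
have i2 : mu.-integrable setT (fun x => ((x - m) * p x)%:E).
  by under eq_fun do rewrite E EFinM; exact: integrableZl.
split; first exact: integrable_normal_prob.
rewrite Rintegral_normal_prob//.
under eq_Rintegral do rewrite E.
by rewrite RintegralZl// e1 mulr0.
Qed.

(** Stein's identity for the function x - m. *)
Lemma normal_second_moment : nu.-integrable setT (EFin \o (fun x => (x - m) ^+ 2)) /\
  \int[nu]_x (x - m) ^+ 2 = s ^+ 2.
Proof.
have [] := @stein (fun x => x - m) (fun=> 1) 1.
- by move=> x; apply: is_derive_eq; rewrite subr0.
- by move=> ?; exact: cvg_cst.
- by move=> x; rewrite mul1r lerDr.
- by move=> x; rewrite normr1.
move=> i1 e1.
have ip := integrable_normal_pdf m s.
have E x : (x - m) ^+ 2 * p x = s ^+ 2 * (p x - (1 - (x - m) * (x - m) / s ^+ 2) * p x) by field.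
have i3 : mu.-integrable setT (fun x => (p x - (1 - (x - m) * (x - m) / s ^+ 2) * p x)%:E).
  by under eq_fun do rewrite EFinB; exact: integrableB.
have i2 : mu.-integrable setT (fun x => ((x - m) ^+ 2 * p x)%:E).
  by under eq_fun do rewrite E EFinM; exact: integrableZl.
have m2 : measurable_fun setT (fun x : R => (x - m) ^+ 2) by exact: measurable_funX.
split; first exact: integrable_normal_prob.
rewrite Rintegral_normal_prob//.
under eq_Rintegral do rewrite E.
rewrite RintegralZl// RintegralB// e1 subr0.
by rewrite /Rintegral integral_normal_pdf/= mulr1.
Qed.

(** As a function of the frequency v, the left-hand side phi satisfies
    phi' = - s^2 v phi: differentiate under the integral and apply Stein's
    identity to a sine.  Hence phi v * exp (s^2 v^2 / 2) is constant. *)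
Lemma normal_cos u b :
  \int[nu]_x cos (u * (x - m) + b) = cos b * expR (- (s ^+ 2 * u ^+ 2 / 2)).
Proof.
pose f u x : R := cos (u * (x - m) + b).
have marg v : measurable_fun setT (fun x : R => v * (x - m) + b).
  by apply: measurable_funD => //; exact: measurable_funM.
have bf v : bmeas (f v) by apply: bmeas_cos.
pose phi v := \int[nu]_x f v x.
have df v x : is_derive v (1 : R) (f ^~ x) (- ((x - m) * sin (v * (x - m) + b))).
  rewrite /f; apply: is_derive_eq.
  by rewrite /GRing.scale/=; ring.
have [inorm _] := normal_mean.
have vI v : (`]v - 1, v + 1[%classic : set R) v.
  by rewrite /= in_itv/= gtrBl ltrDl ltr01.
have intf v w : (`]v - 1, v + 1[%classic : set R) w -> nu.-integrable setT (EFin \o f w).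
  by move=> _; have := bmeas_integrable nu (bf w); exact.
have derf v w x : (`]v - 1, v + 1[%classic : set R) w -> setT x -> derivable (f ^~ x) w 1.
  by move=> _ _; case: (df w x).
have G0 x : 0 <= `|x - m| by [].
have Gub v w x : (`]v - 1, v + 1[%classic : set R) w -> setT x ->
    `|partial1of2 f w x| <= `|x - m|.
  move=> _ _; rewrite partial1of2E; case: (df w x) => _ ->.
  by rewrite normrN normrM ler_piMr// ler_norml sin_geN1 sin_le1.
have iG := integrable_abse inorm.
have dphi v : is_derive v (1 : R) phi (- (s ^+ 2 * v) * phi v).
  apply: DeriveDef.
    exact: (derivable_under_integral measurableT (vI v) (intf v) (derf v) G0 iG (Gub v)).
  rewrite -derive1E (differentiation_under_integral measurableT (vI v) (intf v) (derf v) G0 iG (Gub v)).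
  have [] := @stein (fun x => sin (v * (x - m) + b)) (fun x => v * cos (v * (x - m) + b)) (1 + `|v|).
  - by move=> x; apply: is_derive_eq; rewrite /GRing.scale/=; ring.
  - move=> x; apply: cvgM; first exact: cvg_cst.
    apply: continuous_comp; last exact: continuous_cos.
    apply: cvgD; last exact: cvg_cst.
    apply: cvgM; first exact: cvg_cst.
    by apply: cvgB; [exact: cvg_id | exact: cvg_cst].
  - move=> x; have h : `|sin (v * (x - m) + b)| <= 1 by rewrite ler_norml sin_geN1 sin_le1.
    rewrite (le_trans h)//; have := normr_ge0 v; have := normr_ge0 (x - m); nra.
  - move=> x; have h : `|cos (v * (x - m) + b)| <= 1 by rewrite ler_norml cos_geN1 cos_le1.
    rewrite normrM; have := normr_ge0 v; have := normr_ge0 (cos (v * (x - m) + b)); nra.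
  pose g x := (v * cos (v * (x - m) + b) - sin (v * (x - m) + b) * (x - m) / s ^+ 2) * p x.
  rewrite -/(g _) => ig eg.
  have ifp : mu.-integrable setT (fun x => (f v x * p x)%:E).
    apply: (@integrable_dom _ 1); first exact: (bf v).1.
    move=> x; rewrite mul1r; have h : `|f v x| <= 1 by rewrite ler_norml cos_geN1 cos_le1.
    by rewrite (le_trans h)// lerDl sqr_ge0.
  have E x : partial1of2 f v x * p x = s ^+ 2 * (g x - v * (f v x * p x)).
    rewrite partial1of2E; case: (df v x) => _ ->.
    by rewrite /g /f; field.
  have iv : mu.-integrable setT (fun x => (v * (f v x * p x))%:E).
    by under eq_fun do rewrite EFinM; exact: integrableZl.
  have igv : mu.-integrable setT (fun x => (g x - v * (f v x * p x))%:E).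
    by under eq_fun do rewrite EFinB; exact: integrableB.
  have idp : mu.-integrable setT (fun x => (partial1of2 f v x * p x)%:E).
    by under eq_fun do rewrite E EFinM; exact: integrableZl.
  have mp1 : measurable_fun setT (partial1of2 f v).
    rewrite (_ : partial1of2 f v = fun x => - ((x - m) * sin (v * (x - m) + b))).
      apply: measurableT_comp => //; apply: measurable_funM => //.
      apply: (measurableT_comp _ (marg v)).
      by apply: continuous_measurable_fun; exact: continuous_sin.
    by apply/funext => x; rewrite partial1of2E; case: (df v x) => _ ->.
  rewrite (Rintegral_normal_prob mp1 idp).
  under eq_Rintegral do rewrite E.
  rewrite RintegralZl// RintegralB// eg RintegralZl// sub0r.
  rewrite /phi Rintegral_normal_prob//; last exact: (bf v).1.
  by ring.
pose psi v := phi v * expR (s ^+ 2 * v ^+ 2 / 2).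
have dpsi v : is_derive v (1 : R) psi 0.
  have hp := dphi v.
  apply: is_derive_eq; rewrite /GRing.scale/=.
  by field.
have := is_derive_0_is_cst u 0 dpsi; rewrite /psi expr0n/= mulr0 mul0r expR0 mulr1.
have -> : phi 0 = cos b.
  rewrite /phi /f; under eq_Rintegral do rewrite mul0r add0r.
  exact: Ex_cst.
by move=> <-; rewrite expRN mulfK// gt_eqF// expR_gt0.
Qed.
End NormalLaw.

(** A form of the normal law whose type shows that it is a probability, so that
    results on arbitrary probabilities apply to it.  It is the normal law only
    when [s != 0]. *)
Definition gauss_prob (R : realType) (m s : R) : probability _ R := normal_prob m s.

Lemma gauss_prob_mean (R : realType) (m s : R) : s != 0 ->
  (gauss_prob m s).-integrable setT (EFin \o (fun x => x - m)) /\
  \int[gauss_prob m s]_x (x - m) = 0.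
Proof. by move=> s0; have := normal_mean m s0; exact. Qed.

Lemma gauss_prob_second_moment (R : realType) (m s : R) : s != 0 ->
  (gauss_prob m s).-integrable setT (EFin \o (fun x => (x - m) ^+ 2)) /\
  \int[gauss_prob m s]_x (x - m) ^+ 2 = s ^+ 2.
Proof. by move=> s0; have := normal_second_moment m s0; exact. Qed.

Lemma gauss_prob_cos (R : realType) (m s u b : R) : s != 0 ->
  \int[gauss_prob m s]_x cos (u * (x - m) + b) = cos b * expR (- (s ^+ 2 * u ^+ 2 / 2)).
Proof. by move=> s0; have := normal_cos m s0 u b; exact. Qed.

(** * Centred Gaussian vectors *)

(** Centred Gaussian vectors of covariance [S], through their characteristic
    function: the free phase [b] makes cosines carry its real and its imaginary
    part at once.  No density is involved, so singular [S] are included. *)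
Definition gauss {d} {T : measurableType d} {R : realType} (P : probability T R)
    (N : nat) (W : T -> 'rV[R]_N) (S : 'M[R]_N) : Prop :=
  (forall i, measurable_fun setT (fun w => W w 0 i)) /\
  forall (a : 'cV[R]_N) (b : R),
    \int[P]_w cos ((W w *m a) 0 0 + b) =
    cos b * expR (- ((a^T *m S *m a) 0 0 / 2)).

Lemma measurable_lin d (T : measurableType d) (R : realType) N M (W : T -> 'rV[R]_N) (L : 'M[R]_(N, M)) i j :
  (forall k, measurable_fun setT (fun w => W w 0 k)) ->
  measurable_fun setT (fun w => (W w *m L) i j).
Proof.
move=> mW; under eq_fun do rewrite mxE.
apply: measurable_sum => k; apply: measurable_funM => //.
by rewrite (ord1 i); exact: mW.
Qed.

Section GaussTheory.
Context d (T : measurableType d) (R : realType) (P : probability T R).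

Lemma gauss_mulmx N M (W : T -> 'rV[R]_N) S (L : 'M[R]_(N, M)) :
  gauss P W S -> gauss P (fun w => W w *m L) (L^T *m S *m L).
Proof.
move=> [mW cW]; split; first by move=> i; exact: measurable_lin.
move=> a b; under eq_Rintegral do rewrite -mulmxA.
by rewrite cW trmx_mul !mulmxA.
Qed.

Lemma gauss_prod d' (T' : measurableType d') (P' : probability T' R) N M
  (W : T -> 'rV[R]_N) (W' : T' -> 'rV[R]_M) S S' :
  gauss P W S -> gauss P' W' S' ->
  gauss (prodP P P') (fun z => row_mx (W z.1) (W' z.2)) (block_mx S 0 0 S').
Proof.
move=> [mW cW] [mW' cW']; split.
  move=> i; case: (split_ordP i) => j ->.
    by under eq_fun do rewrite row_mxEl; exact: measurableT_comp (mW j) measurable_fst.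
  by under eq_fun do rewrite row_mxEr; exact: measurableT_comp (mW' j) measurable_snd.
move=> a b.
have E z : (row_mx (W z.1) (W' z.2) *m a) 0 0 = (W z.1 *m usubmx a) 0 0 + (W' z.2 *m dsubmx a) 0 0.
  by rewrite -{1}(vsubmxK a) mul_row_col mxE.
under eq_Rintegral do rewrite E.
rewrite Ex_prod1; last first.
  apply: bmeas_cos; apply: measurable_funD => //; apply: measurable_funD.
    exact: (measurableT_comp (measurable_lin (usubmx a) 0 0 mW) measurable_fst).
  exact: (measurableT_comp (measurable_lin (dsubmx a) 0 0 mW') measurable_snd).
transitivity (\int[P]_x (cos ((W x *m usubmx a) 0 0 + b) * expR (- (((dsubmx a)^T *m S' *m dsubmx a) 0 0 / 2)))).
  apply: eq_Ex => x; rewrite -cW'; apply: eq_Ex => y /=.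
  by congr cos; ring.
rewrite ExZr; last by apply: bmeas_cos; apply: measurable_funD => //; exact: measurable_lin.
rewrite cW -mulrA -expRD; congr (_ * expR _).
have -> : (a^T *m block_mx S 0 0 S' *m a) 0 0 =
    ((usubmx a)^T *m S *m usubmx a) 0 0 + ((dsubmx a)^T *m S' *m dsubmx a) 0 0.
  rewrite -{1 2}(vsubmxK a) tr_col_mx mul_row_block !mulmx0 addr0 add0r.
  by rewrite mul_row_col mxE.
by field.
Qed.

End GaussTheory.

(** * Laws are determined by their cosine transforms *)

Section Kuhn.
Variable R : realType.
Implicit Types u : R.

Lemma bernoulli_ge (x : R) n : -1 <= x -> 1 + n%:R * x <= (1 + x) ^+ n.
Proof.
move=> x1; elim: n => [|n IH]; first by rewrite mul0r addr0 expr0.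
rewrite exprS -natr1; have h : 0 <= 1 + x by rewrite addrC -lerBlDr sub0r.
apply: (le_trans _ (ler_wpM2l h IH)).
have := sqr_ge0 x; have := ler0n R n; nra.
Qed.

Lemma cvg_natM_expr (r : R) : 0 <= r < 1 -> (n%:R * r ^+ n) @[n --> \oo] --> (0 : R).
Proof.
move=> /andP[]; rewrite le_eqVlt => /predU1P[<- _|r0 r1].
  apply: cvg_near_cst; exists 1%N => // n /= n1.
  by rewrite expr0n gtn_eqF// mulr0.
pose q := Num.sqrt r.
have q0 : 0 < q by rewrite sqrtr_gt0.
have q1 : q < 1 by rewrite -sqrtr1 ltr_sqrt.
have y0 : 0 < q^-1 - 1 by rewrite subr_gt0 invf_gt1.
have nq n : n%:R * q ^+ n <= (q^-1 - 1)^-1.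
  have := @bernoulli_ge (q^-1 - 1) n; rewrite addrCA subrr addr0 => h.
  have {}h : n%:R * (q^-1 - 1) <= q^-1 ^+ n.
    by apply: le_trans (h _); [rewrite lerDr|rewrite (le_trans _ (ltW y0))// lerN10].
  rewrite -[leRHS]mul1r ler_pdivlMr// mulrAC.
  apply: (le_trans (ler_wpM2r (exprn_ge0 n (ltW q0)) h)).
  by rewrite -exprMn mulVf ?gt_eqF// expr1n.
apply: (@squeeze_cvgr _ _ _ _ (fun=> 0) (fun n => (q^-1 - 1)^-1 * q ^+ n)).
- apply: nearW => n; rewrite mulr_ge0 ?exprn_ge0 ?(ltW r0)//=.
  have -> : r ^+ n = q ^+ n * q ^+ n by rewrite -exprMn -expr2 sqr_sqrtr ?(ltW r0).
  by rewrite mulrA ler_wpM2r// exprn_ge0 ?ltW.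
- exact: cvg_cst.
- rewrite -[X in _ --> X](mulr0 (q^-1 - 1)^-1); apply: cvgM; first exact: cvg_cst.
  by apply: cvg_expr; rewrite ger0_norm ?ltW.
Qed.

(** Kuhn's polynomials, used in elementary proofs of Weierstrass' theorem to
    approximate a step at 1/2. *)
Definition kuhn n u := (1 - u ^+ n) ^+ (n * 2 ^ n).

Lemma kuhn01 n u : 0 <= u <= 1 -> 0 <= kuhn n u <= 1.
Proof.
move=> /andP[u0 u1].
have h : 0 <= 1 - u ^+ n <= 1 by rewrite subr_ge0 exprn_ile1//= gerBl exprn_ge0.
by case/andP: h => h0 h1; rewrite /kuhn exprn_ge0//= exprn_ile1.
Qed.

(** Bernoulli's inequality on both sides of the step.  Below 1/2 it bounds
    the polynomial from below by 1 - n (2 u)^n.  From 1/2 on, the polynomial is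
    at most the inverse of (1 + u^n)^(n 2^n), and this power is at least
    n (2 u)^n >= n. *)
Lemma cvg_kuhn u : 0 <= u <= 1 -> kuhn n u @[n --> \oo] --> ((u < 2^-1)%R%:R : R).
Proof.
move=> u01; have /andP[u0 u1] := u01; case: ltP => hu.
  rewrite mulr1n.
  apply: (@squeeze_cvgr _ _ _ _ (fun n => 1 - n%:R * (2 * u) ^+ n) (fun=> 1)).
  - apply: nearW => n; have /andP[_ ->] := kuhn01 n u01; rewrite andbT.
    have := @bernoulli_ge (- u ^+ n) (n * 2 ^ n).
    rewrite mulrN natrM natrX -mulrA -exprMn; apply.
    by rewrite lerN2 exprn_ile1.
  - rewrite -[X in _ --> X](subr0 1); apply: cvgB; first exact: cvg_cst.
    by apply: cvg_natM_expr; rewrite mulr_ge0//= mulrC -ltr_pdivlMr// mul1r.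
  - exact: cvg_cst.
rewrite mulr0n.
apply: (@squeeze_cvgr _ _ _ _ (fun=> 0) (fun n => (n%:R)^-1)).
- near=> n; have /andP[-> _] := kuhn01 n u01; rewrite /=.
  have n0 : 0 < n%:R :> R by near: n; exact: nbhs_infty_gtr.
  rewrite -[leRHS]mul1r ler_pdivlMr//.
  have un0 := exprn_ge0 n u0; have un1 := exprn_ile1 n u0 u1.
  have h1 : n%:R <= (1 + u ^+ n) ^+ (n * 2 ^ n).
    apply: le_trans (bernoulli_ge _ _); last by lra.
    rewrite natrM natrX -mulrA -exprMn.
    have h2 : 1 <= (2 * u) ^+ n.
      by apply: exprn_ege1; move: hu; rewrite -[2^-1]mul1r ler_pdivrMr// mulrC.
    by rewrite (@le_trans _ _ (n%:R * (2 * u) ^+ n))// ?lerDr// ler_peMr// ltW.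
  apply: (le_trans (ler_wpM2l _ h1)); first by have /andP[] := kuhn01 n u01.
  rewrite /kuhn -exprMn exprn_ile1//; last by nra.
  by rewrite mulr_ge0//; lra.
- exact: cvg_cst.
- by rewrite -(cvg_shiftn 1); under eq_fun do rewrite addn1; exact: cvg_harmonic.
Unshelve. all: by end_near. Qed.

End Kuhn.

Section CosineTransform.
Context d1 d2 (T1 : measurableType d1) (T2 : measurableType d2) (R : realType).
Variables (P1 : probability T1 R) (P2 : probability T2 R) (N : nat).
Variables (W1 : T1 -> 'rV[R]_N) (W2 : T2 -> 'rV[R]_N).
Hypothesis mW1 : forall i, measurable_fun setT (fun w => W1 w 0 i).
Hypothesis mW2 : forall i, measurable_fun setT (fun w => W2 w 0 i).
Hypothesis eq_cos : forall (a : 'cV[R]_N) b,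
  \int[P1]_w cos ((W1 w *m a) 0 0 + b) = \int[P2]_w cos ((W2 w *m a) 0 0 + b).

Let phase (a : 'cV[R]_N) (b : R) (x : 'rV[R]_N) : R := cos ((x *m a) 0 0 + b).

(** Test functions that do not distinguish the two laws.  Requiring this also
    after multiplication by any cosine makes the class stable under such
    multiplications, hence under polynomials in cosines. *)
Definition testable (h : 'rV[R]_N -> R) : Prop :=
  [/\ exists C, forall x, `|h x| <= C,
      measurable_fun setT (h \o W1), measurable_fun setT (h \o W2) &
      forall a b, \int[P1]_w (h (W1 w) * phase a b (W1 w)) =
                  \int[P2]_w (h (W2 w) * phase a b (W2 w))].

Let bphase1 a b : bmeas (phase a b \o W1).
Proof. by apply: bmeas_cos; apply: measurable_funD => //; exact: measurable_lin. Qed.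

Let bphase2 a b : bmeas (phase a b \o W2).
Proof. by apply: bmeas_cos; apply: measurable_funD => //; exact: measurable_lin. Qed.

Lemma testable_bmeas h : testable h -> bmeas (h \o W1) /\ bmeas (h \o W2).
Proof. by move=> [[C hC] m1 m2 _]; split; split=> //; exists C => x /=. Qed.

Lemma testable_cst c : testable (fun=> c).
Proof.
split; [by exists `|c| | exact: measurable_cst | exact: measurable_cst |].
by move=> a b; rewrite !ExZ ?eq_cos//; [exact: (bphase2 a b)|exact: (bphase1 a b)].
Qed.

Lemma testableD h k : testable h -> testable k -> testable (fun x => h x + k x).
Proof.
move=> th tk.
have [bh1 bh2] := testable_bmeas th; have [bk1 bk2] := testable_bmeas tk.
case: th tk => [[C hC] m1 m2 E] [[D hD] n1 n2 F]; split.
- by exists (C + D) => x; rewrite (le_trans (ler_normD _ _))// lerD.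
- exact: measurable_funD.
- exact: measurable_funD.
move=> a b; under eq_Rintegral do rewrite mulrDl.
under [RHS]eq_Rintegral do rewrite mulrDl.
by rewrite !ExD ?E ?F//; apply: bmeasM => //; first [exact: (bphase1 a b)|exact: (bphase2 a b)].
Qed.

Lemma testableZ c h : testable h -> testable (fun x => c * h x).
Proof.
move=> th; have [bh1 bh2] := testable_bmeas th.
case: th => [[C hC] m1 m2 E]; split.
- by exists (`|c| * C) => x; rewrite normrM ler_wpM2l.
- exact: measurable_funM.
- exact: measurable_funM.
move=> a b; under eq_Rintegral do rewrite -mulrA.
under [RHS]eq_Rintegral do rewrite -mulrA.
by rewrite !ExZ ?E//; apply: bmeasM => //; first [exact: (bphase1 a b)|exact: (bphase2 a b)].
Qed.

Lemma eq_testable h k : h =1 k -> testable h -> testable k.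
Proof. by move=> /funext ->. Qed.

(** A product of two cosines is a half-sum of cosines. *)
Lemma testable_phase a b h : testable h -> testable (fun x => phase a b x * h x).
Proof.
move=> th; have [bh1 bh2] := testable_bmeas th.
case: th => [[C hC] m1 m2 E]; split.
- exists C => x; rewrite normrM -[leRHS]mul1r ler_pM//.
  by rewrite ler_norml cos_geN1 cos_le1.
- by apply: measurable_funM => //; case: (bphase1 a b).
- by apply: measurable_funM => //; case: (bphase2 a b).
move=> a' b'.
have F x : phase a b x * h x * phase a' b' x =
    2^-1 * (h x * phase (a + a') (b + b') x + h x * phase (a - a') (b - b') x).
  rewrite /phase mulmxDr mulmxBr !mxE.
  set u := \sum_j _; set v := \sum_j _.
  have -> : u + v + (b + b') = (u + b) + (v + b') by ring.
  have -> : u - v + (b - b') = (u + b) - (v + b') by ring.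
  by rewrite (cosD (u + b)) (cosB (u + b)); field.
have B1 := fun a b => bmeasM bh1 (bphase1 a b).
have B2 := fun a b => bmeasM bh2 (bphase2 a b).
rewrite (eq_Ex _ (fun w => F (W1 w))) (eq_Ex _ (fun w => F (W2 w))).
rewrite !ExZ ?ExD ?E//; try exact: B1; try exact: B2.
  by apply: bmeasD; exact: B2.
by apply: bmeasD; exact: B1.
Qed.

Lemma testable_cvg (h_ : nat -> 'rV[R]_N -> R) h C :
  (forall n, testable (h_ n)) -> (forall n x, `|h_ n x| <= C) ->
  (forall x, h_ ^~ x @ \oo --> h x) -> testable h.
Proof.
move=> th hC ch.
have m1 n : measurable_fun setT (h_ n \o W1) by case: (th n).
have m2 n : measurable_fun setT (h_ n \o W2) by case: (th n).
have [b1 _] := @Ex_cvg _ _ _ P1 _ (h \o W1) C m1 (fun n x => hC n _) (fun x => ch _).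
have [b2 _] := @Ex_cvg _ _ _ P2 _ (h \o W2) C m2 (fun n x => hC n _) (fun x => ch _).
split; [|by case: b1|by case: b2|].
  exists C => x; have /cvg_norm := ch x.
  by move=> /cvgr_to_le; apply; apply: nearW => n; exact: hC.
move=> a b.
have cb n x : `|h_ n x * phase a b x| <= C.
  rewrite normrM -[leRHS]mulr1 ler_pM//.
  by rewrite ler_norml cos_geN1 cos_le1.
have cc x : (fun n => h_ n x * phase a b x) @ \oo --> h x * phase a b x.
  by apply: cvgM; [exact: ch | exact: cvg_cst].
have [_ c1] := @Ex_cvg _ _ _ P1 (fun n w => h_ n (W1 w) * phase a b (W1 w)) (fun w => h (W1 w) * phase a b (W1 w)) C (fun n => measurable_funM (m1 n) (bphase1 a b).1) (fun n x => cb n _) (fun x => cc _).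
have [_ c2] := @Ex_cvg _ _ _ P2 (fun n w => h_ n (W2 w) * phase a b (W2 w)) (fun w => h (W2 w) * phase a b (W2 w)) C (fun n => measurable_funM (m2 n) (bphase2 a b).1) (fun n x => cb n _) (fun x => cc _).
apply: (cvg_unique _ c1) => //.
have EE n : \int[P1]_w (h_ n (W1 w) * phase a b (W1 w)) =
    \int[P2]_w (h_ n (W2 w) * phase a b (W2 w)) by case: (th n).
by move: c2; under eq_fun do rewrite -EE.
Qed.

(** Only multiplication by the affine function (1 + cos) / 2 has to be
    iterated: first to get its powers, then the powers of one minus these. *)
Lemma testable_kuhn a b n h :
  testable h -> testable (fun x => kuhn n ((1 + phase a b x) / 2) * h x).
Proof.
have tX k g : testable g -> testable (fun x => ((1 + phase a b x) / 2) ^+ k * g x).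
  move=> tg; elim: k => [|k IH]; first by apply: eq_testable tg => x; rewrite expr0 mul1r.
  have := testableZ 2^-1 (testableD IH (testable_phase a b IH)).
  by apply: eq_testable => x /=; rewrite exprS; field.
rewrite /kuhn; elim: (n * 2 ^ n)%N => [|k IH] th.
  by apply: eq_testable th => x; rewrite expr0 mul1r.
have := testableD (IH th) (testableZ (-1) (tX n _ (IH th))).
by apply: eq_testable => x /=; rewrite [in RHS]exprS; ring.
Qed.

Lemma testable_cos_neg a b h :
  testable h -> testable (fun x => (phase a b x < 0)%R%:R * h x).
Proof.
move=> th; have [[C hC] _ _ _] := th.
have u01 x : 0 <= (1 + phase a b x) / 2 <= 1.
  have := cos_geN1 ((x *m a) 0 0 + b); have := cos_le1 ((x *m a) 0 0 + b).
  by rewrite -/(phase a b x); lra.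
apply: (@testable_cvg (fun n x => kuhn n ((1 + phase a b x) / 2) * h x) _ C).
- by move=> n; exact: testable_kuhn.
- move=> n x; rewrite normrM -[leRHS]mul1r ler_pM//.
  by have /andP[k0 k1] := kuhn01 n (u01 x); rewrite ger0_norm.
- move=> x; apply: cvgM; last exact: cvg_cst.
  have := cvg_kuhn (u01 x).
  rewrite (_ : ((1 + phase a b x) / 2 < 2^-1) = (phase a b x < 0))//.
  by rewrite ltr_pdivrMr// mulVf// gtrDl.
Qed.

(** A slow wave has the right sign: once |x i - c| < pi n, the sign of
    sin ((x i - c) / n) is that of x i - c.  A half-space is thus a pointwise
    limit of sets on which a cosine is negative. *)
Lemma testable_halfspace i (c : R) h :
  testable h -> testable (fun x => (c < x 0 i)%R%:R * h x).
Proof.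
move=> th; have [[C hC] _ _ _] := th.
pose a n : 'cV[R]_N := \col_j ((j == i)%:R / n.+1%:R).
pose b n : R := pi / 2 - c / n.+1%:R.
have E n x : phase (a n) (b n) x = - sin ((x 0 i - c) / n.+1%:R).
  rewrite /phase mxE (bigD1 i)//= big1 ?addr0; last first.
    by move=> j /negPf ji; rewrite mxE ji mul0r mulr0.
  by rewrite mxE eqxx mulr1n -cosDpihalf /b; congr cos; field.
apply: (@testable_cvg (fun n x => (phase (a n) (b n) x < 0)%R%:R * h x) _ C).
- by move=> n; exact: testable_cos_neg.
- move=> n x; rewrite normrM -[leRHS]mul1r ler_pM//.
  by case: (_ < _); rewrite ?normr1 ?normr0.
- move=> x; apply: cvgM; last exact: cvg_cst.
  apply: cvg_near_cst; near=> n; rewrite E oppr_lt0; congr (_%:R).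
  set y := x 0 i - c; rewrite -[c < _]subr_gt0 -/y.
  have n0 : 0 < n.+1%:R :> R by [].
  have yn : `|y / n.+1%:R| < pi.
    rewrite normrM normfV (ger0_norm (ltW n0)) ltr_pdivrMr//.
    rewrite mulrC -ltr_pdivrMr ?pi_gt0//.
    have : `|y| / pi < n%:R by near: n; exact: nbhs_infty_gtr.
    by move=> /lt_trans; apply; rewrite ltr_nat.
  move: yn; rewrite ltr_norml => /andP[yn1 yn2].
  have [y0|y0|y0] := ltgtP y 0.
  - have sn : 0 < sin (- (y / n.+1%:R)).
      apply: sin_gt0_pi; rewrite oppr_gt0 pmulr_llt0 ?invr_gt0// y0/=.
      by rewrite ltrNl.
    by rewrite -[y / _]opprK sinN oppr_gt0 ltNge (ltW sn).
  - have sp : 0 < sin (y / n.+1%:R) by apply: sin_gt0_pi; rewrite divr_gt0.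
    by rewrite sp.
  - by rewrite y0 mul0r sin0 ltxx.
Unshelve. all: by end_near. Qed.

(* Stability under multiplication by the indicator, rather than testability of
   the indicator itself, makes intersections immediate; so these sets form a
   sigma-algebra without any monotone class argument. *)
Let good (A : set 'rV[R]_N) : Prop :=
  forall h, testable h -> testable (fun x => \1_A x * h x).

Let good0 : good set0.
Proof.
move=> h _; apply: eq_testable (testable_cst 0) => x.
by rewrite indic0 mul0r.
Qed.

Let goodC A : good A -> good (~` A).
Proof.
move=> gA h th; apply: eq_testable (testableD th (testableZ (-1) (gA _ th))) => x.
rewrite !indicE in_setC; case: (x \in A) => /=; ring.
Qed.

Let good_bigcap (F : (set 'rV[R]_N)^nat) : (forall n, good (F n)) -> good (\bigcap_n F n).
Proof.
move=> gF h th; have [[C hC] _ _ _] := th.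
pose k_ n x : R := \prod_(i < n) \1_(F i) x.
have kE n x : k_ n x = [forall i : 'I_n, x \in F i]%:R.
  rewrite /k_; case: (boolP [forall i : 'I_n, x \in F i]) => [/forallP h1|/forallPn[i hi]].
    by rewrite big1// => i _; rewrite indicE h1.
  by rewrite (bigD1 i)//= indicE (negPf hi) mul0r.
apply: (@testable_cvg (fun n x => k_ n x * h x) _ C).
- elim=> [|n IH].
    by apply: eq_testable th => x; rewrite /k_ big_ord0 mul1r.
  by apply: eq_testable (gF n _ IH) => x; rewrite /k_ big_ord_recr/=; ring.
- move=> n x; rewrite normrM -[leRHS]mul1r ler_pM// kE.
  by case: [forall _, _]; rewrite ?normr1 ?normr0.
- move=> x; apply: cvgM; last exact: cvg_cst.
  apply: cvg_near_cst; rewrite indicE.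
  case: (boolP (x \in \bigcap_n F n)) => [/set_mem xF|].
    by apply: nearW => n; rewrite kE; case: forallP => // -[] i; apply/mem_set/xF.
  rewrite notin_setE => /existsNP[m /not_implyP[_ nFm]].
  exists m.+1 => // n /= mn; rewrite kE; case: forallP => // /(_ (Ordinal mn)).
  by rewrite inE.
Qed.

(** The measurability of the two preimages is carried along because it is known
    beforehand for half-spaces only, the hypotheses being about coordinates. *)
Definition transferable (A : set 'rV[R]_N) : Prop :=
  [/\ measurable (W1 @^-1` A), measurable (W2 @^-1` A) & good A].

Lemma sigma_algebra_transferable : sigma_algebra setT transferable.
Proof.
have tC A : transferable A -> transferable (~` A).
  move=> [m1 m2 g]; split; [| |exact: goodC].
    by rewrite preimage_setC; exact: measurableC.
  by rewrite preimage_setC; exact: measurableC.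
split.
- by split; rewrite ?preimage_set0//.
- by move=> A; rewrite setTD; exact: tC.
- move=> F tF; rewrite -[\bigcup_n F n]setCK setC_bigcup; apply: (tC (_ : set _)); split.
  + rewrite preimage_bigcap; apply: bigcapT_measurable => n.
    by case: (tC _ (tF n)).
  + rewrite preimage_bigcap; apply: bigcapT_measurable => n.
    by case: (tC _ (tF n)).
  + by apply: good_bigcap => n; case: (tC _ (tF n)).
Qed.

Lemma transferable_halfspace i c : transferable [set x | c < x 0 i].
Proof.
split.
- rewrite (_ : _ @^-1` _ = (fun w => W1 w 0 i) @^-1` `]c, +oo[%classic); last first.
    by apply/seteqP; split=> w /=; rewrite in_itv/= andbT.
  by rewrite -[X in measurable X]setTI; apply: mW1.
- rewrite (_ : _ @^-1` _ = (fun w => W2 w 0 i) @^-1` `]c, +oo[%classic); last first.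
    by apply/seteqP; split=> w /=; rewrite in_itv/= andbT.
  by rewrite -[X in measurable X]setTI; apply: mW2.
- move=> h th; apply: eq_testable (testable_halfspace i c th) => x.
  by rewrite indicE; congr (_%:R * _); rewrite mem_setE/=.
Qed.

Lemma transferable_prob A : transferable A -> P1 (W1 @^-1` A) = P2 (W2 @^-1` A).
Proof.
move=> [m1 m2 g].
have [_ _ _ /(_ 0 0)] := g _ (testable_cst 1).
have E x : \1_A x * 1 * phase 0 0 x = \1_A x by rewrite /phase mulmx0 mxE add0r cos0 !mulr1.
rewrite (eq_Ex _ (fun w => E (W1 w))) (eq_Ex _ (fun w => E (W2 w))) => EE.
by rewrite -(Ex_indic P1 m1) -(Ex_indic P2 m2); congr EFin; exact: EE.
Qed.

End CosineTransform.

(** An open set is the union of the countably many boxes with rational corners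
    that it contains. *)
Lemma open_sigma_halfspaces (R : realType) N (G : set (set 'rV[R]_N)) :
  sigma_algebra setT G -> (forall i c, G [set x : 'rV_N | c < x 0 i]) ->
  forall U, open U -> G U.
Proof.
move=> [G0 GD GU] Gh U oU.
have GC A : G A -> G (~` A) by move=> /GD; rewrite setTD.
have GI (F : (set 'rV[R]_N)^nat) : (forall n, G (F n)) -> G (\bigcap_n F n).
  move=> h; rewrite -[\bigcap_n F n]setCK setC_bigcap; apply: (GC _); apply: (GU _) => n.
  exact: GC.
have GT : G setT by rewrite -setC0; exact: GC.
have GU2 A B : G A -> G B -> G (A `|` B).
  by move=> gA gB; rewrite -bigcup2E; apply: GU => -[|[|n]].
have GI2 A B : G A -> G B -> G (A `&` B).
  by move=> gA gB; rewrite -[A `&` B]setCK setCI; apply: (GC _); apply: GU2; exact: GC.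
have Glt i c : G [set x : 'rV_N | x 0 i < c].
  rewrite (_ : [set _ | _] = \bigcup_k ~` [set x : 'rV_N | c - k.+1%:R^-1 < x 0 i]).
    by apply: (GU _) => k; apply: (GC _).
  apply/seteqP; split=> x /=.
    move=> xc.
    have : \forall k \near \oo, k.+1%:R^-1 < c - x 0 i.
      have /cvgr0Pnorm_lt/(_ (c - x 0 i)) := @cvg_harmonic R.
      rewrite subr_gt0 => /(_ xc); apply: filterS => k /=.
      by rewrite ger0_norm ?invr_ge0.
    case=> k _ /(_ k (leqnn _)) h; exists k => //=; apply/negP; rewrite -leNgt.
    by rewrite lerBrDl -lerBrDr ltW.
  case=> k _ /=; move/negP; rewrite -leNgt => /le_lt_trans; apply.
  by rewrite gtrBl invr_gt0.
pose box (p : 'rV[rat]_N * 'rV[rat]_N) : set 'rV[R]_N :=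
  \bigcap_(i in [set: 'I_N]) [set x | ratr (p.1 0 i) < x 0 i < ratr (p.2 0 i)].
have Gbox p : G (box p).
  rewrite (_ : box p = \bigcap_n (if insub n is Some i then
     [set x : 'rV[R]_N | ratr (p.1 0 i) < x 0 i] `&` [set x | x 0 i < ratr (p.2 0 i)] else setT)).
    by apply: (GI _) => n; case: (insub n) => [i|] //; apply: GI2; [exact: Gh|exact: Glt].
  apply/seteqP; split=> x /=.
    by move=> h n _; case: insubP => // i _ _ /=; apply/andP; exact: h.
  by move=> h i _; have := h i I; rewrite valK /= => -[] ? ?; apply/andP.
pose F n : set 'rV[R]_N := if unpickle n is Some p then
  (if `[< box p `<=` U >] then box p else set0) else set0.
rewrite (_ : U = \bigcup_n F n).
  by apply: (GU _) => n; rewrite /F; case: unpickle => // p; case: ifP.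
apply/seteqP; split=> x; last first.
  case=> n _; rewrite /F; case: unpickle => // p; case: asboolP => // h; exact: h.
move=> Ux.
have /nbhs_ballP[e /= e0 eU] : nbhs x U by exact: open_nbhs_nbhs.
have /choice[a ha] : forall i, exists q : rat, x 0 i - e < ratr q < x 0 i.
  move=> i; have [|q] := @rat_in_itvoo R (x 0 i - e) (x 0 i); first by rewrite gtrBl.
  by rewrite in_itv; exists q.
have /choice[b hb] : forall i, exists q : rat, x 0 i < ratr q < x 0 i + e.
  move=> i; have [|q] := @rat_in_itvoo R (x 0 i) (x 0 i + e); first by rewrite ltrDl.
  by rewrite in_itv; exists q.
pose p : 'rV[rat]_N * 'rV[rat]_N := (\row_i a i, \row_i b i).
exists (pickle p) => //; rewrite /F pickleK; case: asboolP => [_|].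
  by move=> i _ /=; rewrite !mxE; have /andP[_ ->] := ha i; have /andP[-> _] := hb i.
case=> y hy; apply: eU; split=> // i j; rewrite /ball /= (ord1 i) ltr_norml.
have := hy j I; rewrite /= !mxE => /andP[h1 h2].
by have /andP[h3 _] := ha j; have /andP[_ h4] := hb j; apply/andP; split; lra.
Qed.

(** The class of functions for which expectations are compared.  It is stable
    under products, affine substitutions and integration over some of the
    coordinates, and being Lipschitz spares all measurability hypotheses. *)
Definition bounded_lipschitz (R : realType) n (f : 'rV[R]_n -> R) : Prop :=
  exists C : R, (forall x, `|f x| <= C) /\
    forall x y, `|f x - f y| <= C * \sum_i `|x 0 i - y 0 i|.

Lemma transferable_borel d1 d2 (T1 : measurableType d1) (T2 : measurableType d2)
    (R : realType) (P1 : probability T1 R) (P2 : probability T2 R) n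
    (W1 : T1 -> 'rV[R]_n) (W2 : T2 -> 'rV[R]_n) :
  (forall i, measurable_fun setT (fun w => W1 w 0 i)) ->
  (forall i, measurable_fun setT (fun w => W2 w 0 i)) ->
  (forall (a : 'cV[R]_n) b,
    \int[P1]_w cos ((W1 w *m a) 0 0 + b) = \int[P2]_w cos ((W2 w *m a) 0 0 + b)) ->
  forall A, borel_event A -> transferable P1 P2 W1 W2 A.
Proof.
move=> mW1 mW2 eq_cos A bA; apply: (smallest_sub _ _ bA).
  exact: sigma_algebra_transferable.
move=> U oU; apply: open_sigma_halfspaces => //.
  exact: sigma_algebra_transferable.
by move=> i c; exact: transferable_halfspace.
Qed.

Section Laws.
Context d (T : measurableType d) (R : realType).

(** The case of two equal laws in the previous lemma. *)
Lemma borel_preimage (P : probability T R) n (W : T -> 'rV[R]_n) (A : set 'rV[R]_n) :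
  (forall i, measurable_fun setT (fun w => W w 0 i)) ->
  borel_event A -> measurable (W @^-1` A).
Proof.
by move=> mW bA; have [] := transferable_borel (P1 := P) (P2 := P) mW mW (fun a b => erefl) bA.
Qed.

(** With this, the sigma-algebra generated by the open sets is all that is
    needed to integrate Lipschitz functions. *)
Lemma lipschitz_open n (f : 'rV[R]_n -> R) c : bounded_lipschitz f ->
  open [set x | c < f x].
Proof.
move=> [C [C0 fC]]; rewrite openE => x /= cf.
have C_ge0 : 0 <= C by exact: le_trans (normr_ge0 _) (C0 0).
pose e := (f x - c) / (C * n%:R + 1).
have D0 : 0 < C * n%:R + 1 by rewrite ltr_wpDl// mulr_ge0.
have e0 : 0 < e by rewrite divr_gt0// subr_gt0.
apply/nbhs_ballP; exists e => //= y [_ yx].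
have h : `|f x - f y| <= C * (n%:R * e).
  apply: (le_trans (fC _ _)); apply: ler_wpM2l => //.
  rewrite -[n in n%:R]card_ord mulr_natl -sumr_const; apply: ler_sum => i _.
  by have := yx 0 i; rewrite /ball/= => /ltW.
have : C * (n%:R * e) < f x - c.
  rewrite mulrA /e; move: D0; set k := C * n%:R => D0.
  by rewrite mulrCA gtr_pMr ?subr_gt0// ltr_pdivrMr// mul1r ltrDl.
move: h; rewrite ler_norml => /andP[h1 h2] h3 /=; lra.
Qed.

Lemma lipschitz_bmeas (P : probability T R) n (W : T -> 'rV[R]_n) f :
  (forall i, measurable_fun setT (fun w => W w 0 i)) ->
  bounded_lipschitz f -> bmeas (fun w => f (W w)).
Proof.
move=> mW lf; split; last by case: lf => C [hC _]; exists C.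
apply: (measurability _ (RGenOInfty.measurableE R)) => //.
move=> _ [_ [c ->] <-]; rewrite setTI.
rewrite (_ : _ @^-1` _ = W @^-1` [set x | c < f x]); last first.
  by apply/seteqP; split=> w /=; rewrite in_itv/= andbT.
apply: (borel_preimage P) => //; apply: sub_gen_smallest.
exact: lipschitz_open.
Qed.

End Laws.

(** Two vectors with the same cosine transform give the same probability to
    every Borel set, so their images on the Borel space of row vectors are the
    same measure. *)
Lemma gauss_same_law d1 d2 (T1 : measurableType d1) (T2 : measurableType d2)
  (R : realType) (P1 : probability T1 R) (P2 : probability T2 R) n
  (W1 : T1 -> 'rV[R]_n) (W2 : T2 -> 'rV[R]_n) S (f : 'rV[R]_n -> R) :
  gauss P1 W1 S -> gauss P2 W2 S -> bounded_lipschitz f ->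
  \int[P1]_w f (W1 w) = \int[P2]_w f (W2 w).
Proof.
move=> [mW1 c1] [mW2 c2] lf.
have eq_cos (a : 'cV[R]_n) b :
    \int[P1]_w cos ((W1 w *m a) 0 0 + b) = \int[P2]_w cos ((W2 w *m a) 0 0 + b).
  by rewrite c1 c2.
have tB := transferable_borel mW1 mW2 eq_cos.
pose B := g_sigma_algebraType [set U : set 'rV[R]_n | open U].
have mX1 : measurable_fun setT (W1 : T1 -> B).
  by move=> _ A mA; rewrite setTI; case: (tB _ mA).
have mX2 : measurable_fun setT (W2 : T2 -> B).
  by move=> _ A mA; rewrite setTI; case: (tB _ mA).
pose X1 : {RV P1 >-> B} := mfun_Sub (mem_set mX1).
pose X2 : {RV P2 >-> B} := mfun_Sub (mem_set mX2).
have mf : measurable_fun setT (EFin \o (f : B -> R)).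
  apply/measurable_EFinP; apply: (measurability _ (RGenOInfty.measurableE R)) => //.
  move=> _ [_ [c ->] <-]; rewrite setTI.
  rewrite (_ : _ @^-1` _ = [set x | c < f x]); last first.
    by apply/seteqP; split=> w /=; rewrite in_itv/= andbT.
  by apply: sub_gen_smallest; exact: lipschitz_open.
have i1 := bmeas_integrable P1 (lipschitz_bmeas P1 mW1 lf).
have i2 := bmeas_integrable P2 (lipschitz_bmeas P2 mW2 lf).
have e1 := @integral_distribution _ _ _ _ _ P1 X1 _ mf i1.
have e2 := @integral_distribution _ _ _ _ _ P2 X2 _ mf i2.
rewrite /Rintegral; congr fine; transitivity (\int[distribution P1 X1]_y (f y)%:E)%E => //.
transitivity (\int[distribution P2 X2]_y (f y)%:E)%E => //.
apply: eq_measure_integral => A mA _; rewrite /distribution /pushforward/=.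
exact: (transferable_prob mW1 mW2 eq_cos (tB A mA)).
Qed.

(** * Association of independent variables *)

Definition increasing_rV (R : realType) n (f : 'rV[R]_n -> R) : Prop :=
  forall x v : 'rV[R]_n, (forall i, 0 <= v 0 i) -> f x <= f (x + v).

Section BoundedLipschitz.
Variable R : realType.

Lemma bounded_lipschitzM n (f g : 'rV[R]_n -> R) :
  bounded_lipschitz f -> bounded_lipschitz g -> bounded_lipschitz (fun x => f x * g x).
Proof.
move=> [C [bC lC]] [D [bD lD]].
have C0 : 0 <= C by exact: le_trans (normr_ge0 _) (bC 0).
have D0 : 0 <= D by exact: le_trans (normr_ge0 _) (bD 0).
exists (2 * C * D); split=> [x|x y].
  rewrite normrM (le_trans (ler_pM _ _ (bC x) (bD x)))//.
  by rewrite -mulrA mulr_natl mulr2n lerDl mulr_ge0.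
have -> : f x * g x - f y * g y = f x * (g x - g y) + g y * (f x - f y) by ring.
rewrite (le_trans (ler_normD _ _))// !normrM.
have h1 := ler_pM (normr_ge0 _) (normr_ge0 _) (bC x) (lD x y).
have h2 := ler_pM (normr_ge0 _) (normr_ge0 _) (bD y) (lC x y).
by apply: (le_trans (lerD h1 h2)); rewrite le_eqVlt; apply/orP; left; apply/eqP; ring.
Qed.

Lemma bounded_lipschitz_affine n m (f : 'rV[R]_m -> R) (L : 'M[R]_(n, m)) u :
  bounded_lipschitz f -> bounded_lipschitz (fun x => f (x *m L + u)).
Proof.
move=> [C [bC lC]].
have C0 : 0 <= C by exact: le_trans (normr_ge0 _) (bC 0).
pose k := \sum_i \sum_j `|L j i|.
have k0 : 0 <= k by apply: sumr_ge0 => i _; apply: sumr_ge0.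
exists (C * (1 + k)); split=> [x|x y].
  by rewrite (le_trans (bC _))// ler_peMr// lerDl.
apply: (le_trans (lC _ _)); rewrite -mulrA ler_wpM2l//.
set s := \sum_i `|x 0 i - y 0 i|.
have s0 : 0 <= s by apply: sumr_ge0.
apply: (@le_trans _ _ (k * s)); last by rewrite ler_wpM2r// lerDr.
rewrite mulr_suml; apply: ler_sum => i _.
rewrite !mxE opprD addrACA subrr addr0 -sumrB (le_trans (ler_norm_sum _ _ _))//.
rewrite mulr_suml; apply: ler_sum => j _; rewrite -mulrBl normrM mulrC ler_wpM2l//.
by rewrite /s (bigD1 j)//= lerDl sumr_ge0.
Qed.

Lemma bounded_lipschitz_lsubmx n m (f : 'rV[R]_n -> R) : bounded_lipschitz f ->
  bounded_lipschitz (fun x : 'rV[R]_(n + m) => f (lsubmx x)).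
Proof.
move=> [C [bC lC]]; exists C; split=> // x y; apply: (le_trans (lC _ _)).
have C0 : 0 <= C by exact: le_trans (normr_ge0 _) (bC 0).
apply: ler_wpM2l => //; rewrite big_split_ord/=.
under eq_bigr do rewrite !mxE.
by rewrite lerDl sumr_ge0.
Qed.

Lemma bounded_lipschitz_rsubmx n m (f : 'rV[R]_m -> R) : bounded_lipschitz f ->
  bounded_lipschitz (fun x : 'rV[R]_(n + m) => f (rsubmx x)).
Proof.
move=> [C [bC lC]]; exists C; split=> // x y; apply: (le_trans (lC _ _)).
have C0 : 0 <= C by exact: le_trans (normr_ge0 _) (bC 0).
apply: ler_wpM2l => //; rewrite big_split_ord/=.
under eq_bigr do rewrite !mxE.
by rewrite lerDr sumr_ge0.
Qed.

Lemma bounded_lipschitz_row_mxr n m (f : 'rV[R]_(n + m) -> R) u : bounded_lipschitz f ->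
  bounded_lipschitz (fun v => f (row_mx u v)).
Proof.
move=> [C [bC lC]]; exists C; split=> // x y; apply: (le_trans (lC _ _)).
rewrite big_split_ord/= [X in X + _]big1 ?add0r; last first.
  by move=> i _; rewrite !row_mxEl subrr normr0.
by under eq_bigr do rewrite !row_mxEr.
Qed.

(** Lets association pass to products: the partial integrals of a test function
    have to be test functions of the remaining coordinates. *)
Lemma bounded_lipschitz_Ex d (T : measurableType d) (P : probability T R) n m
    (f : 'rV[R]_(n + m) -> R) (W : T -> 'rV[R]_m) :
  (forall i, measurable_fun setT (fun w => W w 0 i)) -> bounded_lipschitz f ->
  bounded_lipschitz (fun u => \int[P]_w f (row_mx u (W w))).
Proof.
move=> mW lf; have bf u := lipschitz_bmeas P mW (bounded_lipschitz_row_mxr u lf).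
case: lf => [C [bC lC]]; exists C; split=> [x|x y]; first exact: Ex_norm_le.
rewrite -ExB//; apply: Ex_norm_le; first exact: bmeasB.
move=> w; apply: (le_trans (lC _ _)).
rewrite big_split_ord/= [X in _ + X]big1 ?addr0; last first.
  by move=> i _; rewrite !row_mxEr subrr normr0.
by under eq_bigr do rewrite !row_mxEl.
Qed.

End BoundedLipschitz.

(** Positive association, the conclusion of the Harris and FKG inequalities. *)
Definition associated {d} {T : measurableType d} {R : realType} (P : probability T R)
    n (W : T -> 'rV[R]_n) : Prop :=
  forall f g, bounded_lipschitz f -> increasing_rV f ->
    bounded_lipschitz g -> increasing_rV g ->
    (\int[P]_w f (W w)) * (\int[P]_w g (W w)) <= \int[P]_w (f (W w) * g (W w)).

Section Association.
Variable R : realType.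

(** Chebyshev's inequality: for one variable, (f x - f y) (g x - g y) >= 0.
    Integrate over y, then over x, the two being independent copies. *)
Lemma associated1 d (T : measurableType d) (P : probability T R) (W : T -> 'rV[R]_1) :
  (forall i, measurable_fun setT (fun w => W w 0 i)) -> associated P W.
Proof.
move=> mW f g lf If lg Ig.
have bf := lipschitz_bmeas P mW lf; have bg := lipschitz_bmeas P mW lg.
have bfg := bmeasM bf bg.
set a := \int[P]_w f (W w); set b := \int[P]_w g (W w).
set c := \int[P]_w (f (W w) * g (W w)).
have pos (x y : 'rV[R]_1) : 0 <= (f x - f y) * (g x - g y).
  wlog xy : x y / y 0 0 <= x 0 0.
    move=> H; have [|/ltW /H h] := leP (y 0 0) (x 0 0); first exact: H.
    by rewrite -mulrNN !opprB.
  have -> : x = y + (x - y) by rewrite addrC subrK.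
  by apply: mulr_ge0; rewrite subr_ge0; [apply: If|apply: Ig] => i; rewrite (ord1 i) !mxE subr_ge0.
have inner x : 0 <= f x * g x - f x * b - g x * a + c.
  have -> : f x * g x - f x * b - g x * a + c =
      \int[P]_w ((f x * g x - f x * g (W w)) - g x * f (W w) + f (W w) * g (W w)).
    have k1 : bmeas (fun w : T => f x * g x) by exact: bmeas_cst.
    have k2 : bmeas (fun w => f x * g (W w)) by exact: bmeasZ.
    have k3 : bmeas (fun w => g x * f (W w)) by exact: bmeasZ.
    have k4 := bmeasB k1 k2; have k5 := bmeasB k4 k3.
    by rewrite (ExD P k5 bfg) (ExB P k4 k3) (ExB P k1 k2) (ExZ P _ bg) (ExZ P _ bf) Ex_cst.
  rewrite -[X in X <= _](Ex_cst P 0); apply: le_Ex; first exact: bmeas_cst.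
    apply: bmeasD => //; apply: bmeasB; last exact: bmeasZ.
    by apply: bmeasB; [exact: bmeas_cst|exact: bmeasZ].
  by move=> w; apply: le_trans (pos x (W w)) _; rewrite le_eqVlt; apply/orP; left; apply/eqP; ring.
have : 0 <= \int[P]_w ((f (W w) * g (W w) - f (W w) * b) - g (W w) * a + c).
  rewrite -[X in X <= _](Ex_cst P 0); apply: le_Ex => //; first exact: bmeas_cst.
  apply: bmeasD; last exact: bmeas_cst.
  by apply: bmeasB; [apply: bmeasB|] => //; apply: bmeasM => //; exact: bmeas_cst.
have zb : bmeas (fun w => f (W w) * b) by apply: bmeasM => //; exact: bmeas_cst.
have za : bmeas (fun w => g (W w) * a) by apply: bmeasM => //; exact: bmeas_cst.
rewrite ExD ?ExB ?ExZr ?Ex_cst//; first 1 last.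
- exact: bmeasB.
- by apply: bmeasB => //; exact: bmeasB.
- exact: bmeas_cst.
by rewrite -/a -/b -/c; lra.
Qed.

(** Harris' argument: use association of the second factor with the first one
    fixed, then association of the first for the partial integrals, which are
    still increasing. *)
Lemma associated_prod d1 d2 (T1 : measurableType d1) (T2 : measurableType d2)
    (P1 : probability T1 R) (P2 : probability T2 R) n1 n2
    (W1 : T1 -> 'rV[R]_n1) (W2 : T2 -> 'rV[R]_n2) :
  (forall i, measurable_fun setT (fun w => W1 w 0 i)) ->
  (forall i, measurable_fun setT (fun w => W2 w 0 i)) ->
  associated P1 W1 -> associated P2 W2 ->
  associated (prodP P1 P2) (fun z => row_mx (W1 z.1) (W2 z.2)).
Proof.
move=> mW1 mW2 a1 a2 f g lf If lg Ig.
have mW i : measurable_fun setT (fun z : T1 * T2 => row_mx (W1 z.1) (W2 z.2) 0 i).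
  case: (split_ordP i) => j ->.
    by under eq_fun do rewrite row_mxEl; exact: measurableT_comp (mW1 j) measurable_fst.
  by under eq_fun do rewrite row_mxEr; exact: measurableT_comp (mW2 j) measurable_snd.
have bf := lipschitz_bmeas (prodP P1 P2) mW lf.
have bg := lipschitz_bmeas (prodP P1 P2) mW lg.
rewrite !Ex_prod1//; last exact: bmeasM.
have mono (h : 'rV[R]_(n1 + n2) -> R) : bounded_lipschitz h -> increasing_rV h ->
    increasing_rV (fun u => \int[P2]_w h (row_mx u (W2 w))).
  move=> lh Ih x v v0.
  have bh u := lipschitz_bmeas P2 mW2 (bounded_lipschitz_row_mxr u lh).
  apply: le_Ex => // w.
  have -> : row_mx (x + v) (W2 w) = row_mx x (W2 w) + row_mx v 0 by rewrite add_row_mx addr0.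
  apply: Ih => i; case: (split_ordP i) => j ->; first by rewrite row_mxEl.
  by rewrite row_mxEr mxE.
have incr2 (h : 'rV[R]_(n1 + n2) -> R) u : increasing_rV h -> increasing_rV (fun v => h (row_mx u v)).
  move=> Ih x v v0.
  have -> : row_mx u (x + v) = row_mx u x + row_mx 0 v by rewrite add_row_mx addr0.
  apply: Ih => i; case: (split_ordP i) => j ->; last by rewrite row_mxEr.
  by rewrite row_mxEl mxE.
apply: (le_trans (a1 _ _ (bounded_lipschitz_Ex P2 mW2 lf) (mono f lf If)
                         (bounded_lipschitz_Ex P2 mW2 lg) (mono g lg Ig))).
apply: le_Ex.
- apply: bmeasM.
    exact: (lipschitz_bmeas P1 mW1 (bounded_lipschitz_Ex P2 mW2 lf)).
  exact: (lipschitz_bmeas P1 mW1 (bounded_lipschitz_Ex P2 mW2 lg)).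
- exact: (bmeas_Ex1 P1 P2 (bmeasM bf bg)).
move=> x.
exact: (a2 _ _ (bounded_lipschitz_row_mxr _ lf) (incr2 f _ If) (bounded_lipschitz_row_mxr _ lg) (incr2 g _ Ig)).
Qed.

Lemma gauss_normal (m s : R) : s != 0 ->
  gauss (gauss_prob m s) (fun x => const_mx (x - m) : 'rV[R]_1) (s ^+ 2)%:M.
Proof.
move=> s0; split.
  by move=> i; under eq_fun do rewrite mxE; exact: measurable_funB.
move=> a b.
have E (x : R) : (const_mx (x - m) *m a) 0 0 + b = a 0 0 * (x - m) + b.
  by rewrite mxE big_ord1 !mxE mulrC.
transitivity (cos b * expR (- (s ^+ 2 * (a 0 0) ^+ 2 / 2))).
  by rewrite -(gauss_prob_cos m (a 0 0) b s0); apply: eq_Ex => x; rewrite E.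
have -> // : (a^T *m (s ^+ 2)%:M *m a) 0 0 = s ^+ 2 * a 0 0 ^+ 2.
by rewrite mul_mx_scalar -scalemxAl !mxE big_ord1 !mxE -expr2.
Qed.

(** The underlying space is irrelevant, since only expectations of functions of
    [Z] are used; it is a product of copies of the real line. *)
Lemma exists_standard_gauss N : exists d (T : measurableType d) (P : probability T R)
  (Z : T -> 'rV[R]_N), gauss P Z 1%:M /\ associated P Z.
Proof.
have g1 := gauss_normal 0 (oner_neq0 R).
elim: N => [|N [d [T [P [Z [gZ aZ]]]]]].
  exists _, _, (gauss_prob 0 1), (fun=> 0); split.
    split=> [[]//|a b].
    under eq_Rintegral do rewrite mul0mx mxE add0r.
    by rewrite Ex_cst mxE big_ord0 mul0r oppr0 expR0 mulr1.
  by move=> f g _ _ _ _; rewrite !Ex_cst.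
have := gauss_prod g1 gZ; rewrite expr1n -scalar_mx_block => g2.
have a2 := associated_prod g1.1 gZ.1 (associated1 (gauss_prob 0 1) g1.1) aZ.
by exists _, _, (prodP (gauss_prob 0 1) P), (fun z => row_mx (const_mx (z.1 - 0) : 'rV[R]_1) (Z z.2)).
Qed.

End Association.

(** * Comparison of Gaussian pairs *)

Section NoiseMatrices.
Variables (R : realType) (n1 n2 : nat) (D : 'M[R]_(n1, n2)).
Hypothesis D0 : forall i j, 0 <= D i j.

Definition pair_count := #|{: 'I_n1 * 'I_n2}|.

(** A factorisation D = A^T B with nonnegative factors.  There is one row for
    each pair (i, j), which contributes the square root of D i j to the
    coordinate i of one block and to the coordinate j of the other.  If Z has
    identity covariance, Z A and Z B have cross-covariance D and are both
    increasing in Z. *)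
Definition left_noise : 'M[R]_(pair_count, n1) := \matrix_(p, k)
  (Num.sqrt (D (enum_val p).1 (enum_val p).2) * (k == (enum_val p).1)%:R).

Definition right_noise : 'M[R]_(pair_count, n2) := \matrix_(p, k)
  (Num.sqrt (D (enum_val p).1 (enum_val p).2) * (k == (enum_val p).2)%:R).

Lemma left_noise_ge0 p k : 0 <= left_noise p k.
Proof. by rewrite mxE mulr_ge0. Qed.

Lemma right_noise_ge0 p k : 0 <= right_noise p k.
Proof. by rewrite mxE mulr_ge0. Qed.

Lemma noise_cross : left_noise^T *m right_noise = D.
Proof.
apply/matrixP => k l; rewrite mxE.
under eq_bigr do rewrite !mxE.
rewrite -(big_enum_val (fun x : 'I_n1 * 'I_n2 => Num.sqrt (D x.1 x.2) * (k == x.1)%:R *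
   (Num.sqrt (D x.1 x.2) * (l == x.2)%:R))) /=.
rewrite (bigD1 (k, l))//= big1 ?addr0; last first.
  case=> i j /=; rewrite -pair_eqE/= negb_and => /orP[/negPf h|/negPf h].
    by rewrite [k == i]eq_sym h mulr0 mul0r.
  by rewrite [l == j]eq_sym h !mulr0.
by rewrite !eqxx !mulr1 -expr2 sqr_sqrtr.
Qed.

End NoiseMatrices.

Lemma gauss_add d1 d2 (T1 : measurableType d1) (T2 : measurableType d2) (R : realType)
    (P1 : probability T1 R) (P2 : probability T2 R) n m k
    (W1 : T1 -> 'rV[R]_n) (W2 : T2 -> 'rV[R]_m) S1 S2 (L1 : 'M[R]_(n, k)) (L2 : 'M[R]_(m, k)) :
  gauss P1 W1 S1 -> gauss P2 W2 S2 ->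
  gauss (prodP P1 P2) (fun z => W1 z.1 *m L1 + W2 z.2 *m L2)
    (L1^T *m S1 *m L1 + L2^T *m S2 *m L2).
Proof.
move=> g1 g2; have := gauss_mulmx (col_mx L1 L2) (gauss_prod g1 g2).
rewrite tr_col_mx mul_row_block !mulmx0 addr0 add0r mul_row_col.
by under eq_fun do rewrite mul_row_col.
Qed.

Lemma sqrt_sqr (R : realType) (x : R) : 0 <= x -> Num.sqrt x * Num.sqrt x = x.
Proof. by move=> x0; rewrite -expr2 sqr_sqrtr. Qed.

Section BlockSlepian.
Context d1 d2 (T1 : measurableType d1) (T2 : measurableType d2) (R : realType).
Variables (P1 : probability T1 R) (P2 : probability T2 R) (n1 n2 : nat).
Variables (W1 : T1 -> 'rV[R]_(n1 + n2)) (W2 : T2 -> 'rV[R]_(n1 + n2)).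
Variables (S1 : 'M[R]_n1) (S2 : 'M[R]_n2) (C1 C2 : 'M[R]_(n1, n2)).
Let G C := block_mx S1 C C^T S2.
Hypothesis g1 : gauss P1 W1 (G C1).
Hypothesis g2 : gauss P2 W2 (G C2).
Hypothesis C12 : forall i j, C1 i j <= C2 i j.
Variables (f : 'rV[R]_n1 -> R) (g : 'rV[R]_n2 -> R).
Hypotheses (lf : bounded_lipschitz f) (If : increasing_rV f).
Hypotheses (lg : bounded_lipschitz g) (Ig : increasing_rV g).

Let D := C2 - C1.
Let F (x : 'rV[R]_(n1 + n2)) := f (lsubmx x) * g (rsubmx x).

Let D0 i j : 0 <= D i j. Proof. by rewrite !mxE subr_ge0. Qed.

Let lF : bounded_lipschitz F.
Proof.
by apply: bounded_lipschitzM; [exact: bounded_lipschitz_lsubmx|exact: bounded_lipschitz_rsubmx].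
Qed.

(* The interpolation keeps the marginal covariances and has cross-covariance
   [C1 + t *: D]. *)
Let path t (z : T1 * T2) := W1 z.1 *m (Num.sqrt (1 - t))%:M + W2 z.2 *m (Num.sqrt t)%:M.

Let gauss_path t : 0 <= t <= 1 -> gauss (prodP P1 P2) (path t) (G (C1 + t *: D)).
Proof.
move=> /andP[t0 t1]; have := gauss_add (Num.sqrt (1 - t))%:M (Num.sqrt t)%:M g1 g2.
have t1' : 0 <= 1 - t by rewrite subr_ge0.
rewrite !tr_scalar_mx !mul_scalar_mx !mul_mx_scalar !scalerA.
rewrite (sqrt_sqr t0) (sqrt_sqr t1').
rewrite (_ : _ + _ = G (C1 + t *: D))// /G !scale_block_mx add_block_mx -!scalerDl subrK !scale1r.
by congr block_mx; apply/matrixP => i j; rewrite !mxE; ring.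
Qed.

Section Noise.
Context d0 (T0 : measurableType d0) (P0 : probability T0 R).
Variable Z : T0 -> 'rV[R]_(pair_count n1 n2).
Hypothesis gZ : gauss P0 Z 1%:M.
Hypothesis aZ : associated P0 Z.
Let A := left_noise D.
Let B := right_noise D.

(* Noise with the same marginals is added in two ways: driven by one vector
   [Z], it contributes [h *: D] to the cross-covariance; driven by two
   independent copies of [Z], it contributes nothing. *)
Let shared h t (z : (T1 * T2) * T0) : 'rV[R]_(n1 + n2) :=
  path t z.1 *m 1%:M + Z z.2 *m (Num.sqrt h *: row_mx A B).

Let indep h t (z : (T1 * T2) * (T0 * T0)) : 'rV[R]_(n1 + n2) :=
  path t z.1 *m 1%:M + row_mx (Z z.2.1) (Z z.2.2) *m (Num.sqrt h *: block_mx A 0 0 B).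

Let J h t := \int[prodP (prodP P1 P2) (prodP P0 P0)]_z F (indep h t z).

Let gauss_shared h t : 0 <= h -> 0 <= t <= 1 ->
  gauss (prodP (prodP P1 P2) P0) (shared h t)
    (G (C1 + t *: D) + h *: block_mx (A^T *m A) D D^T (B^T *m B)).
Proof.
move=> h0 t01; have := gauss_add 1%:M (Num.sqrt h *: row_mx A B) (gauss_path t01) gZ.
rewrite trmx1 mulmx1 mul1mx [(_ *: _)^T]linearZ/= mulmx1 -scalemxAl -scalemxAr scalerA (sqrt_sqr h0).
rewrite tr_row_mx mul_col_row (_ : A^T *m B = D); last exact: noise_cross.
by rewrite (_ : B^T *m A = D^T)// -(noise_cross D0) trmx_mul trmxK.
Qed.

Let gauss_indep h t : 0 <= h -> 0 <= t <= 1 ->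
  gauss (prodP (prodP P1 P2) (prodP P0 P0)) (indep h t)
    (G (C1 + t *: D) + h *: block_mx (A^T *m A) 0 0 (B^T *m B)).
Proof.
move=> h0 t01.
have := gauss_add 1%:M (Num.sqrt h *: block_mx A 0 0 B) (gauss_path t01) (gauss_prod gZ gZ).
rewrite trmx1 mulmx1 mul1mx [(_ *: _)^T]linearZ/= -scalar_mx_block mulmx1 -scalemxAl -scalemxAr scalerA (sqrt_sqr h0).
by rewrite tr_block_mx mulmx_block !trmx0 !mulmx0 !mul0mx !addr0 !add0r.
Qed.

(* Independent noise at time [t + h] has the law of shared noise at time [t],
   the increment of the path being provided by the noise.  Conditionally on the
   path, association says that sharing the noise raises the expectation. *)
Let step h t : 0 <= h -> 0 <= t -> t + h <= 1 -> J h t <= J h (t + h).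
Proof.
move=> h0 t0 th1.
have t01 : 0 <= t <= 1 by rewrite t0/=; lra.
have th01 : 0 <= t + h <= 1 by rewrite th1 andbT addr_ge0.
have -> : J h (t + h) = \int[prodP (prodP P1 P2) P0]_z F (shared h t z).
  apply: (gauss_same_law (gauss_indep h0 th01) _ lF).
  have := gauss_shared h0 t01.
  have -> // : G (C1 + t *: D) + h *: block_mx (A^T *m A) D D^T (B^T *m B) =
    G (C1 + (t + h) *: D) + h *: block_mx (A^T *m A) 0 0 (B^T *m B).
  rewrite /G !scale_block_mx !add_block_mx !scaler0 !addr0.
  by congr block_mx; apply/matrixP => i j; rewrite !mxE; ring.
have bI := lipschitz_bmeas (prodP (prodP P1 P2) (prodP P0 P0)) (gauss_indep h0 t01).1 lF.
have bS := lipschitz_bmeas (prodP (prodP P1 P2) P0) (gauss_shared h0 t01).1 lF.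
rewrite /J (Ex_prod1 (prodP P1 P2) (prodP P0 P0) bI) (Ex_prod1 (prodP P1 P2) P0 bS); apply: le_Ex.
- exact: (bmeas_Ex1 (prodP P1 P2) (prodP P0 P0) bI).
- exact: (bmeas_Ex1 (prodP P1 P2) P0 bS).
move=> x.
pose f' (u : 'rV[R]_(pair_count n1 n2)) := f (u *m (Num.sqrt h *: A) + lsubmx (path t x)).
pose g' (u : 'rV[R]_(pair_count n1 n2)) := g (u *m (Num.sqrt h *: B) + rsubmx (path t x)).
have lf' : bounded_lipschitz f' by exact: bounded_lipschitz_affine.
have lg' : bounded_lipschitz g' by exact: bounded_lipschitz_affine.
have incr n (k : 'rV[R]_n -> R) (L : 'M[R]_(pair_count n1 n2, n)) u :
    increasing_rV k -> (forall i j, 0 <= L i j) ->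
    increasing_rV (fun x => k (x *m (Num.sqrt h *: L) + u)).
  move=> Ik L0 y v v0; rewrite mulmxDl addrAC; apply: Ik => i.
  by rewrite mxE sumr_ge0// => j _; rewrite !mxE !mulr_ge0.
have If' : increasing_rV f' by apply: incr => //; exact: left_noise_ge0.
have Ig' : increasing_rV g' by apply: incr => //; exact: right_noise_ge0.
have bf' := lipschitz_bmeas P0 gZ.1 lf'; have bg' := lipschitz_bmeas P0 gZ.1 lg'.
have EI y : F (indep h t (x, y)) = f' (Z y.1) * g' (Z y.2).
  rewrite /F /indep/= mulmx1 -scalemxAr mul_row_block !mulmx0 addr0 add0r.
  rewrite /f' /g'; move: (path t x) => p.
  rewrite -!scalemxAr scale_row_mx -{1 2}(hsubmxK p) add_row_mx row_mxKl row_mxKr.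
  by rewrite [lsubmx p + _]addrC [rsubmx p + _]addrC.
have ES y : F (shared h t (x, y)) = f' (Z y) * g' (Z y).
  rewrite /F /shared/= mulmx1 -scalemxAr mul_mx_row.
  rewrite /f' /g'; move: (path t x) => p.
  rewrite -!scalemxAr scale_row_mx -{1 2}(hsubmxK p) add_row_mx row_mxKl row_mxKr.
  by rewrite [lsubmx p + _]addrC [rsubmx p + _]addrC.
rewrite (eq_Ex _ EI) (eq_Ex _ ES).
by rewrite (Ex_prodM P0 P0 bf' bg'); exact: aZ.
Qed.

Let J01 N : J N.+1%:R^-1 0 <= J N.+1%:R^-1 1.
Proof.
pose h : R := N.+1%:R^-1.
have h0 : 0 <= h by rewrite invr_ge0.
have : forall k, (k <= N.+1)%N -> J h 0 <= J h (k%:R * h).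
  elim=> [|k IH] kN; first by rewrite mul0r.
  apply: (le_trans (IH (ltnW kN))).
  rewrite -natr1 mulrDl mul1r; apply: step => //; first by rewrite mulr_ge0.
  by rewrite -{2}(mul1r h) -mulrDl natr1 ler_pdivrMr// mul1r ler_nat.
by move=> /(_ N.+1 (leqnn _)); rewrite mulfV.
Qed.

(* The noise has size [sqrt h], so it disappears when the number of steps
   grows. *)
Let J_cvg t : 0 <= t <= 1 -> J N.+1%:R^-1 t @[N --> \oo] --> \int[prodP P1 P2]_z F (path t z).
Proof.
move=> t01.
have [C [bC lC]] := lF.
have b0 := lipschitz_bmeas (prodP P1 P2) (gauss_path t01).1 lF.
have -> : \int[prodP P1 P2]_z F (path t z) =
    \int[prodP (prodP P1 P2) (prodP P0 P0)]_z F (path t z.1).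
  rewrite [RHS]Ex_prod1; last exact: (bmeas_comp measurable_fst b0).
  by apply: eq_Ex => x; rewrite -[LHS](Ex_cst (prodP P0 P0)).
have C0 : 0 <= C by exact: le_trans (normr_ge0 _) (bC 0).
have N0 N : 0 <= N.+1%:R^-1 :> R by rewrite invr_ge0.
apply: (proj2 (Ex_cvg _ (C := C) _ _ _)).
- by move=> N; case: (lipschitz_bmeas (prodP (prodP P1 P2) (prodP P0 P0)) (gauss_indep (N0 N) t01).1 lF).
- by [].
move=> z.
set r := row_mx (Z z.2.1) (Z z.2.2) *m block_mx A 0 0 B.
have E N : indep N.+1%:R^-1 t z = path t z.1 + Num.sqrt (N.+1%:R^-1) *: r.
  by rewrite /indep mulmx1 -scalemxAr.
apply/cvgrPdist_le => e e0.
pose K := C * \sum_i `|r 0 i|.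
have K0 : 0 <= K by rewrite mulr_ge0// sumr_ge0.
near=> N.
apply: (@le_trans _ _ (Num.sqrt (N.+1%:R^-1) * K)).
  rewrite E (le_trans (lC _ _))// /K mulrCA ler_wpM2l// mulr_sumr ler_sum// => i _.
  by rewrite !mxE opprD addNKr normrN normrM ger0_norm.
have K1 : 0 < K + 1 by rewrite ltr_wpDl.
have h : Num.sqrt (N.+1%:R^-1) <= e / (K + 1).
  have q0 : 0 < e / (K + 1) by rewrite divr_gt0.
  rewrite -(ger0_norm (ltW q0)) -sqrtr_sqr; apply: ler_wsqrtr.
  have h : 0 < (e / (K + 1)) ^+ 2 by rewrite exprn_gt0.
  rewrite invf_ple ?posrE//.
  have : ((e / (K + 1)) ^+ 2)^-1 <= N%:R by near: N; exact: nbhs_infty_ger.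
  by move=> /le_trans; apply; rewrite ler_nat.
apply: (le_trans (ler_wpM2r K0 h)).
by rewrite mulrAC ler_pdivrMr// ler_wpM2l ?ltW// ltrDl.
Unshelve. all: by end_near. Qed.

Lemma slepian_limit :
  \int[prodP P1 P2]_z F (path 0 z) <= \int[prodP P1 P2]_z F (path 1 z).
Proof.
apply: (ler_cvg_to (J_cvg (t := 0) _) (J_cvg (t := 1) _)).
- by rewrite lexx ler01.
- by rewrite lexx ler01.
- by apply: nearW => N; exact: J01.
Qed.

End Noise.

(** Slepian's inequality for pairs of vectors.  For smooth [f] and [g] the
    derivative of the expectation along the path is the sum of
    D i j E (d_i f) (d_j g), which is nonnegative; small independent and shared
    noises replace the derivative, so that no smoothness is required. *)
Theorem block_slepian :
  \int[P1]_w (f (lsubmx (W1 w)) * g (rsubmx (W1 w))) <=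
  \int[P2]_w (f (lsubmx (W2 w)) * g (rsubmx (W2 w))).
Proof.
have [d0 [T0 [P0 [Z [gZ aZ]]]]] := exists_standard_gauss R (pair_count n1 n2).
have := slepian_limit gZ aZ.
have b1 := lipschitz_bmeas P1 g1.1 lF; have b2 := lipschitz_bmeas P2 g2.1 lF.
have E0 z : F (path 0 z) = F (W1 z.1).
  by rewrite /path subr0 sqrtr1 sqrtr0 mulmx1 raddf0 mulmx0 addr0.
have E1 z : F (path 1 z) = F (W2 z.2).
  by rewrite /path subrr sqrtr1 sqrtr0 mulmx1 raddf0 mulmx0 add0r.
rewrite (eq_Ex _ E0) (eq_Ex _ E1).
by rewrite (Ex_prod_fst P1 P2 b1) (Ex_prod_snd P1 P2 b2).
Qed.

End BlockSlepian.

(** * From Gaussian linear forms to the cosine transform *)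

Section RintegralSum.
Context d (T : measurableType d) (R : realType) (P : probability T R).

Lemma integrable_sumr (I : Type) (s : seq I) (f : I -> T -> R) :
  (forall i, P.-integrable setT (EFin \o f i)) ->
  P.-integrable setT (EFin \o (fun w => \sum_(i <- s) f i w)).
Proof.
move=> h; rewrite (_ : _ \o _ = fun w => (\sum_(i <- s) (f i w)%:E)%E).
  by apply: integrable_sum => // i _; exact: h.
by apply/funext => w /=; rewrite sumEFin.
Qed.

Lemma Rintegral_sum (I : Type) (s : seq I) (f : I -> T -> R) :
  (forall i, P.-integrable setT (EFin \o f i)) ->
  \int[P]_w (\sum_(i <- s) f i w) = \sum_(i <- s) \int[P]_w f i w.
Proof.
move=> h; elim: s => [|i s IH].
  by rewrite big_nil; under eq_Rintegral do rewrite big_nil; exact: Ex_cst.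
rewrite big_cons -IH -RintegralD//; last exact: integrable_sumr.
by apply: eq_Ex => w; rewrite big_cons.
Qed.

(** The law of [L] is only known set by set, as in the definition of Gaussian
    vectors; integrability has to be transported along with the integral. *)
Lemma change_of_law (nu : probability (measurableTypeR R) R) (L f : _ -> R) :
  measurable_fun setT L ->
  (forall B, measurable B -> P (L @^-1` B) = nu B) ->
  measurable_fun setT f -> nu.-integrable setT (EFin \o f) ->
  P.-integrable setT (EFin \o (fun w => f (L w))) /\
  \int[P]_w f (L w) = \int[nu]_x f x.
Proof.
move=> mL PL mf /integrableP[mfE fi].
pose L0 : T -> measurableTypeR R := L.
have mL' : measurable_fun setT L0 by exact: mL.
pose L' : {RV P >-> measurableTypeR R} := mfun_Sub (mem_set mL').
have mabs : measurable_fun setT (fun x : measurableTypeR R => `|(f x)%:E|%E).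
  exact: measurableT_comp mfE.
have i1 : P.-integrable setT ((EFin \o f) \o L').
  apply/integrableP; split; first by apply/measurable_EFinP; exact: measurableT_comp.
  apply: le_lt_trans fi.
  rewrite -(ge0_integral_distribution L' mabs)//.
  rewrite le_eqVlt; apply/orP; left; apply/eqP.
  by apply: eq_measure_integral => A mA _; exact: PL.
split=> //; rewrite /Rintegral; congr fine.
transitivity (\int[distribution P L']_y ((EFin \o f) y))%E.
  by rewrite (integral_distribution mfE i1).
by apply: eq_measure_integral => A mA _; exact: PL.
Qed.

End RintegralSum.

Section NormalLawMoments.
Variables (R : realType) (m s : R).

(** Treats the Dirac mass and the nondegenerate normal law uniformly, so that
    the case distinction ends here. *)
Lemma normal_law_moments : exists nu : probability (measurableTypeR R) R,
  [/\ forall B, measurable B -> normal_law m s B = nu B,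
      nu.-integrable setT (EFin \o (fun x => x - m)),
      \int[nu]_x (x - m) = 0,
      nu.-integrable setT (EFin \o (fun x => (x - m) ^+ 2)) &
      \int[nu]_x (x - m) ^+ 2 = s ^+ 2 /\
      forall b, \int[nu]_x cos (x - m + b) = cos b * expR (- (s ^+ 2 / 2))].
Proof.
have mc : measurable_fun setT (fun x : R => x - m) by exact: measurable_funB.
rewrite /normal_law; have [s0|s0] := eqVneq s 0; last first.
  exists (gauss_prob m s).
  have [i1 e1] := gauss_prob_mean m s0.
  have [i2 e2] := gauss_prob_second_moment m s0.
  split=> //; split=> // b.
  have := gauss_prob_cos m 1 b s0; rewrite expr1n mulr1 => <-.
  by apply: eq_Ex => x; rewrite mul1r.
pose nu : probability (measurableTypeR R) R := @dirac _ (measurableTypeR R) m R.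
have int (f : R -> R) : measurable_fun setT f -> nu.-integrable setT (EFin \o f).
  move=> mf; apply/integrableP; split; first exact/measurable_EFinP.
  rewrite integral_dirac//; first by rewrite diracT mul1e ltry.
  by apply: measurableT_comp => //; exact/measurable_EFinP.
have val (f : R -> R) : measurable_fun setT f -> \int[nu]_x f x = f m.
  move=> mf; rewrite /Rintegral integral_dirac//; last exact/measurable_EFinP.
  by rewrite diracT mul1e.
exists nu; split=> //.
- exact: int.
- by rewrite val// subrr.
- by apply: int; exact: measurable_funX.
- split; first by rewrite val ?subrr ?s0//; exact: measurable_funX.
  move=> b; rewrite val; first by rewrite subrr add0r s0 expr0n/= mul0r oppr0 expR0 mulr1.
  by case: (bmeas_cos (measurable_funD mc (measurable_cst b))).
Qed.

End NormalLawMoments.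

Section GaussianVector.
Context d (T : measurableType d) (R : realType) (P : probability T R) (n : nat).
Variable X : 'I_n -> {RV P >-> R}.
Hypothesis gX : gaussian_vector X.

Definition mean_vector : 'rV[R]_n := \row_i \int[P]_w X i w.

Definition centered (w : T) : 'rV[R]_n := random_vector X w - mean_vector.

Let lin (a : 'I_n -> R) (w : T) : R := \sum_i a i * X i w.

Let mlin a : measurable_fun setT (lin a).
Proof. by apply: measurable_sum => i; exact: measurable_funM. Qed.

Let law a : exists m s,
  [/\ P.-integrable setT (EFin \o (fun w => lin a w - m)),
      \int[P]_w (lin a w - m) = 0,
      P.-integrable setT (EFin \o (fun w => (lin a w - m) ^+ 2)),
      \int[P]_w (lin a w - m) ^+ 2 = s ^+ 2 &
      forall b, \int[P]_w cos (lin a w - m + b) = cos b * expR (- (s ^+ 2 / 2))].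
Proof.
have [m [s [s0 PB]]] := gX a; exists m, s.
have [nu [nuE i1 e1 i2 [e2 ec]]] := normal_law_moments m s.
have PL B : measurable B -> P (lin a @^-1` B) = nu B by move=> mB; rewrite -nuE// -PB.
have mc : measurable_fun setT (fun x : R => x - m) by exact: measurable_funB.
have [j1 f1] := change_of_law (mlin a) PL mc i1.
have [j2 f2] := change_of_law (mlin a) PL (measurable_funX 2 mc) i2.
split=> //; [by rewrite -e1 -f1|by rewrite -e2 -f2|].
move=> b; have bc := bmeas_cos (measurable_funD mc (measurable_cst b)).
by have [_ fc] := change_of_law (mlin a) PL bc.1 (bmeas_integrable nu bc); rewrite -ec -fc.
Qed.

Let one_coord i w : lin (fun j => (j == i)%:R) w = X i w.
Proof.
rewrite /lin (bigD1 i)//= eqxx mul1r big1 ?addr0// => j /negPf ->.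
by rewrite mul0r.
Qed.

Let integrable_coord i : P.-integrable setT (EFin \o (X i : T -> R)).
Proof.
have [m [s [i1 _ _ _ _]]] := law (fun j => (j == i)%:R).
have i2 : P.-integrable setT (EFin \o (fun=> m : R)).
  exact: bmeas_integrable (bmeas_cst T m).
have := integrableD measurableT i1 i2; apply: eq_integrable => // w _ /=.
by rewrite one_coord -EFinD subrK.
Qed.

Let mean_law a m : P.-integrable setT (EFin \o (fun w => lin a w - m)) ->
  \int[P]_w (lin a w - m) = 0 -> m = \sum_i a i * mean_vector 0 i.
Proof.
move=> im e0.
have ia i : P.-integrable setT (EFin \o (fun w => a i * X i w)).
  exact: (integrableZl measurableT (a i) (integrable_coord i)).
have i2 : P.-integrable setT (EFin \o (fun=> m : R)).
  exact: bmeas_integrable (bmeas_cst T m).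
have il : P.-integrable setT (EFin \o lin a) by exact: integrable_sumr.
move: e0; rewrite RintegralB// Ex_cst Rintegral_sum// => /eqP; rewrite subr_eq0 => /eqP <-.
by apply: eq_bigr => i _; rewrite RintegralZl// mxE.
Qed.

Lemma centeredE i w : centered w 0 i = X i w - mean_vector 0 i.
Proof. by rewrite !mxE. Qed.

Let centered_sqr i : P.-integrable setT (EFin \o (fun w => centered w 0 i ^+ 2)).
Proof.
have [m [s [i1 e1 i2 _ _]]] := law (fun j => (j == i)%:R).
have := mean_law i1 e1; rewrite (bigD1 i)//= eqxx mul1r big1 ?addr0; last first.
  by move=> j /negPf ->; rewrite mul0r.
move=> mE; move: i2; apply: eq_integrable => // w _ /=.
by rewrite one_coord centeredE mE.
Qed.

Let mcentered i : measurable_fun setT (fun w => centered w 0 i).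
Proof. by under eq_fun do rewrite centeredE; exact: measurable_funB. Qed.

(* From [`|x * y| <= x ^+ 2 + y ^+ 2]. *)
Let centered_prod i j : P.-integrable setT (EFin \o (fun w => centered w 0 i * centered w 0 j)).
Proof.
apply: (le_integrable measurableT _ _ (integrableD measurableT (centered_sqr i) (centered_sqr j))).
  by apply/measurable_EFinP; exact: measurable_funM.
move=> w _ /=; rewrite lee_fin normrM.
set x := centered w 0 i; set y := centered w 0 j.
rewrite [leRHS]ger0_norm ?addr_ge0 ?sqr_ge0// -(real_normK (num_real x)) -(real_normK (num_real y)).
have := sqr_ge0 (`|x| - `|y|); have := normr_ge0 x; have := normr_ge0 y; nra.
Qed.

Let cov_kernelE i j : cov_kernel X i j = \int[P]_w (centered w 0 i * centered w 0 j).
Proof.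
rewrite mxE covariance.unlock !expectation.unlock /Rintegral; congr fine.
by apply: eq_integral => w _; rewrite !centeredE !mxE /=.
Qed.

(** Each linear form of [X] is normal; the first two moments of its law identify
    its mean and variance with those computed from the mean vector and from the
    covariance kernel, by linearity. *)
Theorem gauss_centered : gauss P centered (cov_kernel X).
Proof.
split=> // a b.
have [m [s [i1 e1 i2 e2 ec]]] := law (fun i => a i 0).
have mE := mean_law i1 e1.
have E w : lin (fun i => a i 0) w - m = (centered w *m a) 0 0.
  rewrite mE /lin -sumrB mxE; apply: eq_bigr => i _.
  by rewrite centeredE; ring.
have -> : (a^T *m cov_kernel X *m a) 0 0 = s ^+ 2.
  rewrite -e2.
  transitivity (\int[P]_w \sum_j \sum_i (a i 0 * a j 0) * (centered w 0 i * centered w 0 j)).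
    have ia i j : P.-integrable setT (EFin \o (fun w => (a i 0 * a j 0) * (centered w 0 i * centered w 0 j))).
      exact: (integrableZl measurableT (a i 0 * a j 0) (centered_prod i j)).
    rewrite Rintegral_sum; last by move=> j; exact: integrable_sumr.
    rewrite mxE; apply: eq_bigr => j _; rewrite Rintegral_sum//.
    rewrite mxE mulr_suml; apply: eq_bigr => i _.
    by rewrite RintegralZl// -cov_kernelE mxE; ring.
  apply: eq_Ex => w; rewrite E expr2 mxE mulr_suml exchange_big/=.
  apply: eq_bigr => i _; rewrite mulr_sumr; apply: eq_bigr => j _; ring.
by rewrite -ec; apply: eq_Ex => w; rewrite E.
Qed.

End GaussianVector.

(** * Decorrelation by an added scalar noise *)

Definition supported_fun (R : realType) n (I : {set 'I_n}) (f : 'rV[R]_n -> R) : Prop :=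
  forall x v : 'rV[R]_n, (forall i, i \in I -> v 0 i = 0) -> f (x + v) = f x.

(** The projection onto the coordinates in [I].  A function supported on [I] does
    not see it, and after projecting the two blocks onto [I1] and [I2] the
    cross-covariance vanishes outside [I1] x [I2]; so only the entries of the
    covariance on this rectangle matter. *)
Definition mask (R : realType) n (I : {set 'I_n}) : 'M[R]_n :=
  diag_mx (\row_i (i \in I)%:R).

Lemma scale_const_mx (R : realType) m n (a b : R) :
  a *: const_mx b = const_mx (a * b) :> 'M[R]_(m, n).
Proof. by apply/matrixP => i j; rewrite !mxE. Qed.

Section Comparison.
Context d (T : measurableType d) (R : realType) (P : probability T R) (n : nat).
Variables (W : T -> 'rV[R]_n) (K : 'M[R]_n) (mean : 'rV[R]_n).
Hypothesis gW : gauss P W K.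
Hypothesis symK : K^T = K.
Variables (I1 I2 : {set 'I_n}).

Let Y w := mean + W w.
Let M1 : 'M[R]_n := mask R I1.
Let M2 : 'M[R]_n := mask R I2.
Let S1 := M1^T *m K *m M1.
Let S2 := M2^T *m K *m M2.
Let C12 := M1^T *m K *m M2.

Let crossE i j : C12 i j = ((i \in I1) && (j \in I2))%:R * K i j.
Proof.
rewrite /C12 /M1 /M2 /mask tr_diag_mx mul_diag_mx mul_mx_diag !mxE.
by case: (i \in I1); case: (j \in I2); rewrite /= ?(mul1r, mulr1, mul0r, mulr0).
Qed.

Variables (F G : 'rV[R]_n -> R).
Hypotheses (lF : bounded_lipschitz F) (iF : increasing_rV F) (sF : supported_fun I1 F).
Hypotheses (lG : bounded_lipschitz G) (iG : increasing_rV G) (sG : supported_fun I2 G).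

Let f x := F (x + mean).
Let g x := G (x + mean).

Let lf : bounded_lipschitz f.
Proof.
have := bounded_lipschitz_affine 1%:M mean lF.
by rewrite /f; under [X in bounded_lipschitz X -> _]eq_fun do rewrite mulmx1.
Qed.

Let lg : bounded_lipschitz g.
Proof.
have := bounded_lipschitz_affine 1%:M mean lG.
by rewrite /g; under [X in bounded_lipschitz X -> _]eq_fun do rewrite mulmx1.
Qed.

Let incrf : increasing_rV f. Proof. by move=> x v v0; rewrite /f addrAC; exact: iF. Qed.
Let incrg : increasing_rV g. Proof. by move=> x v v0; rewrite /g addrAC; exact: iG. Qed.

Let fE w u : f (W w *m M1 + u) = F (Y w + u).
Proof.
have h i : i \in I1 -> (W w *m M1 - W w) 0 i = 0.
  by move=> iI; rewrite /M1 /mask mul_mx_diag !mxE iI mulr1 subrr.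
rewrite /f -(sF (Y w + u) h) /Y; apply: congr1.
by move: (W w *m M1) (W w) => a b; apply/rowP => i; rewrite !mxE; ring.
Qed.

Let gE w u : g (W w *m M2 + u) = G (Y w + u).
Proof.
have h i : i \in I2 -> (W w *m M2 - W w) 0 i = 0.
  by move=> iI; rewrite /M2 /mask mul_mx_diag !mxE iI mulr1 subrr.
rewrite /g -(sG (Y w + u) h) /Y; apply: congr1.
by move: (W w *m M2) (W w) => a b; apply/rowP => i; rewrite !mxE; ring.
Qed.

Let C21 : M2^T *m K *m M1 = C12^T.
Proof. by rewrite /C12 !trmx_mul symK trmxK mulmxA. Qed.

Let gauss_same : gauss P (fun w => W w *m row_mx M1 M2) (block_mx S1 C12 C12^T S2).
Proof.
have := gauss_mulmx (row_mx M1 M2) gW.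
by rewrite tr_row_mx mul_col_mx mul_col_row C21.
Qed.

Let gauss_copies : gauss (prodP P P) (fun z => row_mx (W z.1) (W z.2) *m block_mx M1 0 0 M2)
  (block_mx S1 0 0^T S2).
Proof.
have := gauss_mulmx (block_mx M1 0 0 M2) (gauss_prod gW gW).
rewrite tr_block_mx !mulmx_block !trmx0.
by rewrite !(mulmx0, mul0mx, addr0, add0r).
Qed.

(** Comparison with two independent copies, whose cross-covariance is 0. *)
Lemma association_positive : (forall i j, i \in I1 -> j \in I2 -> 0 <= K i j) ->
  (\int[P]_w F (Y w)) * (\int[P]_w G (Y w)) <= \int[P]_w (F (Y w) * G (Y w)).
Proof.
move=> K0.
have C0 i j : (0 : 'M[R]_n) i j <= C12 i j.
  rewrite mxE crossE; case: (boolP (i \in I1)) => [iI|_]; last by rewrite mul0r.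
  by case: (boolP (j \in I2)) => [jI|_]; rewrite ?mul0r// mul1r K0.
have := block_slepian gauss_copies gauss_same C0 lf incrf lg incrg.
have fE0 w : f (W w *m M1) = F (Y w) by rewrite -[_ *m M1]addr0 fE addr0.
have gE0 w : g (W w *m M2) = G (Y w) by rewrite -[_ *m M2]addr0 gE addr0.
have E1 z : f (lsubmx (row_mx (W z.1) (W z.2) *m block_mx M1 0 0 M2)) *
    g (rsubmx (row_mx (W z.1) (W z.2) *m block_mx M1 0 0 M2)) = F (Y z.1) * G (Y z.2).
  by rewrite mul_row_block !mulmx0 addr0 add0r row_mxKl row_mxKr fE0 gE0.
have E2 w : f (lsubmx (W w *m row_mx M1 M2)) * g (rsubmx (W w *m row_mx M1 M2)) =
    F (Y w) * G (Y w).
  by rewrite mul_mx_row row_mxKl row_mxKr fE0 gE0.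
have mY i : measurable_fun setT (fun w => Y w 0 i).
  by rewrite /Y; under eq_fun do rewrite mxE; apply: measurable_funD => //; exact: gW.1.
have bF := lipschitz_bmeas P mY lF; have bG := lipschitz_bmeas P mY lG.
rewrite (eq_Ex _ E1) (eq_Ex _ E2).
by rewrite (Ex_prodM P P bF bG).
Qed.

Section SharedNoise.
Variable c : R.
Let N : probability (measurableTypeR R) R := gauss_prob 0 1.
Let c1 : 'M[R]_(1, n) := const_mx c.
Let z1 (x : measurableTypeR R) : 'rV[R]_1 := const_mx (x - 0).

Let gN : gauss N z1 1%:M.
Proof. by have := gauss_normal 0 (oner_neq0 R); rewrite expr1n. Qed.

Let z1E x : z1 x *m c1 = const_mx (c * x).
Proof. by apply/rowP => i; rewrite mxE big_ord1 !mxE subr0 mulrC. Qed.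

Let c1c1 : c1^T *m c1 = const_mx (c ^+ 2).
Proof. by apply/matrixP => i j; rewrite mxE big_ord1 !mxE expr2. Qed.

Let gauss_indep_noise : gauss (prodP P (prodP N N))
  (fun z => W z.1 *m row_mx M1 M2 + row_mx (z1 z.2.1) (z1 z.2.2) *m block_mx c1 0 0 c1)
  (block_mx (S1 + const_mx (c ^+ 2)) C12 C12^T (S2 + const_mx (c ^+ 2))).
Proof.
have := gauss_add (row_mx M1 M2) (block_mx c1 0 0 c1) gW (gauss_prod gN gN).
rewrite tr_row_mx mul_col_mx mul_col_row C21 -scalar_mx_block mulmx1 tr_block_mx mulmx_block.
by rewrite !trmx0 !mulmx0 !mul0mx !addr0 !add0r c1c1 add_block_mx !addr0.
Qed.

Let gauss_shared_noise (e : R) : e ^+ 2 = 1 -> gauss (prodP (prodP P P) N)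
  (fun z => row_mx (W z.1.1) (W z.1.2) *m block_mx M1 0 0 M2 + z1 z.2 *m row_mx c1 (e *: c1))
  (block_mx (S1 + const_mx (c ^+ 2)) (const_mx (e * c ^+ 2)) (const_mx (e * c ^+ 2))^T
     (S2 + const_mx (c ^+ 2))).
Proof.
move=> e1.
have := gauss_add (block_mx M1 0 0 M2) (row_mx c1 (e *: c1)) (gauss_prod gW gW) gN.
rewrite mulmx1 tr_row_mx mul_col_row [(e *: c1)^T]linearZ/= -!scalemxAl -!scalemxAr c1c1 scalerA -expr2 e1 scale1r.
rewrite tr_block_mx !mulmx_block !trmx0.
rewrite !(mulmx0, mul0mx, addr0, add0r) add_block_mx !add0r.
by rewrite trmx_const !scale_const_mx; exact.
Qed.

Let E1 z : f (lsubmx (W z.1 *m row_mx M1 M2 + row_mx (z1 z.2.1) (z1 z.2.2) *m block_mx c1 0 0 c1)) *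
  g (rsubmx (W z.1 *m row_mx M1 M2 + row_mx (z1 z.2.1) (z1 z.2.2) *m block_mx c1 0 0 c1)) =
  F (Y z.1 + const_mx (c * z.2.1)) * G (Y z.1 + const_mx (c * z.2.2)).
Proof.
rewrite mul_mx_row mul_row_block !mulmx0 addr0 add0r add_row_mx row_mxKl row_mxKr.
by rewrite !z1E fE gE.
Qed.

Let E2 e z : f (lsubmx (row_mx (W z.1.1) (W z.1.2) *m block_mx M1 0 0 M2 + z1 z.2 *m row_mx c1 (e *: c1))) *
  g (rsubmx (row_mx (W z.1.1) (W z.1.2) *m block_mx M1 0 0 M2 + z1 z.2 *m row_mx c1 (e *: c1))) =
  F (Y z.1.1 + const_mx (c * z.2)) * G (Y z.1.2 + const_mx (e * c * z.2)).
Proof.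
rewrite mul_mx_row mul_row_block !mulmx0 addr0 add0r add_row_mx row_mxKl row_mxKr.
rewrite -scalemxAr !z1E fE gE.
by rewrite scale_const_mx mulrA.
Qed.

(** Both pairs have marginal covariances K + c^2.  The cross-covariance is K for
    the first, where each block has its own scalar noise, and c^2 for the second,
    where independent copies share one. *)
Lemma decorrelate_above : (forall i j, i \in I1 -> j \in I2 -> K i j <= c ^+ 2) ->
  \int[prodP P (prodP N N)]_z
    (F (Y z.1 + const_mx (c * z.2.1)) * G (Y z.1 + const_mx (c * z.2.2))) <=
  \int[prodP (prodP P P) N]_z
    (F (Y z.1.1 + const_mx (c * z.2)) * G (Y z.1.2 + const_mx (c * z.2))).
Proof.
move=> Kc.
have CK i j : C12 i j <= (const_mx (1 * c ^+ 2) : 'M[R]_n) i j.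
  rewrite crossE mxE mul1r; case: (boolP (i \in I1)) => [iI|_]; last by rewrite mul0r sqr_ge0.
  by case: (boolP (j \in I2)) => [jI|_]; rewrite ?mul0r ?sqr_ge0// mul1r Kc.
have := block_slepian gauss_indep_noise (gauss_shared_noise (expr1n R 2)) CK lf incrf lg incrg.
rewrite (eq_Ex _ E1) (eq_Ex _ (E2 1)).
by under [leRHS]eq_Rintegral do rewrite mul1r.
Qed.

(** The same comparison with opposite noises in the two copies, which have
    cross-covariance - c^2. *)
Lemma decorrelate_below : (forall i j, i \in I1 -> j \in I2 -> - c ^+ 2 <= K i j) ->
  \int[prodP (prodP P P) N]_z
    (F (Y z.1.1 + const_mx (c * z.2)) * G (Y z.1.2 + const_mx (- c * z.2))) <=
  \int[prodP P (prodP N N)]_z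
    (F (Y z.1 + const_mx (c * z.2.1)) * G (Y z.1 + const_mx (c * z.2.2))).
Proof.
move=> Kc.
have CK i j : (const_mx (-1 * c ^+ 2) : 'M[R]_n) i j <= C12 i j.
  rewrite crossE mxE mulN1r; case: (boolP (i \in I1)) => [iI|_]; last by rewrite mul0r oppr_le0 sqr_ge0.
  by case: (boolP (j \in I2)) => [jI|_]; rewrite ?mul0r ?oppr_le0 ?sqr_ge0// mul1r Kc.
have e1 : (-1) ^+ 2 = 1 :> R by rewrite sqrrN expr1n.
have := block_slepian (gauss_shared_noise e1) gauss_indep_noise CK lf incrf lg incrg.
rewrite (eq_Ex _ E1) (eq_Ex _ (E2 (-1))).
by under [leLHS]eq_Rintegral do rewrite mulN1r.
Qed.

End SharedNoise.
End Comparison.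

(** * Heights of increasing events *)

Section Height.
Variables (R : realType) (n : nat) (A : set 'rV[R]_n).
Hypothesis incA : increasing_event A.
Hypotheses (A_neq0 : A !=set0) (A_neqT : (~` A) !=set0).

(** Signed distance to the boundary of [A] along the diagonal. *)
Definition height (x : 'rV[R]_n) : R := sup [set s | A (x - const_mx s)].

Let dist (x y : 'rV[R]_n) : R := \sum_i `|x 0 i - y 0 i|.

Let dist_ge (x y : 'rV[R]_n) i : `|x 0 i - y 0 i| <= dist x y.
Proof. by rewrite /dist (bigD1 i)//= lerDl sumr_ge0. Qed.

Let up (x y : 'rV[R]_n) : A x -> (forall i, x 0 i <= y 0 i) -> A y.
Proof.
move=> Ax xy; have -> : y = x + (y - x) by rewrite addrC subrK.
by apply: incA => // i; rewrite !mxE subr_ge0.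
Qed.

(** Moving far enough down the diagonal leaves [A], since one passes below a point
    outside [A]; moving far enough up enters it. *)
Lemma height_has_sup x : has_sup [set s | A (x - const_mx s)].
Proof.
have [a Aa] := A_neq0; have [b nAb] := A_neqT; split.
  exists (- dist a x) => /=; apply: (up Aa) => i.
  have := dist_ge a x i; rewrite ler_norml !mxE => /andP[_].
  by rewrite opprK lerBlDl.
exists (dist x b) => s /= As; rewrite leNgt; apply/negP => bs; apply: nAb.
apply: (up As) => i; rewrite !mxE.
have := dist_ge x b i; rewrite ler_norml => /andP[_].
by rewrite lerBlDl lerBlDr => /le_trans; apply; rewrite lerD2l ltW.
Qed.

Lemma height_shift (x : 'rV[R]_n) s : height (x + const_mx s) = height x + s.
Proof.
have E t : x + const_mx s - const_mx t = x - const_mx (t - s).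
  by apply/rowP => i; rewrite !mxE opprB addrA addrAC.
apply/eqP; rewrite eq_le; apply/andP; split.
  apply: ge_sup; first by have [] := height_has_sup (x + const_mx s).
  move=> t /=; rewrite E -lerBlDr => At.
  by apply: ub_le_sup => //; have [] := height_has_sup x.
rewrite -lerBrDr; apply: ge_sup; first by have [] := height_has_sup x.
move=> t /= At; rewrite lerBrDr; apply: ub_le_sup.
  by have [] := height_has_sup (x + const_mx s).
by rewrite /= E addrK.
Qed.

Lemma height_increasing : increasing_rV height.
Proof.
move=> x v v0; apply: ge_sup; first by have [] := height_has_sup x.
move=> t /= At; apply: ub_le_sup; first by have [] := height_has_sup (x + v).
by rewrite /= addrAC; exact: incA.
Qed.

Lemma height_ge0 x : A x -> 0 <= height x.
Proof.
move=> Ax; apply: ub_le_sup; first by have [] := height_has_sup x.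
by rewrite /= (_ : x - const_mx 0 = x)//; apply/rowP => i; rewrite !mxE subr0.
Qed.

Lemma height_gt0 x : 0 < height x -> A x.
Proof.
move=> /(sup_gt _)[]; first by have [] := height_has_sup x.
move=> s /= As s0; apply: (up As) => i.
by rewrite !mxE gerBl ltW.
Qed.

(** Shifting [v] up by its distance to [u] brings it above [u]; monotonicity and
    the shift property do the rest. *)
Lemma height_lipschitz (x y : 'rV[R]_n) : `|height x - height y| <= \sum_i `|x 0 i - y 0 i|.
Proof.
suff H u v : height u - height v <= dist u v.
  rewrite ler_norml H andbT lerNl opprB.
  rewrite (_ : \sum_i _ = dist y x); first exact: H.
  by apply: eq_bigr => i _; rewrite distrC.
rewrite lerBlDl -height_shift.
have -> : v + const_mx (dist u v) = u + (v + const_mx (dist u v) - u).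
  by rewrite [RHS]addrC subrK.
apply: height_increasing => i; rewrite !mxE.
have := dist_ge u v i; rewrite ler_norml => /andP[_].
by rewrite lerBlDl -subr_ge0.
Qed.

Lemma height_supported I : supported_on I A -> supported_fun I height.
Proof.
move=> sA x v v0; congr sup; apply/seteqP; split=> s /=; rewrite addrAC.
  exact: (sA _ _ v0).2.
exact: (sA _ _ v0).1.
Qed.

End Height.

(** * Functions of the heights *)

Section Truncation.
Variable R : realType.
Implicit Types a b s t : R.

Definition clamp a b t := Num.max a (Num.min b t).

Lemma clamp_bounds a b t : a <= b -> a <= clamp a b t <= b.
Proof. by move=> ab; rewrite /clamp le_max lexx/= ge_max ab ge_min lexx. Qed.

Lemma clamp_id a b t : a <= t <= b -> clamp a b t = t.
Proof. by move=> /andP[at_ tb]; rewrite /clamp min_r// max_r. Qed.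

Lemma clamp_left a b t : a <= b -> t <= a -> clamp a b t = a.
Proof. by move=> ab ta; rewrite /clamp min_r ?(le_trans ta)// max_l. Qed.

Lemma clamp_right a b t : a <= b -> b <= t -> clamp a b t = b.
Proof. by move=> ab bt; rewrite /clamp min_l// max_r. Qed.

Lemma clamp_incr a b s t : s <= t -> clamp a b s <= clamp a b t.
Proof.
move=> st; rewrite /clamp ge_max !le_max lexx/=; apply/orP; right.
by rewrite le_min !ge_min lexx st !orbT.
Qed.

Lemma clamp_gap a b s t : a <= b -> s <= t -> clamp a b t - clamp a b s <= t - s.
Proof.
move=> ab st; rewrite /clamp.
by case: (leP b t) => h1; case: (leP b s) => h2; rewrite ?maxEle;
  do ?[case: ifP => ?]; lra.
Qed.

(** The function on the left only varies on [- eps, 0], with slope 1.  For t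
    there, t + y stays within eps + delta of 0, where the function on the right
    has slope 1 too. *)
Lemma clamp_slope eps delta s t y : 0 <= eps -> s <= t -> `|y| <= delta ->
  clamp 0 eps (t + eps) - clamp 0 eps (s + eps) <=
  clamp (- (eps + delta)) (eps + delta) (t + y) -
  clamp (- (eps + delta)) (eps + delta) (s + y).
Proof.
move=> e0 st; rewrite ler_norml => /andP[y1 y2]; set M := eps + delta.
have mono u v : u <= v -> clamp (- M) M u <= clamp (- M) M v by exact: clamp_incr.
have [h|h] := leP t (- eps).
  rewrite !(@clamp_left 0 eps) ?subrr ?subr_ge0//; last 2 first.
  - by lra.
  - by lra.
  by apply: mono; rewrite lerD2r.
have [h'|h'] := leP 0 s.
  rewrite !(@clamp_right 0 eps) ?subrr ?subr_ge0//; last 2 first.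
  - by lra.
  - by lra.
  by apply: mono; rewrite lerD2r.
have ht : clamp 0 eps (t + eps) - eps + y <= clamp (- M) M (t + y).
  have tt : clamp 0 eps (t + eps) - eps <= t.
    have [t0|t0] := leP t 0; first by rewrite clamp_id; lra.
    by rewrite clamp_right; lra.
  have /andP[c0 c1] := clamp_bounds (t + eps) e0.
  rewrite -{1}(@clamp_id (- M) M (_ + y)); first by apply: mono; lra.
  by rewrite /M; lra.
have hs : clamp (- M) M (s + y) <= clamp 0 eps (s + eps) - eps + y.
  have ss : s <= clamp 0 eps (s + eps) - eps.
    have [s1|s1] := leP s (- eps); first by rewrite clamp_left; lra.
    by rewrite clamp_id; lra.
  have /andP[c0 c1] := clamp_bounds (s + eps) e0.
  rewrite -[leRHS](@clamp_id (- M) M (_ + y)); first by apply: mono; lra.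
  by rewrite /M; lra.
by lra.
Qed.

Lemma incr_lipschitz (phi : R -> R) k :
  (forall s t, s <= t -> phi s <= phi t) ->
  (forall s t, s <= t -> phi t - phi s <= k * (t - s)) ->
  forall s t, `|phi s - phi t| <= k * `|s - t|.
Proof.
move=> i l s t; wlog st : s t / s <= t.
  by move=> H; have [|/ltW] := leP s t; [exact: H|rewrite distrC [X in _ * X]distrC; exact: H].
rewrite distrC [X in _ * X]distrC !ger0_norm ?subr_ge0//; [exact: l|exact: i].
Qed.

End Truncation.

Section Profiles.
Variables (R : realType) (n : nat) (A : set 'rV[R]_n) (I : {set 'I_n}).
Hypothesis incA : increasing_event A.
Hypothesis supA : supported_on I A.
Hypotheses (A_neq0 : A !=set0) (A_neqT : (~` A) !=set0).

(** Everything needed for the comparison results is inherited from the height. *)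
Lemma profile_regular (phi : R -> R) C k :
  (forall t, `|phi t| <= C) -> (forall s t, s <= t -> phi s <= phi t) ->
  (forall s t, s <= t -> phi t - phi s <= k * (t - s)) ->
  [/\ bounded_lipschitz (phi \o height A), increasing_rV (phi \o height A) &
      supported_fun I (phi \o height A)].
Proof.
move=> bphi iphi lphi; split.
- have C0 : 0 <= C by exact: le_trans (normr_ge0 _) (bphi 0).
  have k0 : 0 <= k.
    have := lphi 0 1 ler01; rewrite subr0 mulr1; apply: le_trans.
    by rewrite subr_ge0 iphi.
  exists (C + k); split=> [x|x y]; first by rewrite (le_trans (bphi _))// lerDl.
  apply: (le_trans (incr_lipschitz iphi lphi _ _)).
  apply: (le_trans (ler_wpM2l k0 (height_lipschitz incA A_neq0 A_neqT x y))).
  by rewrite ler_wpM2r ?sumr_ge0// lerDr.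
- by move=> x v v0; apply: iphi; exact: height_increasing.
- by move=> x v v0; rewrite /= (height_supported supA).
Qed.

Variable delta : R.
Hypothesis delta0 : 0 < delta.

(** The offset [b] counts shifts in units of the width [delta]. *)
Definition ramp (b t : R) : R := clamp 0 1 (t / delta + b).

Lemma ramp01 b t : 0 <= ramp b t <= 1.
Proof. exact: clamp_bounds. Qed.

Lemma ramp_regular b :
  [/\ bounded_lipschitz (ramp b \o height A), increasing_rV (ramp b \o height A) &
      supported_fun I (ramp b \o height A)].
Proof.
apply: (@profile_regular _ 1 delta^-1).
- by move=> t; have /andP[h0 h1] := ramp01 b t; rewrite ger0_norm.
- by move=> s t st; apply: clamp_incr; rewrite lerD2r ler_pM2r ?invr_gt0.
- move=> s t st; apply: (le_trans (clamp_gap _ _)) => //.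
    by rewrite lerD2r ler_pM2r ?invr_gt0.
  by rewrite [leRHS]mulrC mulrBl; lra.
Qed.

(** A ramp takes the width [delta] to rise from 0 to 1: hence the difference of
    one unit of offset between this bound and the next. *)
Lemma indic_le_ramp x s : \1_A (x + const_mx s) <= ramp (1 + s / delta) (height A x).
Proof.
rewrite indicE; case: (boolP (x + const_mx s \in A)) => [/set_mem As|_].
  have := height_ge0 incA A_neq0 A_neqT As; rewrite height_shift// => h.
  rewrite /ramp clamp_right// addrCA -mulrDl lerDl.
  by rewrite divr_ge0 // ltW.
by have /andP[] := ramp01 (1 + s / delta) (height A x).
Qed.

Lemma ramp_le_indic x s : ramp (s / delta) (height A x) <= \1_A (x + const_mx s).
Proof.
rewrite indicE; case: (boolP (x + const_mx s \in A)) => [_|/negP As].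
  by have /andP[] := ramp01 (s / delta) (height A x).
rewrite /ramp clamp_left// -mulrDl -(height_shift incA A_neq0 A_neqT).
rewrite pmulr_lle0 ?invr_gt0// leNgt; apply/negP => h; apply: As.
by apply/mem_set; exact: height_gt0 h.
Qed.

End Profiles.

Section Excess.
Variables (R : realType) (delta : R).
Hypothesis delta0 : 0 < delta.

(** The price of perturbing the argument of a ramp by [y].  One more unit of
    offset compensates every perturbation up to [delta]; beyond it the price is
    1, the oscillation of a ramp.  The quadratic form makes the mean price a
    second moment, as in Chebyshev's inequality. *)
Definition excess (y : R) : R := Num.min 1 (y ^+ 2 / delta ^+ 2).

Lemma excess_ge0 y : 0 <= excess y.
Proof. by rewrite /excess le_min ler01 divr_ge0 ?sqr_ge0. Qed.

Lemma excess_le1 y : excess y <= 1.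
Proof. by rewrite /excess ge_min lexx. Qed.

Lemma excessN y : excess (- y) = excess y.
Proof. by rewrite /excess sqrrN. Qed.

Lemma excess_far y : delta < `|y| -> excess y = 1.
Proof.
move=> h; rewrite /excess min_l// ler_pdivlMr ?exprn_gt0// mul1r.
by rewrite -[y ^+ 2]real_normK ?num_real// lerXn2r ?nnegrE ?(ltW delta0)// ltW.
Qed.

Lemma ramp_excess b t y : ramp delta b t <= ramp delta (b + 1) (t + y) + excess y.
Proof.
have [h|h] := leP `|y| delta; last first.
  rewrite (excess_far h); have /andP[h1 _] := ramp01 delta (b + 1) (t + y).
  by have /andP[_ h2] := ramp01 delta b t; lra.
apply: (@le_trans _ _ (ramp delta (b + 1) (t + y))); last by rewrite lerDl excess_ge0.
apply: clamp_incr; rewrite mulrDl.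
have : - 1 <= y / delta.
  by rewrite ler_pdivlMr// mulN1r; move: h; rewrite ler_norml => /andP[].
by lra.
Qed.

Lemma ramp_excessM b t t' y y' : ramp delta b t * ramp delta b t' <=
  ramp delta (b + 1) (t + y) * ramp delta (b + 1) (t' + y') + excess y + excess y'.
Proof.
have h1 := ramp_excess b t y; have h2 := ramp_excess b t' y'.
have /andP[a0 a1] := ramp01 delta b t.
have /andP[b0 b1] := ramp01 delta (b + 1) (t' + y').
have e1 := excess_ge0 y; have e2 := excess_ge0 y'.
have := excess_le1 y.
move: h1 h2 a0 a1 b0 b1 e1 e2.
set f := ramp _ _ _; set f' := ramp _ _ _; set g := ramp _ _ t'; set g' := ramp _ _ (t' + _).
nra.
Qed.

Lemma bmeas_excess (c : R) : bmeas (fun z : measurableTypeR R => excess (c * z)).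
Proof.
split; last first.
  by exists 1 => z; rewrite ger0_norm ?excess_ge0 ?excess_le1.
apply: measurable_minr => //; apply: measurable_funM => //.
by apply: measurable_funX; exact: measurable_funM.
Qed.

Lemma Ex_excess c : \int[gauss_prob 0 1]_z excess (c * z) <= c ^+ 2 / delta ^+ 2.
Proof.
have [i1 e1] := gauss_prob_second_moment 0 (oner_neq0 R).
have i2 : (gauss_prob (0 : R) 1).-integrable setT
    (EFin \o (fun z => (c ^+ 2 / delta ^+ 2) * (z - 0) ^+ 2)).
  exact: (integrableZl measurableT (c ^+ 2 / delta ^+ 2) i1).
have -> : c ^+ 2 / delta ^+ 2 =
    \int[gauss_prob 0 1]_z ((c ^+ 2 / delta ^+ 2) * (z - 0) ^+ 2).
  by rewrite (RintegralZl _ measurableT i1) e1 expr1n mulr1.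
apply: (le_Rintegral measurableT _ i2).
  exact: (bmeas_integrable _ (bmeas_excess c)).
move=> z _; rewrite subr0 /excess ge_min; apply/orP; right.
by rewrite exprMn mulrAC.
Qed.

End Excess.

(** The variance of [p] is at most its mean square distance to [a], which is at
    most c^2; the covariance is bounded by the mean of the two variances. *)
Lemma covariance_lipschitz_normal (R : realType) (p q : measurableTypeR R -> R) (a b c : R) :
  bmeas p -> bmeas q -> (forall z, `|p z - a| <= `|c * z|) ->
  (forall z, `|q z - b| <= `|c * z|) ->
  \int[gauss_prob 0 1]_z (p z * q z) -
  (\int[gauss_prob 0 1]_z p z) * (\int[gauss_prob 0 1]_z q z) <= c ^+ 2.
Proof.
move=> bp bq pc qc; set N := gauss_prob 0 1.
set m := \int[N]_z p z; set k := \int[N]_z q z.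
have sq (g : measurableTypeR R -> R) u : bmeas g -> (forall z, `|g z - u| <= `|c * z|) ->
    \int[N]_z (g z - \int[N]_y g y) ^+ 2 <= c ^+ 2.
  move=> bg gc; set v := \int[N]_y g y.
  have [i1 e1] := gauss_prob_second_moment (0 : R) (oner_neq0 R).
  have i2 : N.-integrable setT (EFin \o (fun z => c ^+ 2 * (z - 0) ^+ 2)).
    exact: (integrableZl measurableT (c ^+ 2) i1).
  have bgu : bmeas (fun z => g z - u) by apply: bmeasB => //; exact: bmeas_cst.
  have bgu2 : bmeas (fun z => (g z - u) ^+ 2) by exact: bmeasM.
  have vu : \int[N]_z (g z - u) = v - u by rewrite (ExB N bg (bmeas_cst _ u)) Ex_cst.
  have -> : \int[N]_z (g z - v) ^+ 2 = \int[N]_z (g z - u) ^+ 2 - (v - u) ^+ 2.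
    have bl : bmeas (fun z => 2 * (v - u) * (g z - u)) by exact: bmeasZ.
    transitivity (\int[N]_z (((g z - u) ^+ 2 - 2 * (v - u) * (g z - u)) + (v - u) ^+ 2)).
      by apply: eq_Ex => z; ring.
    rewrite (ExD N (bmeasB bgu2 bl) (bmeas_cst _ _)) (ExB N bgu2 bl) (ExZ N _ bgu) vu Ex_cst.
    by ring.
  have le2 : \int[N]_z (g z - u) ^+ 2 <= c ^+ 2.
    have -> : c ^+ 2 = \int[N]_z (c ^+ 2 * (z - 0) ^+ 2).
      by rewrite (RintegralZl _ measurableT i1) e1 expr1n mulr1.
    apply: (le_Rintegral measurableT (bmeas_integrable N bgu2) i2) => z _.
    rewrite subr0 -exprMn -[leLHS]real_normK ?num_real// -[leRHS]real_normK ?num_real//.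
    by rewrite lerXn2r ?nnegrE.
  by rewrite (le_trans _ le2)// gerBl sqr_ge0.
have sp := sq p a bp pc; have sqq := sq q b bq qc.
have bpm : bmeas (fun z => p z - m) by apply: bmeasB => //; exact: bmeas_cst.
have bqk : bmeas (fun z => q z - k) by apply: bmeasB => //; exact: bmeas_cst.
have bp2 : bmeas (fun z => (p z - m) ^+ 2) by exact: bmeasM.
have bq2 : bmeas (fun z => (q z - k) ^+ 2) by exact: bmeasM.
have bpq := bmeasM bp bq.
have -> : \int[N]_z (p z * q z) - m * k = \int[N]_z ((p z - m) * (q z - k)).
  have bl1 : bmeas (fun z => m * q z) by exact: bmeasZ.
  have bl2 : bmeas (fun z => k * p z) by exact: bmeasZ.
  transitivity (\int[N]_z ((p z * q z - m * q z - k * p z) + m * k)).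
    rewrite (ExD N (bmeasB (bmeasB bpq bl1) bl2) (bmeas_cst _ _)) (ExB N (bmeasB bpq bl1) bl2).
    by rewrite (ExB N bpq bl1) (ExZ N m bq) (ExZ N k bp) Ex_cst -/m -/k; ring.
  by apply: eq_Ex => z; ring.
apply: (@le_trans _ _ (\int[N]_z (2^-1 * ((p z - m) ^+ 2 + (q z - k) ^+ 2)))).
  apply: le_Ex; [exact: bmeasM|by apply: bmeasZ; exact: bmeasD|move=> z].
  by have := sqr_ge0 ((p z - m) - (q z - k)); lra.
by rewrite (ExZ N _ (bmeasD bp2 bq2)) (ExD N bp2 bq2); lra.
Qed.

(** * Decoupling of nontrivial events *)

Section Decoupling.
Context d (T : measurableType d) (R : realType) (P : probability T R) (n : nat).
Variable X : 'I_n -> {RV P >-> R}.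
Hypothesis gX : gaussian_vector X.

Let Y (w : T) : 'rV[R]_n := mean_vector X + centered X w.
Let K := cov_kernel X.
Let N : probability (measurableTypeR R) R := gauss_prob 0 1.
Let gW := gauss_centered gX.

Let YE w : random_vector X w = Y w.
Proof. by rewrite /Y /centered addrC subrK. Qed.

Let symK : K^T = K.
Proof. by apply/matrixP => i j; rewrite !mxE covarianceC. Qed.

Let mY i : measurable_fun setT (fun w => Y w 0 i).
Proof.
by rewrite /Y; under eq_fun do rewrite mxE; apply: measurable_funD => //; exact: gW.1.
Qed.

Let mYs d' (T' : measurableType d') (u : T' -> T) (s : T' -> R) i :
  measurable_fun setT u -> measurable_fun setT s ->
  measurable_fun setT (fun z => (Y (u z) + const_mx (s z)) 0 i).
Proof.
move=> mu ms; under eq_fun do rewrite mxE [X in _ + X]mxE.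
by apply: measurable_funD => //; exact: (measurableT_comp (mY i) mu).
Qed.

Definition event_prob (A : set 'rV[R]_n) a := \int[P]_w (\1_A (Y w + const_mx a) : R).

Lemma bmeas_event A a : borel_event A -> bmeas (fun w => \1_A (Y w + const_mx a) : R).
Proof.
move=> bA; apply: (@bmeas_indic _ T R ((fun w => Y w + const_mx a) @^-1` A)).
apply: (borel_preimage P) => // i.
by apply: mYs => //; exact: measurable_id.
Qed.

Lemma event_probE A a : borel_event A -> (event_prob A a)%:E = shift_prob X a A.
Proof.
move=> bA; rewrite /event_prob /shift_prob.
under eq_set do rewrite YE.
rewrite -Ex_indic; first by congr EFin; apply: eq_Ex => w; rewrite !indicE.
apply: (@borel_preimage _ _ _ P _ (fun w => Y w + const_mx a)) => // i.
by apply: mYs => //; exact: measurable_id.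
Qed.

Definition joint_prob (A1 A2 : set 'rV[R]_n) : R := \int[P]_w (\1_A1 (Y w) * \1_A2 (Y w)).

Let const0 w : Y w + const_mx 0 = Y w.
Proof. by apply/rowP => i; rewrite !mxE addr0. Qed.

Let bmeas_event0 A : borel_event A -> bmeas (fun w => \1_A (Y w) : R).
Proof. by move=> bA; have := bmeas_event 0 bA; under eq_fun do rewrite const0. Qed.

Lemma joint_probE A1 A2 : borel_event A1 -> borel_event A2 ->
  (joint_prob A1 A2)%:E = P [set w | (A1 `&` A2) (random_vector X w)].
Proof.
move=> b1 b2; under eq_set do rewrite YE.
rewrite -Ex_indic.
  by congr EFin; apply: eq_Ex => w; rewrite !indicE -natrM mulnb -in_setI.
apply: measurableI; [exact: (borel_preimage P mY b1)|exact: (borel_preimage P mY b2)].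
Qed.

Lemma event_prob_ge0 A a : borel_event A -> 0 <= event_prob A a.
Proof.
move=> bA; rewrite -(Ex_cst P 0); apply: le_Ex => //; first exact: bmeas_cst.
exact: bmeas_event.
Qed.

Variables (I1 I2 : {set 'I_n}) (A1 A2 : set 'rV[R]_n).
Hypotheses (bA1 : borel_event A1) (iA1 : increasing_event A1) (sA1 : supported_on I1 A1).
Hypotheses (bA2 : borel_event A2) (iA2 : increasing_event A2) (sA2 : supported_on I2 A2).

Section Nontrivial.
Hypotheses (A1_neq0 : A1 !=set0) (A1_neqT : (~` A1) !=set0).
Hypotheses (A2_neq0 : A2 !=set0) (A2_neqT : (~` A2) !=set0).

Let h1 w := height A1 (Y w).
Let h2 w := height A2 (Y w).

Let shift1 w s : height A1 (Y w + const_mx s) = h1 w + s.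
Proof. exact: height_shift. Qed.

Let shift2 w s : height A2 (Y w + const_mx s) = h2 w + s.
Proof. exact: height_shift. Qed.

Section General.
Variables (delta c : R).
Hypothesis delta0 : 0 < delta.

Let f b t := ramp delta b t.
Let q := \int[N]_z excess delta (c * z).

Let qE : q <= c ^+ 2 / delta ^+ 2. Proof. exact: Ex_excess. Qed.

Let lip1 b : bounded_lipschitz (f b \o height A1).
Proof. by case: (ramp_regular iA1 sA1 A1_neq0 A1_neqT delta0 b). Qed.

Let lip2 b : bounded_lipschitz (f b \o height A2).
Proof. by case: (ramp_regular iA2 sA2 A2_neq0 A2_neqT delta0 b). Qed.

Let bf1 b : bmeas (fun w => f b (h1 w)). Proof. exact: (lipschitz_bmeas P mY (lip1 b)). Qed.
Let bf2 b : bmeas (fun w => f b (h2 w)). Proof. exact: (lipschitz_bmeas P mY (lip2 b)). Qed.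

Let bf1s b d' (T' : measurableType d') (Q : probability T' R) (u : T' -> T) (s : T' -> R) :
  measurable_fun setT u -> measurable_fun setT s ->
  bmeas (fun z => f b (h1 (u z) + s z)).
Proof.
move=> mu ms; under eq_fun do rewrite -shift1.
by apply: (lipschitz_bmeas Q _ (lip1 b)) => i; exact: mYs.
Qed.

Let bf2s b d' (T' : measurableType d') (Q : probability T' R) (u : T' -> T) (s : T' -> R) :
  measurable_fun setT u -> measurable_fun setT s ->
  bmeas (fun z => f b (h2 (u z) + s z)).
Proof.
move=> mu ms; under eq_fun do rewrite -shift2.
by apply: (lipschitz_bmeas Q _ (lip2 b)) => i; exact: mYs.
Qed.

Let Qi := prodP P (prodP N N).
Let Qs := prodP (prodP P P) N.

(* [same] is the expectation for [X] in both events, [apart] the one for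
   independent copies; the noisy versions are the two sides of
   [decorrelate_above] and [decorrelate_below]. *)
Let same b := \int[P]_w (f b (h1 w) * f b (h2 w)).
Let apart b := (\int[P]_w f b (h1 w)) * (\int[P]_w f b (h2 w)).
Let noisy_same b := \int[Qi]_z (f b (h1 z.1 + c * z.2.1) * f b (h2 z.1 + c * z.2.2)).
Let noisy_apart b e := \int[Qs]_z (f b (h1 z.1.1 + c * z.2) * f b (h2 z.1.2 + e * c * z.2)).

Let bex : bmeas (fun z : measurableTypeR R => excess delta (c * z)).
Proof. exact: bmeas_excess. Qed.

Let mc1 : measurable_fun setT (fun z : T * (measurableTypeR R * measurableTypeR R) => c * z.2.1 : R).
Proof.
by apply: measurable_funM => //; exact: (measurableT_comp measurable_fst measurable_snd).
Qed.

Let mc2 : measurable_fun setT (fun z : T * (measurableTypeR R * measurableTypeR R) => c * z.2.2 : R).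
Proof.
by apply: measurable_funM => //; exact: (measurableT_comp measurable_snd measurable_snd).
Qed.

Let mcs e : measurable_fun setT (fun z : (T * T) * measurableTypeR R => e * c * z.2 : R).
Proof. by apply: measurable_funM => //; exact: measurable_snd. Qed.

Let Ex_error d' (T' : measurableType d') (Q : probability T' R) (u v e1 e2 : T' -> R) :
  bmeas u -> bmeas v -> bmeas e1 -> bmeas e2 -> (forall z, u z <= v z + e1 z + e2 z) ->
  \int[Q]_z u z <= \int[Q]_z v z + \int[Q]_z e1 z + \int[Q]_z e2 z.
Proof.
move=> bu bv be1 be2 le; have be := bmeasD (bmeasD bv be1) be2.
by apply: (le_trans (le_Ex Q bu be le)); rewrite (ExD Q (bmeasD bv be1) be2) (ExD Q bv be1).
Qed.

Let bexi1 : bmeas (fun z : T * (measurableTypeR R * measurableTypeR R) => excess delta (c * z.2.1)).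
Proof. exact: (bmeas_comp (measurableT_comp measurable_fst measurable_snd) bex). Qed.

Let bexi2 : bmeas (fun z : T * (measurableTypeR R * measurableTypeR R) => excess delta (c * z.2.2)).
Proof. exact: (bmeas_comp (measurableT_comp measurable_snd measurable_snd) bex). Qed.

Let bexs : bmeas (fun z : (T * T) * measurableTypeR R => excess delta (c * z.2)).
Proof. exact: (bmeas_comp measurable_snd bex). Qed.

Let q_i1 : \int[Qi]_z excess delta (c * z.2.1) = q.
Proof.
have b : bmeas (fun z : measurableTypeR R * measurableTypeR R => excess delta (c * z.1)).
  exact: (bmeas_comp measurable_fst bex).
by rewrite /Qi (Ex_prod_snd P (prodP N N) b) (Ex_prod_fst N N bex).
Qed.

Let q_i2 : \int[Qi]_z excess delta (c * z.2.2) = q.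
Proof.
have b : bmeas (fun z : measurableTypeR R * measurableTypeR R => excess delta (c * z.2)).
  exact: (bmeas_comp measurable_snd bex).
by rewrite /Qi (Ex_prod_snd P (prodP N N) b) (Ex_prod_snd N N bex).
Qed.

Let q_s : \int[Qs]_z excess delta (c * z.2) = q.
Proof. by rewrite /Qs (Ex_prod_snd (prodP P P) N bex). Qed.

Let bsame b : bmeas (fun w => f b (h1 w) * f b (h2 w)). Proof. exact: bmeasM. Qed.

Let bnoisy_same b : bmeas (fun z : T * (measurableTypeR R * measurableTypeR R) => f b (h1 z.1 + c * z.2.1) * f b (h2 z.1 + c * z.2.2)).
Proof.
apply: bmeasM; [apply: (bf1s b Qi) => //|apply: (bf2s b Qi) => //]; exact: measurable_fst.
Qed.

Let bnoisy_apart b e : bmeas (fun z : (T * T) * measurableTypeR R => f b (h1 z.1.1 + c * z.2) * f b (h2 z.1.2 + e * c * z.2)).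
Proof.
apply: bmeasM; [apply: (bf1s b Qs)|apply: (bf2s b Qs) => //].
- exact: (measurableT_comp measurable_fst measurable_fst).
- by have := mcs 1; under eq_fun do rewrite mul1r.
- exact: (measurableT_comp measurable_snd measurable_fst).
Qed.

Let same_lift b : same b = \int[Qi]_z (f b (h1 z.1) * f b (h2 z.1)).
Proof. by rewrite /Qi (Ex_prod_fst P (prodP N N) (bsame b)). Qed.

Let bapart b : bmeas (fun z : T * T => f b (h1 z.1) * f b (h2 z.2)).
Proof.
by apply: bmeasM; [exact: (bmeas_comp measurable_fst (bf1 b))|exact: (bmeas_comp measurable_snd (bf2 b))].
Qed.

Let apart_lift b : apart b = \int[Qs]_z (f b (h1 z.1.1) * f b (h2 z.1.2)).
Proof.
by rewrite /Qs (Ex_prod_fst (prodP P P) N (bapart b)) (Ex_prodM P P (bf1 b) (bf2 b)).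
Qed.

Let bsame_lift b : bmeas (fun z : T * (measurableTypeR R * measurableTypeR R) =>
  f b (h1 z.1) * f b (h2 z.1)).
Proof. exact: (bmeas_comp measurable_fst (bsame b)). Qed.

Let bapart_lift b : bmeas (fun z : (T * T) * measurableTypeR R =>
  f b (h1 z.1.1) * f b (h2 z.1.2)).
Proof. exact: (bmeas_comp measurable_fst (bapart b)). Qed.

Let same_le_noisy b : same b <= noisy_same (b + 1) + q + q.
Proof.
rewrite same_lift -{1}q_i1 -q_i2.
apply: (Ex_error Qi (bsame_lift b) (bnoisy_same (b + 1)) bexi1 bexi2) => z.
exact: ramp_excessM.
Qed.

Let noisy_le_same b : noisy_same b <= same (b + 1) + q + q.
Proof.
rewrite same_lift -{1}q_i1 -q_i2.
apply: (Ex_error Qi (bnoisy_same b) (bsame_lift (b + 1)) bexi1 bexi2) => z.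
rewrite -[excess _ (c * z.2.1)]excessN -[excess _ (c * z.2.2)]excessN.
rewrite -{2}[h1 z.1](addrK (c * z.2.1)) -{2}[h2 z.1](addrK (c * z.2.2)).
exact: ramp_excessM.
Qed.

Section Sign.
Variable e : R.
Hypothesis e1 : e ^+ 2 = 1.

Let excess_sign (y : R) : excess delta (e * c * y) = excess delta (c * y).
Proof. by rewrite /excess -mulrA exprMn e1 mul1r. Qed.

Let apart_le_noisy b : apart b <= noisy_apart (b + 1) e + q + q.
Proof.
rewrite apart_lift -q_s.
apply: (Ex_error Qs (bapart_lift b) (bnoisy_apart (b + 1) e) bexs bexs) => z.
rewrite -{2}excess_sign; exact: ramp_excessM.
Qed.

Let noisy_le_apart b : noisy_apart b e <= apart (b + 1) + q + q.
Proof.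
rewrite apart_lift -q_s.
apply: (Ex_error Qs (bnoisy_apart b e) (bapart_lift (b + 1)) bexs bexs) => z.
rewrite -{2}excess_sign -[excess _ (c * z.2)]excessN -[excess _ (e * c * z.2)]excessN.
rewrite -{2}[h1 z.1.1](addrK (c * z.2)) -{2}[h2 z.1.2](addrK (e * c * z.2)).
exact: ramp_excessM.
Qed.

Lemma apart_noise b : apart b <= noisy_apart (b + 1) e + q + q /\
  noisy_apart b e <= apart (b + 1) + q + q.
Proof. by split; [exact: apart_le_noisy|exact: noisy_le_apart]. Qed.

End Sign.

Let regular1 b := ramp_regular iA1 sA1 A1_neq0 A1_neqT delta0 b.
Let regular2 b := ramp_regular iA2 sA2 A2_neq0 A2_neqT delta0 b.

Let noisy_above b : (forall i j, i \in I1 -> j \in I2 -> K i j <= c ^+ 2) ->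
  noisy_same b <= noisy_apart b 1.
Proof.
move=> Kc; have [l1 i1 s1] := regular1 b; have [l2 i2 s2] := regular2 b.
rewrite /noisy_same /noisy_apart; under [leRHS]eq_Rintegral do rewrite mul1r.
have := decorrelate_above (mean_vector X) gW symK l1 i1 s1 l2 i2 s2 Kc.
under eq_Rintegral do rewrite /= shift1 shift2.
by under [X in _ <= X -> _]eq_Rintegral do rewrite /= shift1 shift2.
Qed.

Let noisy_below b : (forall i j, i \in I1 -> j \in I2 -> - c ^+ 2 <= K i j) ->
  noisy_apart b (-1) <= noisy_same b.
Proof.
move=> Kc; have [l1 i1 s1] := regular1 b; have [l2 i2 s2] := regular2 b.
rewrite /noisy_same /noisy_apart; under [leLHS]eq_Rintegral do rewrite mulN1r.
have := decorrelate_below (mean_vector X) gW symK l1 i1 s1 l2 i2 s2 Kc.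
under eq_Rintegral do rewrite /= shift1 shift2.
by under [X in _ <= X -> _]eq_Rintegral do rewrite /= shift1 shift2.
Qed.

Let event1 s b : b = 1 + s / delta -> event_prob A1 s <= \int[P]_w f b (h1 w).
Proof.
move=> ->; apply: le_Ex; [exact: bmeas_event|exact: bf1|].
by move=> w; exact: indic_le_ramp.
Qed.

Let event2 s b : b = 1 + s / delta -> event_prob A2 s <= \int[P]_w f b (h2 w).
Proof.
move=> ->; apply: le_Ex; [exact: bmeas_event|exact: bf2|].
by move=> w; exact: indic_le_ramp.
Qed.

Lemma ramp1_event s b : b = s / delta -> \int[P]_w ramp delta b (h1 w) <= event_prob A1 s.
Proof.
move=> ->; apply: le_Ex; [exact: bf1|exact: bmeas_event|].
by move=> w; exact: ramp_le_indic.
Qed.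

Lemma ramp2_event s b : b = s / delta -> \int[P]_w ramp delta b (h2 w) <= event_prob A2 s.
Proof.
move=> ->; apply: le_Ex; [exact: bf2|exact: bmeas_event|].
by move=> w; exact: ramp_le_indic.
Qed.

Let f01 b t : 0 <= f b t <= 1. Proof. exact: ramp01. Qed.

Lemma joint_le_ramps : joint_prob A1 A2 <= \int[P]_w (ramp delta 1 (h1 w) * ramp delta 1 (h2 w)).
Proof.
apply: le_Ex; [apply: bmeasM; exact: bmeas_event0|exact: bsame|].
move=> w; apply: ler_pM; rewrite ?indicE//.
  by rewrite -indicE -[Y w]const0 (le_trans (indic_le_ramp iA1 A1_neq0 A1_neqT delta0 _ _))// mul0r addr0.
by rewrite -indicE -[Y w]const0 (le_trans (indic_le_ramp iA2 A2_neq0 A2_neqT delta0 _ _))// mul0r addr0.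
Qed.

Let same_le_joint : same 0 <= joint_prob A1 A2.
Proof.
apply: le_Ex; [exact: bsame|apply: bmeasM; exact: bmeas_event0|].
move=> w; apply: ler_pM.
- by have /andP[] := f01 0 (h1 w).
- by have /andP[] := f01 0 (h2 w).
- by rewrite -[Y w]const0 (le_trans _ (ramp_le_indic iA1 A1_neq0 A1_neqT delta0 _ _))// mul0r.
- by rewrite -[Y w]const0 (le_trans _ (ramp_le_indic iA2 A2_neq0 A2_neqT delta0 _ _))// mul0r.
Qed.

Let ramp_Ex_ge0 b h : bmeas (fun w : T => f b (h w)) -> 0 <= \int[P]_w f b (h w).
Proof.
move=> bf; rewrite -(Ex_cst P 0); apply: le_Ex => //; first exact: bmeas_cst.
by move=> w; have /andP[] := f01 b (h w).
Qed.

(** Offsets grow by one at each of three steps: from events to ramps, when the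
    noises are added, and when they are removed after the comparison.  A ramp of
    offset 3 is below the event shifted by [3 * delta].  Each of the last two
    steps costs two excesses. *)
Lemma joint_prob_le : (forall i j, i \in I1 -> j \in I2 -> K i j <= c ^+ 2) ->
  joint_prob A1 A2 <= event_prob A1 (3 * delta) * event_prob A2 (3 * delta) +
    4 * (c ^+ 2 / delta ^+ 2).
Proof.
move=> Kc.
have e3 : 1 + 1 + 1 = 3 * delta / delta by rewrite mulfK ?gt_eqF//; ring.
have [_ s3] := apart_noise (expr1n R 2) (1 + 1).
have a3 : apart (1 + 1 + 1) <= event_prob A1 (3 * delta) * event_prob A2 (3 * delta).
  by apply: ler_pM; [exact: ramp_Ex_ge0|exact: ramp_Ex_ge0|exact: ramp1_event|exact: ramp2_event].
have s1 : joint_prob A1 A2 <= same 1 := joint_le_ramps; have s2 := same_le_noisy 1; have s4 := noisy_above (1 + 1) Kc.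
have := qE; lra.
Qed.

(** The same three steps from the product towards the joint probability, with
    offsets growing from - 2 to 0. *)
Lemma joint_prob_ge : (forall i j, i \in I1 -> j \in I2 -> - c ^+ 2 <= K i j) ->
  event_prob A1 (- (3 * delta)) * event_prob A2 (- (3 * delta)) <= joint_prob A1 A2 +
    4 * (c ^+ 2 / delta ^+ 2).
Proof.
move=> Kc.
have e3 : -2 = 1 + - (3 * delta) / delta by rewrite mulNr mulfK ?gt_eqF//; ring.
have em : (-1) ^+ 2 = 1 :> R by rewrite sqrrN expr1n.
have [s1 _] := apart_noise em (-2).
have a3 : event_prob A1 (- (3 * delta)) * event_prob A2 (- (3 * delta)) <= apart (-2).
  by apply: ler_pM; [exact: event_prob_ge0|exact: event_prob_ge0|exact: event1|exact: event2].
have e21 : -2 + 1 = -1 :> R by ring.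
rewrite e21 in s1.
have s2 := noisy_below (-1) Kc; have s3 := noisy_le_same (-1); have s4 := same_le_joint.
rewrite addNr in s3.
have := qE; lra.
Qed.

Lemma joint_prob_ge_positive : (forall i j, i \in I1 -> j \in I2 -> 0 <= K i j) ->
  event_prob A1 (- delta) * event_prob A2 (- delta) <= joint_prob A1 A2.
Proof.
move=> K0; have e0 : 0 = 1 + - delta / delta by rewrite mulNr mulfV ?gt_eqF// subrr.
have [l1 i1 s1] := regular1 0; have [l2 i2 s2] := regular2 0.
have h := association_positive (mean_vector X) gW symK l1 i1 s1 l2 i2 s2 K0.
apply: (le_trans _ (le_trans h same_le_joint)).
by apply: ler_pM; [exact: event_prob_ge0|exact: event_prob_ge0|exact: event1|exact: event2].
Qed.

End General.
Section Positive.
Variables (eps delta c : R).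
Hypotheses (eps0 : 0 < eps) (delta0 : 0 < delta).
Hypothesis K0 : forall i j, i \in I1 -> j \in I2 -> 0 <= K i j.
Hypothesis Kc : forall i j, i \in I1 -> j \in I2 -> K i j <= c ^+ 2.

(* [phi] is a multiple of the ramp that dominates the event, [Psi] a smoothing
   of the truncated identity by the scalar noise.  Wherever [phi] increases, with
   slope 1, [Psi] increases with slope at least [theta], a lower bound for the
   probability that the noise keeps the argument within the truncation level
   [M]. *)
Let M := eps + delta.
Let cut t := clamp (- M) M t.
Let Psi t := \int[N]_z cut (t + c * z).
Let q := \int[N]_z excess delta (c * z).
Let theta := 1 - q.
Let phi t := eps * ramp eps 1 t.

Let M0 : 0 < M. Proof. exact: addr_gt0. Qed.

Let NM : - M <= M. Proof. by rewrite ge0_cp ?ltW. Qed.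

Let cut_bound t : `|cut t| <= M.
Proof. by rewrite ler_norml; exact: clamp_bounds. Qed.

Let mcut : measurable_fun setT cut.
Proof.
by apply: measurable_maxr => //; exact: measurable_minr.
Qed.

Let bcut t : bmeas (fun z : measurableTypeR R => cut (t + c * z)).
Proof.
split; last by exists M => z; exact: cut_bound.
apply: (measurableT_comp mcut); apply: measurable_funD; first exact: measurable_cst.
by apply: measurable_funM; [exact: measurable_cst|exact: measurable_id].
Qed.

Let bexc : bmeas (fun z : measurableTypeR R => excess delta (c * z)).
Proof. exact: bmeas_excess. Qed.

Let phiE t : phi t = clamp 0 eps (t + eps).
Proof.
rewrite /phi /ramp /clamp maxr_pMr ?ltW// mulr0 minr_pMr ?ltW// mulr1; congr Num.max.
by congr Num.min; field; rewrite gt_eqF.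
Qed.

Let phi_incr s t : s <= t -> phi s <= phi t.
Proof. by move=> st; rewrite !phiE; apply: clamp_incr; rewrite lerD2r. Qed.

Let phi_gap s t : s <= t -> phi t - phi s <= t - s.
Proof.
move=> st; rewrite !phiE; have := @clamp_gap R 0 eps (s + eps) (t + eps) (ltW eps0).
by rewrite lerD2r => /(_ st); lra.
Qed.

Let phi_bound t : `|phi t| <= eps.
Proof. by rewrite phiE; have /andP[p0 p1] := clamp_bounds (t + eps) (ltW eps0); rewrite ger0_norm. Qed.

Let cut_slope s t y : s <= t -> `|y| <= delta -> phi t - phi s <= cut (t + y) - cut (s + y).
Proof. by move=> st yd; rewrite !phiE; apply: clamp_slope => //; exact: ltW. Qed.

Let q_ge0 : 0 <= q.
Proof.
rewrite -(Ex_cst N 0); apply: le_Ex; [exact: bmeas_cst|exact: bexc|].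
by move=> z; exact: excess_ge0.
Qed.

Let q_le1 : q <= 1.
Proof.
rewrite -(Ex_cst N 1); apply: le_Ex; [exact: bexc|exact: bmeas_cst|].
by move=> z; exact: excess_le1.
Qed.

Let Psi_bound t : `|Psi t| <= M.
Proof. by apply: Ex_norm_le; [exact: bcut|move=> z; exact: cut_bound]. Qed.

Let Psi_gap s t : s <= t -> Psi t - Psi s <= t - s.
Proof.
move=> st; rewrite -(ExB N (bcut t) (bcut s)) -[leRHS](Ex_cst N).
apply: le_Ex; [by apply: bmeasB; exact: bcut|exact: bmeas_cst|move=> z].
have := @clamp_gap R (- M) M (s + c * z) (t + c * z) NM.
by rewrite lerD2r => /(_ st); rewrite /cut; lra.
Qed.

Let Psi_slope s t : s <= t -> theta * (phi t - phi s) <= Psi t - Psi s.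
Proof.
move=> st; rewrite -(ExB N (bcut t) (bcut s)).
have b1 := bmeas_cst (measurableTypeR R) (1 : R).
have -> : theta * (phi t - phi s) =
    \int[N]_z ((1 - excess delta (c * z)) * (phi t - phi s)).
  by rewrite (ExZr N _ (bmeasB b1 bexc)) (ExB N b1 bexc) Ex_cst.
apply: le_Ex.
- by apply: bmeasM; [exact: bmeasB|exact: bmeas_cst].
- by apply: bmeasB; exact: bcut.
move=> z; have phi0 : 0 <= phi t - phi s by rewrite subr_ge0 phi_incr.
have [h|h] := leP `|c * z| delta.
  apply: (le_trans _ (cut_slope st h)).
  by rewrite ler_piMl// gerBl excess_ge0.
rewrite (excess_far delta0 h) subrr mul0r subr_ge0.
by apply: clamp_incr; rewrite lerD2r.
Qed.

Let Psi_incr s t : s <= t -> Psi s <= Psi t.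
Proof.
move=> st; rewrite -subr_ge0; apply: (le_trans _ (Psi_slope st)).
by rewrite mulr_ge0 ?subr_ge0 ?q_le1 ?phi_incr.
Qed.

(* Both [phi] and [rem] are increasing, so they are positively correlated with
   increasing functions of the other height. *)
Let rem t := Psi t - theta * phi t.

Let rem_incr s t : s <= t -> rem s <= rem t.
Proof. by move=> st; have := Psi_slope st; rewrite /rem; lra. Qed.

Let rem_gap s t : s <= t -> rem t - rem s <= 1 * (t - s).
Proof.
move=> st; have := Psi_gap st; have : 0 <= theta * (phi t - phi s).
  by rewrite mulr_ge0 ?subr_ge0 ?q_le1 ?phi_incr.
by rewrite /rem; lra.
Qed.

Let rem_bound t : `|rem t| <= M + eps.
Proof.
rewrite (le_trans (ler_normB _ _))// lerD//.
rewrite normrM -[leRHS]mul1r ler_pM// ger0_norm; first by rewrite gerBl.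
by rewrite subr_ge0 q_le1.
Qed.

Let gap1 (g : R -> R) : (forall s t, s <= t -> g t - g s <= t - s) ->
  forall s t, s <= t -> g t - g s <= 1 * (t - s).
Proof. by move=> h s t st; rewrite mul1r h. Qed.

Let cut_incr s t : s <= t -> cut s <= cut t. Proof. exact: clamp_incr. Qed.
Let cut_gap s t : s <= t -> cut t - cut s <= t - s. Proof. exact: clamp_gap. Qed.

Let reg1 := profile_regular iA1 sA1 A1_neq0 A1_neqT.
Let reg2 := profile_regular iA2 sA2 A2_neq0 A2_neqT.

Let bm1 g : bounded_lipschitz (g \o height A1) -> bmeas (fun w => g (h1 w)).
Proof. by move=> lg; exact: (lipschitz_bmeas P mY lg). Qed.

Let bm2 g : bounded_lipschitz (g \o height A2) -> bmeas (fun w => g (h2 w)).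
Proof. by move=> lg; exact: (lipschitz_bmeas P mY lg). Qed.

Let associate g k :
  bounded_lipschitz (g \o height A1) -> increasing_rV (g \o height A1) ->
  supported_fun I1 (g \o height A1) ->
  bounded_lipschitz (k \o height A2) -> increasing_rV (k \o height A2) ->
  supported_fun I2 (k \o height A2) ->
  (\int[P]_w g (h1 w)) * (\int[P]_w k (h2 w)) <= \int[P]_w (g (h1 w) * k (h2 w)).
Proof.
by move=> l1 i1 s1 l2 i2 s2;
  exact: (association_positive (mean_vector X) gW symK l1 i1 s1 l2 i2 s2 K0).
Qed.

(* Replace [theta * phi] by [Psi] in one factor, then in the other; each time the
   difference is [rem], whose covariance with the other factor is
   nonnegative. *)
Let cov_phi_le : theta ^+ 2 *
    (\int[P]_w (phi (h1 w) * phi (h2 w)) - (\int[P]_w phi (h1 w)) * (\int[P]_w phi (h2 w))) <=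
  \int[P]_w (Psi (h1 w) * Psi (h2 w)) - (\int[P]_w Psi (h1 w)) * (\int[P]_w Psi (h2 w)).
Proof.
have [lr1 ir1 sr1] := reg1 rem_bound rem_incr rem_gap.
have [lr2 ir2 sr2] := reg2 rem_bound rem_incr rem_gap.
have [lp1 ip1 sp1] := reg1 phi_bound phi_incr (gap1 phi_gap).
have [lp2 ip2 sp2] := reg2 phi_bound phi_incr (gap1 phi_gap).
have [lP1 iP1 sP1] := reg1 Psi_bound Psi_incr (gap1 Psi_gap).
have [lP2 iP2 sP2] := reg2 Psi_bound Psi_incr (gap1 Psi_gap).
have a1 := associate lr1 ir1 sr1 lP2 iP2 sP2.
have a2 := associate lp1 ip1 sp1 lr2 ir2 sr2.
have bp1 := bm1 lp1; have bp2 := bm2 lp2; have bP1 := bm1 lP1; have bP2 := bm2 lP2.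
have bt1 := bmeasZ theta bp1; have bt2 := bmeasZ theta bp2.
have bpP := bmeasM bp1 bP2; have bPP := bmeasM bP1 bP2; have bpp := bmeasM bp1 bp2.
move: a1; rewrite /rem (ExB P bP1 bt1) (ExZ P theta bp1).
have -> : \int[P]_w ((Psi (h1 w) - theta * phi (h1 w)) * Psi (h2 w)) =
    \int[P]_w (Psi (h1 w) * Psi (h2 w)) - theta * \int[P]_w (phi (h1 w) * Psi (h2 w)).
  rewrite -(ExZ P theta bpP) -(ExB P bPP (bmeasZ theta bpP)).
  by apply: eq_Ex => w; ring.
move: a2; rewrite /rem (ExB P bP2 bt2) (ExZ P theta bp2).
have -> : \int[P]_w (phi (h1 w) * (Psi (h2 w) - theta * phi (h2 w))) =
    \int[P]_w (phi (h1 w) * Psi (h2 w)) - theta * \int[P]_w (phi (h1 w) * phi (h2 w)).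
  rewrite -(ExZ P theta bpp) -(ExB P bpP (bmeasZ theta bpp)).
  by apply: eq_Ex => w; ring.
have th0 : 0 <= theta by rewrite subr_ge0 q_le1.
move=> /(ler_wpM2l th0).
set x := \int[P]_w (phi _ * phi _); set y := \int[P]_w (phi _ * Psi _).
set z := \int[P]_w (Psi _ * Psi _).
set a := \int[P]_w (phi (h1 _)); set b := \int[P]_w (phi (h2 _)).
set a' := \int[P]_w (Psi (h1 _)); set b' := \int[P]_w (Psi (h2 _)).
by move=> e1 e2; rewrite expr2; lra.
Qed.

(* Conditional expectations given the scalar noise [z]. *)
Let p z := \int[P]_w cut (h1 w + c * z).
Let p' z := \int[P]_w cut (h2 w + c * z).

Let cut_regular1 := reg1 cut_bound cut_incr (gap1 cut_gap).
Let cut_regular2 := reg2 cut_bound cut_incr (gap1 cut_gap).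

Let bc1 d' (T' : measurableType d') (Q : probability T' R) (u : T' -> T) (s : T' -> R) :
  measurable_fun setT u -> measurable_fun setT s ->
  bmeas (fun z => cut (h1 (u z) + s z)).
Proof.
move=> mu ms; under eq_fun do rewrite -shift1.
have [l1 _ _] := cut_regular1.
by apply: (lipschitz_bmeas Q _ l1) => i; exact: mYs.
Qed.

Let bc2 d' (T' : measurableType d') (Q : probability T' R) (u : T' -> T) (s : T' -> R) :
  measurable_fun setT u -> measurable_fun setT s ->
  bmeas (fun z => cut (h2 (u z) + s z)).
Proof.
move=> mu ms; under eq_fun do rewrite -shift2.
have [l2 _ _] := cut_regular2.
by apply: (lipschitz_bmeas Q _ l2) => i; exact: mYs.
Qed.

Let mcz : measurable_fun setT (fun z : T * measurableTypeR R => c * z.2 : R).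
Proof. by apply: measurable_funM => //; exact: measurable_snd. Qed.

Let bpair1 : bmeas (fun z : T * measurableTypeR R => cut (h1 z.1 + c * z.2)).
Proof. by apply: (bc1 (prodP P N)) => //; exact: measurable_fst. Qed.

Let bpair2 : bmeas (fun z : T * measurableTypeR R => cut (h2 z.1 + c * z.2)).
Proof. by apply: (bc2 (prodP P N)) => //; exact: measurable_fst. Qed.

Let Psi_p : \int[P]_w Psi (h1 w) = \int[N]_z p z.
Proof. by rewrite -(Ex_prod2 P N bpair1) (Ex_prod1 P N bpair1). Qed.

Let Psi_p' : \int[P]_w Psi (h2 w) = \int[N]_z p' z.
Proof. by rewrite -(Ex_prod2 P N bpair2) (Ex_prod1 P N bpair2). Qed.

Let Qi := prodP P (prodP N N).
Let Qs := prodP (prodP P P) N.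

Let PsiPsi_le : \int[P]_w (Psi (h1 w) * Psi (h2 w)) <= \int[N]_z (p z * p' z).
Proof.
have [l1 i1 s1] := cut_regular1; have [l2 i2 s2] := cut_regular2.
have bi : bmeas (fun z : T * (measurableTypeR R * measurableTypeR R) =>
    cut (h1 z.1 + c * z.2.1) * cut (h2 z.1 + c * z.2.2)).
  apply: bmeasM.
    apply: (bc1 Qi); first exact: measurable_fst.
    by apply: measurable_funM => //; exact: (measurableT_comp measurable_fst measurable_snd).
  apply: (bc2 Qi); first exact: measurable_fst.
  by apply: measurable_funM => //; exact: (measurableT_comp measurable_snd measurable_snd).
have bs : bmeas (fun z : (T * T) * measurableTypeR R =>
    cut (h1 z.1.1 + c * z.2) * cut (h2 z.1.2 + c * z.2)).
  have ms : measurable_fun setT (fun z : (T * T) * measurableTypeR R => c * z.2 : R).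
    by apply: measurable_funM => //; exact: measurable_snd.
  apply: bmeasM; [apply: (bc1 Qs) => //|apply: (bc2 Qs) => //].
    exact: (measurableT_comp measurable_fst measurable_fst).
  exact: (measurableT_comp measurable_snd measurable_fst).
have -> : \int[P]_w (Psi (h1 w) * Psi (h2 w)) =
    \int[Qi]_z (cut (h1 z.1 + c * z.2.1) * cut (h2 z.1 + c * z.2.2)).
  rewrite (Ex_prod1 P (prodP N N) bi); apply: eq_Ex => w.
  by rewrite -(Ex_prodM N N (bcut (h1 w)) (bcut (h2 w))).
have -> : \int[N]_z (p z * p' z) =
    \int[Qs]_z (cut (h1 z.1.1 + c * z.2) * cut (h2 z.1.2 + c * z.2)).
  rewrite (Ex_prod2 (prodP P P) N bs); apply: eq_Ex => z.
  have bz1 := bmeas_pair2 z bpair1; have bz2 := bmeas_pair2 z bpair2.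
  by rewrite -(Ex_prodM P P bz1 bz2).
have := decorrelate_above (mean_vector X) gW symK l1 i1 s1 l2 i2 s2 Kc.
under eq_Rintegral do rewrite /= shift1 shift2.
by under [X in _ <= X -> _]eq_Rintegral do rewrite /= shift1 shift2.
Qed.

Let cut_lip s t : `|cut s - cut t| <= 1 * `|s - t|.
Proof. exact: (incr_lipschitz cut_incr (gap1 cut_gap)). Qed.

Let bp_ : bmeas p.
Proof. exact: (bmeas_Ex2 P N bpair1). Qed.

Let bp'_ : bmeas p'.
Proof. exact: (bmeas_Ex2 P N bpair2). Qed.

Let p_lip z : `|p z - p 0| <= `|c * z|.
Proof.
have b1 := bmeas_pair2 z bpair1; have b0 := bmeas_pair2 (0 : R) bpair1.
rewrite /p -(ExB P b1 b0); apply: Ex_norm_le; first exact: bmeasB.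
move=> w; rewrite (le_trans (cut_lip _ _))// mul1r mulr0 addr0.
by rewrite [X in X - _]addrC addrK.
Qed.

Let p'_lip z : `|p' z - p' 0| <= `|c * z|.
Proof.
have b1 := bmeas_pair2 z bpair2; have b0 := bmeas_pair2 (0 : R) bpair2.
rewrite /p' -(ExB P b1 b0); apply: Ex_norm_le; first exact: bmeasB.
move=> w; rewrite (le_trans (cut_lip _ _))// mul1r mulr0 addr0.
by rewrite [X in X - _]addrC addrK.
Qed.

Lemma joint_prob_le_positive_approx :
  (1 - q) ^+ 2 * (eps ^+ 2 *
    (joint_prob A1 A2 - event_prob A1 eps * event_prob A2 eps)) <= c ^+ 2.
Proof.
have cv := covariance_lipschitz_normal bp_ bp'_ p_lip p'_lip.
have pp := PsiPsi_le; have cphi := cov_phi_le.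
rewrite Psi_p Psi_p' in cphi.
have {cphi cv pp}key : theta ^+ 2 *
    (\int[P]_w (phi (h1 w) * phi (h2 w)) - (\int[P]_w phi (h1 w)) * (\int[P]_w phi (h2 w))) <= c ^+ 2.
  by apply: (le_trans cphi); apply: (le_trans _ cv); rewrite lerD2r.
apply: (le_trans _ key); apply: ler_wpM2l; first exact: sqr_ge0.
have [lr1 _ _] := ramp_regular iA1 sA1 A1_neq0 A1_neqT eps0 1.
have [lr2 _ _] := ramp_regular iA2 sA2 A2_neq0 A2_neqT eps0 1.
have br1 := bm1 lr1; have br2 := bm2 lr2.
have -> : \int[P]_w (phi (h1 w) * phi (h2 w)) =
    eps ^+ 2 * \int[P]_w (ramp eps 1 (h1 w) * ramp eps 1 (h2 w)).
  by rewrite -(ExZ P _ (bmeasM br1 br2)); apply: eq_Ex => w; rewrite /phi; ring.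
rewrite /phi (ExZ P eps br1) (ExZ P eps br2) mulrACA -expr2 -mulrBr.
apply: ler_wpM2l; first exact: sqr_ge0.
have e1 : 1 = eps / eps by rewrite divff ?gt_eqF.
have j := joint_le_ramps eps0.
have r1 := ramp1_event eps0 e1; have r2 := ramp2_event eps0 e1.
apply: lerB => //; apply: ler_pM => //.
  rewrite -(Ex_cst P 0); apply: le_Ex; [exact: bmeas_cst|exact: br1|move=> w].
  by have /andP[] := ramp01 eps 1 (h1 w).
rewrite -(Ex_cst P 0); apply: le_Ex; [exact: bmeas_cst|exact: br2|move=> w].
by have /andP[] := ramp01 eps 1 (h2 w).
Qed.

End Positive.

(** Letting [delta] tend to infinity removes the factor: its defect 2 q is at
    most 2 c^2 / delta^2.  The choice of [delta] in the proof makes the loss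
    2 q a at most [e]. *)
Lemma joint_prob_le_positive eps c : 0 < eps ->
  (forall i j, i \in I1 -> j \in I2 -> 0 <= K i j) ->
  (forall i j, i \in I1 -> j \in I2 -> K i j <= c ^+ 2) ->
  eps ^+ 2 * (joint_prob A1 A2 - event_prob A1 eps * event_prob A2 eps) <= c ^+ 2.
Proof.
move=> eps0 K0 Kc; set a := eps ^+ 2 * _.
have [a0|a0] := leP a 0; first by rewrite (le_trans a0)// sqr_ge0.
apply/ler_addgt0Pr => e e0.
pose delta := 1 + 2 * c ^+ 2 * a / e.
have c0 := sqr_ge0 c.
have d1 : 1 <= delta by rewrite lerDl divr_ge0 ?(ltW e0)// mulr_ge0 ?(ltW a0)// mulr_ge0.
have d0 : 0 < delta by exact: lt_le_trans d1.
have := joint_prob_le_positive_approx eps0 d0 K0 Kc; rewrite -/a.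
have := Ex_excess delta c; set q := \int[_]_z _ => qE h.
have qd : 2 * q * a <= e.
  have dd : delta <= delta ^+ 2 by rewrite expr2 ler_peMr ?(ltW d0).
  have qd2 : q * delta <= c ^+ 2.
    have : q * delta ^+ 2 <= c ^+ 2 by rewrite -ler_pdivlMr// exprn_gt0.
    apply: le_trans; apply: ler_wpM2l => //.
    rewrite -(Ex_cst N 0); apply: le_Ex; [exact: bmeas_cst|exact: bmeas_excess|].
    by move=> z; exact: excess_ge0.
  have ed : 2 * c ^+ 2 * a <= e * delta.
    by rewrite /delta mulrDr mulr1 [e * (_ / e)]mulrC divfK ?gt_eqF// lerDr ltW.
  rewrite -(ler_pM2r d0).
  have := ler_wpM2l (ltW a0) qd2; lra.
have := mulr_ge0 (sqr_ge0 q) (ltW a0); move: h; rewrite !expr2; lra.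
Qed.

End Nontrivial.
End Decoupling.

(** * Trivial events and conclusion *)

Section TrivialEvents.
Context d (T : measurableType d) (R : realType) (P : probability T R) (n : nat).
Variable X : 'I_n -> {RV P >-> R}.
Hypothesis gX : gaussian_vector X.

Lemma event_prob_incr A a b : borel_event A -> increasing_event A -> a <= b ->
  event_prob X A a <= event_prob X A b.
Proof.
move=> bA iA ab; apply: le_Ex; [exact: bmeas_event|exact: bmeas_event|move=> w].
rewrite !indicE; set x := _ + centered X w.
case: (boolP (x + const_mx a \in A)) => [/set_mem h|_]; last by case: (_ \in _).
suff -> : x + const_mx b \in A by [].
apply/mem_set; have -> : x + const_mx b = x + const_mx a + const_mx (b - a).
  by apply/rowP => i; rewrite !mxE; ring.
by apply: iA h => i; rewrite mxE subr_ge0.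
Qed.

Lemma joint_probC A B : joint_prob X A B = joint_prob X B A.
Proof. by apply: eq_Ex => w; rewrite mulrC. Qed.

(** The events without a height. *)
Lemma trivial_event A B eps : borel_event A -> borel_event B -> increasing_event B ->
  A = set0 \/ A = setT -> 0 <= eps ->
  joint_prob X A B <= event_prob X A eps * event_prob X B eps /\
  event_prob X A (- eps) * event_prob X B (- eps) <= joint_prob X A B.
Proof.
move=> bA bB iB [->|->] e0.
  have -> : joint_prob X set0 B = 0.
    by rewrite -(Ex_cst P 0); apply: eq_Ex => w; rewrite indic0 mul0r.
  have E a : event_prob X set0 a = 0.
    by rewrite -(Ex_cst P 0); apply: eq_Ex => w; rewrite indic0.
  by rewrite !E !mul0r.
have -> : joint_prob X setT B = event_prob X B 0.
  apply: eq_Ex => w; rewrite indicT mul1r; congr (\1_B _).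
  by apply/rowP => i; rewrite !mxE addr0.
have E a : event_prob X setT a = 1.
  by rewrite -[RHS](Ex_cst P 1); apply: eq_Ex => w; rewrite indicT.
rewrite !E !mul1r; split; apply: event_prob_incr => //.
by rewrite oppr_le0.
Qed.

End TrivialEvents.

Section BlockNorm.
Variables (R : realType) (n : nat) (K : 'M[R]_n) (I J : {set 'I_n}).

Lemma block_norm_ge0 : 0 <= block_norm K I J.
Proof. by rewrite /block_norm; apply: bigmax_ge_id. Qed.

Lemma le_block_norm i j : i \in I -> j \in J -> `|K i j| <= block_norm K I J.
Proof.
move=> iI jJ; apply: (le_trans (le_bigmax_cond 0 (fun j => `|K i j|) jJ)).
exact: (le_bigmax_cond 0 (fun i => \big[Num.max/0]_(j in J) `|K i j|) iI).
Qed.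

End BlockNorm.

Theorem theorem1p1 (R : realType) :
  exists c : R, 0 < c /\
    forall (n : nat) (d : measure_display) (T : measurableType d)
      (P : probability T R) (X : 'I_n -> {RV P >-> R})
      (I1 I2 : {set 'I_n}) (A1 A2 : set 'rV[R]_n) (eps : R),
      (0 < n)%N ->
      gaussian_vector X ->
      borel_event A1 -> increasing_event A1 -> supported_on I1 A1 ->
      borel_event A2 -> increasing_event A2 -> supported_on I2 A2 ->
      0 < eps ->
      upper_decoupling X I1 I2 A1 A2 eps c /\
      lower_decoupling X I1 I2 A1 A2 eps c /\
      ((forall i j, i \in I1 -> j \in I2 -> 0 <= cov_kernel X i j) ->
        upper_decoupling X I1 I2 A1 A2 eps 1 /\
        lower_decoupling X I1 I2 A1 A2 eps 0).
Proof.
(* The shift is [eps = 3 * delta], which turns 4 / delta^2 into 36 / eps^2. *)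
exists 36; split=> // n d T P X I1 I2 A1 A2 eps _ gX b1 i1 s1 b2 i2 s2 eps0.
set kappa := block_norm (cov_kernel X) I1 I2.
have k0 : 0 <= kappa by exact: block_norm_ge0.
have ee : 0 < eps ^+ 2 by rewrite exprn_gt0.
have upperP c : joint_prob X A1 A2 - event_prob X A1 eps * event_prob X A2 eps <=
    c * kappa / eps ^+ 2 -> upper_decoupling X I1 I2 A1 A2 eps c.
  by rewrite /upper_decoupling -(joint_probE gX b1 b2) -!(event_probE gX).
have lowerP c : event_prob X A1 (- eps) * event_prob X A2 (- eps) - joint_prob X A1 A2 <=
    c * kappa / eps ^+ 2 -> lower_decoupling X I1 I2 A1 A2 eps c.
  by rewrite /lower_decoupling -(joint_probE gX b1 b2) -!(event_probE gX).
have rhs0 c : 0 <= c -> 0 <= c * kappa / eps ^+ 2.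
  by move=> c0; exact: divr_ge0 (mulr_ge0 c0 k0) (ltW ee).
have trivial : joint_prob X A1 A2 <= event_prob X A1 eps * event_prob X A2 eps /\
    event_prob X A1 (- eps) * event_prob X A2 (- eps) <= joint_prob X A1 A2 ->
    upper_decoupling X I1 I2 A1 A2 eps 36 /\ lower_decoupling X I1 I2 A1 A2 eps 36 /\
    ((forall i j, i \in I1 -> j \in I2 -> 0 <= cov_kernel X i j) ->
      upper_decoupling X I1 I2 A1 A2 eps 1 /\ lower_decoupling X I1 I2 A1 A2 eps 0).
  move=> [u l]; have le c x y : 0 <= c -> x <= y -> x - y <= c * kappa / eps ^+ 2.
    by move=> c0 xy; rewrite (le_trans _ (rhs0 c c0))// subr_le0.
  by split; [exact/upperP/le|split; [exact/lowerP/le|move=> _; split; [exact/upperP/le|exact/lowerP/le]]].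
have dich (A : set 'rV[R]_n) : (A = set0 \/ A = setT) \/ (A !=set0 /\ (~` A) !=set0).
  have [->|/set0P A0] := eqVneq A set0; first by left; left.
  have [AT|/set0P AT] := eqVneq (~` A) set0; last by right.
  by left; right; rewrite -[A]setCK AT setC0.
have [t1|[A10 A1T]] := dich A1; first by apply: trivial; apply: trivial_event => //; exact: ltW.
have [t2|[A20 A2T]] := dich A2.
  apply: trivial; rewrite joint_probC ![event_prob X A1 _ * _]mulrC.
  by apply: trivial_event => //; exact: ltW.
pose c := Num.sqrt kappa.
have c2 : c ^+ 2 = kappa by rewrite sqr_sqrtr.
have Kc i j : i \in I1 -> j \in I2 -> cov_kernel X i j <= c ^+ 2.
  by move=> iI jI; rewrite c2 (le_trans (ler_norm _))// le_block_norm.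
have Kc' i j : i \in I1 -> j \in I2 -> - c ^+ 2 <= cov_kernel X i j.
  by move=> iI jI; rewrite c2 lerNl (le_trans (ler_norm _))// normrN le_block_norm.
have d0 : 0 < eps / 3 by rewrite divr_gt0.
have d3 : 3 * (eps / 3) = eps by field.
have r36 : 4 * (c ^+ 2 / (eps / 3) ^+ 2) = 36 * kappa / eps ^+ 2.
  by rewrite c2; field; rewrite gt_eqF.
split; [|split; [|move=> K0; split]].
- apply: upperP; rewrite lerBlDl -r36 -{1 2}d3.
  exact: (joint_prob_le gX b1 i1 s1 b2 i2 s2 A10 A1T A20 A2T d0 Kc).
- apply: lowerP; rewrite lerBlDl -r36 -{1 2}d3.
  exact: (joint_prob_ge gX b1 i1 s1 b2 i2 s2 A10 A1T A20 A2T d0 Kc').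
- apply: upperP; rewrite mul1r ler_pdivlMr// mulrC -c2.
  exact: (joint_prob_le_positive gX b1 i1 s1 b2 i2 s2 A10 A1T A20 A2T eps0 K0 Kc).
- apply: lowerP; rewrite !mul0r subr_le0.
  exact: (joint_prob_ge_positive gX b1 i1 s1 b2 i2 s2 A10 A1T A20 A2T eps0 K0).
Qed.
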